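(* Let $n\ge 1$, $\omega>0$, $s>\frac n2$ and $\sigma>0$. Then the function $\phi_\omega$ defined by $$\hat{\phi}_\omega(\xi)= \left(\int_{\mathbb R^n} \frac{1}{(2\pi|\eta|)^{2s}+\omega}\, d\eta\right)^{-(1+\frac{1}{2\sigma})} \frac{1}{(2\pi|\xi|)^{2s}+\omega},$$ or, equivalently, by $$\phi_\omega(x)= \frac{\mathcal G_s^\omega(x)}{(\mathcal G_s^\omega(0))^{1+\frac{1}{2\sigma}}},$$ is a weak solution of the profile equation $$(-\Delta)^s \phi+\omega \phi - |\phi(0)|^{2\sigma} \phi(0)\, \delta_0=0 \quad\text{on } \mathbb R^n.$$
   Context: Fourier transform: $\hat f(\xi)=\int_{\mathbb R^n} f(x)e^{-2\pi i x\cdot\xi}dx$, $f(x)=\int_{\mathbb R^n}\hat f(\xi)e^{2\pi i x\cdot \xi}d\xi$; $\widehat{(-\Delta)^s f}(\xi)=(2\pi|\xi|)^{2s}\hat f(\xi)$ for $s>0$. For $\lambda>0$, $s>0$, $\mathcal G_s^\lambda$ is defined by $\widehat{\mathcal G_s^\lambda}(\xi)=\frac{1}{(2\pi|\xi|)^{2s}+\lambda}$; for $s>n/2$ it belongs to $H^s(\mathbb R^n)\subset C(\mathbb R^n)$. $\delta_0$ is the Dirac mass at the origin. A continuous real-valued $\phi\in H^s(\mathbb R^n)$ is a weak solution of the profile equation if $\langle(-\Delta)^{s/2}\phi,(-\Delta)^{s/2}\psi\rangle+\omega\langle\phi,\psi\rangle-|\phi(0)|^{2\sigma}\phi(0)\psi(0)=0$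 for all test functions $\psi$, where $\langle f,g\rangle=\int_{\mathbb R^n} fg\,dx$. *)

(* Defs.v *)
From HB Require Import structures.
From mathcomp Require Import all_boot all_order all_algebra.
From mathcomp Require Import all_classical all_reals all_analysis.
From mathcomp Require Import complex.

Set Implicit Arguments.
Unset Strict Implicit.
Unset Printing Implicit Defensive.
Import Order.TTheory GRing.Theory Num.Theory.
Import numFieldNormedType.Exports.
Local Open Scope classical_set_scope.
Local Open Scope ring_scope.
Local Open Scope complex_scope.

(* The sigma-algebra generated by the coordinates, i.e. the Borel
   sigma-algebra of R^n. *)
Section measurable_rV.
Context (R : realType) (n : nat).

Let coors : 'I_n -> 'rV[R]_n -> measurableTypeR R := fun i x => x ord0 i.

Let rV_set0 : g_sigma_preimage coors set0.
Proof. exact: sigma_algebra0. Qed.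

Let rV_setC A : g_sigma_preimage coors A -> g_sigma_preimage coors (~` A).
Proof. exact: sigma_algebraC. Qed.

Let rV_bigcup (F : (set 'rV[R]_n)^nat) :
  (forall i, g_sigma_preimage coors (F i)) ->
  g_sigma_preimage coors (\bigcup_i (F i)).
Proof. exact: sigma_algebra_bigcup. Qed.

HB.instance Definition _ := @isMeasurable.Build
  (measure_tuple_display default_measure_display)
  'rV[R]_n (g_sigma_preimage coors) rV_set0 rV_setC rV_bigcup.

Lemma measurable_coord (i : 'I_n) :
  measurable_fun [set: 'rV[R]_n] (fun x : 'rV[R]_n => x ord0 i : measurableTypeR R).
Proof.
move=> _ Y mY; rewrite setTI; apply: sub_sigma_algebra => /=.
rewrite -bigcup_seq/=; exists i => /=; first by rewrite mem_index_enum.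
by exists Y => //; rewrite setTI.
Qed.

Lemma measurable_fun_coordP d (T : measurableType d) (f : T -> 'rV[R]_n) :
  (forall i, measurable_fun [set: T]
    (fun x => f x ord0 i : measurableTypeR R)) ->
  measurable_fun [set: T] f.
Proof.
move=> mf.
have prefS : g_sigma_preimage (fun i => coors i \o f) `<=` measurable.
  apply: smallest_sub; first exact: sigma_algebra_measurable.
  move=> A; rewrite -bigcup_seq => -[i _ [B mB <-]].
  exact: mf.
move=> _ A mA; apply: prefS; rewrite g_sigma_preimage_comp.
by exists A.
Qed.

End measurable_rV.

Section cons_measure.
Context (R : realType) (n : nat).

Definition cons_rV (p : measurableTypeR R * 'rV[R]_n) : 'rV[R]_n.+1 :=
  row_mx (p.1 : R)%:M p.2.

Definition uncons_rV (v : 'rV[R]_n.+1) : measurableTypeR R * 'rV[R]_n :=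
  (v ord0 ord0, \row_j v ord0 (lift ord0 j)).

Lemma cons_rVK : cancel cons_rV uncons_rV.
Proof.
move=> [x v]; rewrite /uncons_rV /cons_rV /=; congr pair.
  have -> : ord0 = lshift n (ord0 : 'I_1) :> 'I_(1 + n) by exact: val_inj.
  by rewrite [LHS](@row_mxEl R 1 1 n) mxE.
apply/rowP => j; rewrite mxE.
have -> : lift ord0 j = rshift 1 j :> 'I_(1 + n) by exact: val_inj.
by rewrite [LHS](@row_mxEr R 1 1 n).
Qed.

Lemma measurable_cons_rV : measurable_fun setT cons_rV.
Proof.
apply: measurable_fun_coordP => i.
have [j ->|j ->] := @split_ordP 1 n i.
  apply: (eq_measurable_fun fst) => //.
  by move=> [x v] _; rewrite /cons_rV [RHS](@row_mxEl R 1 1 n) (ord1 j) mxE.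
apply: (eq_measurable_fun
  ((fun v : 'rV[R]_n => v ord0 j : measurableTypeR R) \o snd)).
  by move=> [x v] _; rewrite /cons_rV [RHS](@row_mxEr R 1 1 n).
by apply: measurableT_comp => //; exact: measurable_coord.
Qed.

Lemma measurable_uncons_rV : measurable_fun setT uncons_rV.
Proof.
apply/measurable_fun_pairP; split; first exact: measurable_coord.
apply: measurable_fun_coordP => i.
apply: (eq_measurable_fun
  (fun v : 'rV[R]_n.+1 => v ord0 (lift ord0 i) : measurableTypeR R)).
  by move=> v _; rewrite /= mxE.
exact: measurable_coord.
Qed.

Variable mu : {sigma_finite_measure set 'rV[R]_n -> \bar R}.

Definition cons_measure : set 'rV[R]_n.+1 -> \bar R :=
  pushforward (@lebesgue_measure R \x mu)%E cons_rV.

Let cons_measure0 : cons_measure set0 = 0%E.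
Proof. by rewrite /cons_measure /pushforward preimage_set0 measure0. Qed.

Let cons_measure_ge0 A : (0 <= cons_measure A)%E.
Proof. by rewrite /cons_measure /pushforward measure_ge0. Qed.

Let cons_measure_sigma_additive : semi_sigma_additive cons_measure.
Proof.
move=> F mF tF mUF; rewrite /cons_measure /pushforward preimage_bigcup.
apply: measure_semi_sigma_additive.
- by move=> k; rewrite -[X in measurable X]setTI; exact: measurable_cons_rV.
- apply/trivIsetP => /= i j _ _ ij; rewrite -preimage_setI.
  by move/trivIsetP : tF => /(_ _ _ _ _ ij) ->//; rewrite preimage_set0.
- by rewrite -preimage_bigcup -[X in measurable X]setTI;
     exact: measurable_cons_rV.
Qed.

HB.instance Definition _ := isMeasure.Build _ _ _ cons_measure
  cons_measure0 cons_measure_ge0 cons_measure_sigma_additive.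

Let cons_measure_sigma_finite : sigma_finite setT cons_measure.
Proof.
have /sigma_finiteP[F [TF ndF Foo]] := sigma_finiteT (@lebesgue_measure R).
have /sigma_finiteP[G [TG ndG Goo]] := sigma_finiteT mu.
exists (fun k => uncons_rV @^-1` (F k `*` G k)).
  apply/esym/seteqP; split => // v _.
  have [i _ Fi] : (\bigcup_i F i) (uncons_rV v).1 by rewrite -TF.
  have [j _ Gj] : (\bigcup_i G i) (uncons_rV v).2 by rewrite -TG.
  exists (maxn i j) => //; split.
  - by move: Fi; exact/subsetPset/ndF/leq_maxl.
  - by move: Gj; exact/subsetPset/ndG/leq_maxr.
move=> k; have [mF Fk] := Foo k; have [mG Gk] := Goo k; split.
  rewrite -[X in measurable X]setTI; apply: measurable_uncons_rV => //.
  exact: measurableX.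
rewrite /cons_measure /pushforward -comp_preimage.
rewrite (_ : uncons_rV \o cons_rV = id); last first.
  by apply/funext => p; exact: cons_rVK.
rewrite preimage_id product_measure1E// lte_mul_pinfty//.
by rewrite ge0_fin_numE.
Qed.

HB.instance Definition _ := Measure_isSigmaFinite.Build _ _ _ cons_measure
  cons_measure_sigma_finite.

End cons_measure.

(* n-dimensional Lebesgue measure, as an iterated product measure *)
Fixpoint lebesgue_rV (R : realType) (n : nat) :
    {sigma_finite_measure set 'rV[R]_n -> \bar R} :=
  match n with
  | 0 => \d_(0 : 'rV[R]_0)
  | m.+1 => cons_measure (lebesgue_rV R m)
  end.

Section fourier.
Context {R : realType} {n : nat}.
Local Notation E := 'rV[R]_n.
Local Notation mu := (lebesgue_rV R n).
Implicit Types (f g : E -> R[i]) (x y xi : E) (phi psi : E -> R) (s lam : R).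

Definition dotv x y : R := \sum_(i < n) x ord0 i * y ord0 i.

(* The Euclidean norm; the library norm `|x| on 'rV[R]_n is the sup norm. *)
Definition enorm x : R := Num.sqrt (dotv x x).

Definition expi (t : R) : R[i] := cos t +i* sin t.

Definition Cfun phi : E -> R[i] := fun x => (phi x)%:C.

Definition Cintegral f : R[i] :=
  (\int[mu]_x complex.Re (f x)) +i* (\int[mu]_x complex.Im (f x)).

Definition L1 f : Prop :=
  mu.-integrable setT (fun x => (complex.Re (f x))%:E) /\
  mu.-integrable setT (fun x => (complex.Im (f x))%:E).

Definition sqnorm2 f : \bar R := (\int[mu]_x (Normc.normc (f x) ^+ 2)%:E)%E.

Definition L2 f : Prop :=
  [/\ measurable_fun setT (fun x => complex.Re (f x)),
      measurable_fun setT (fun x => complex.Im (f x)) &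
      (sqnorm2 f < +oo)%E].

(* bilinear, without complex conjugation *)
Definition pairing f g : R[i] := Cintegral (fun x => f x * g x).

(* absolutely convergent only for f in L^1; junk otherwise *)
Definition fourier1 f : E -> R[i] :=
  fun xi => Cintegral (fun x => f x * expi (- (2 * pi * dotv x xi))).

(* g is (a.e. equal to) the Fourier transform of f in the L^2 sense: the
   continuous extension to L^2 of the integral formula on L^1 /\ L^2. *)
Definition is_fourier f g : Prop :=
  [/\ L2 f, L2 g &
      exists F : nat -> E -> R[i],
        [/\ forall k, L1 (F k) /\ L2 (F k),
            sqnorm2 (fun x => F k x - f x) @[k --> \oo] --> 0%E &
            sqnorm2 (fun xi => fourier1 (F k) xi - g xi) @[k --> \oo] --> 0%E]].

(* a representative of the L^2 Fourier transform of f; 0 if there is none *)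
Definition fourier f : E -> R[i] := xget (fun=> 0) [set g | is_fourier f g].

(* a representative of (-Delta)^s f when f and (-Delta)^s f are in L^2;
   0 if there is none *)
Definition fraclap s f : E -> R[i] :=
  xget (fun=> 0)
    [set u | is_fourier u
      (fun xi => ((2 * pi * enorm xi) `^ (2 * s))%:C * fourier f xi)].

Definition sobolev s f : Prop :=
  exists2 g, is_fourier f g &
    (\int[mu]_xi (((1 + (2 * pi * enorm xi) ^+ 2) `^ s *
                   Normc.normc (g xi) ^+ 2)%:E) < +oo)%E.

Fixpoint iter_derive (vs : seq E) phi : E -> R :=
  if vs is v :: vs' then 'D_v (iter_derive vs' phi) else phi.

Definition smooth phi : Prop :=
  forall (vs : seq E) x, differentiable (iter_derive vs phi) x.

Definition test_function phi : Prop :=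
  smooth phi /\ compact (closure [set x | phi x != 0]).

(* phi is the continuous real-valued function with Fourier transform h. *)
Definition has_transform phi (h : E -> R) : Prop :=
  continuous phi /\ is_fourier (Cfun phi) (Cfun h).

Definition resolvent_symbol s lam : E -> R :=
  fun xi => ((2 * pi * enorm xi) `^ (2 * s) + lam)^-1.

Definition green s lam : E -> R :=
  xget (fun=> 0) [set G | has_transform G (resolvent_symbol s lam)].

Definition profile_transform s omega sigma : E -> R :=
  fun xi =>
    (\int[mu]_eta resolvent_symbol s omega eta) `^ (- (1 + (2 * sigma)^-1)) *
    resolvent_symbol s omega xi.

Definition weak_solution s omega sigma phi : Prop :=
  [/\ continuous phi, sobolev s (Cfun phi) &
      forall psi, test_function psi ->
        pairing (fraclap (s / 2) (Cfun phi)) (fraclap (s / 2) (Cfun psi)) +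
        omega%:C * pairing (Cfun phi) (Cfun psi) -
        (`|phi 0| `^ (2 * sigma) * phi 0 * psi 0)%:C = 0].

End fourier.

(* Main.v *)
(** The resolvent symbol [r] is positive, even, integrable and square
  integrable because [s > n/2], so the Green function is the cosine transform
  of [r] and its value at the origin is the integral [I] of [r].  For a test
  function [psi], Parseval's identity turns the two pairings of the weak
  equation with [phi = c G] into the integral of
  [(|2 pi xi|^(2s) + omega) c r psi^], which is [c] times the integral of the
  transform [psi^] of [psi], that is [c psi(0)].  The nonlinear term is
  [(c I)^(2 sigma + 1) psi(0)], and [c = I^-(1 + 1/(2 sigma))] is exactly the
  solution of [(c I)^(2 sigma + 1) = c].

  Fourier inversion and Plancherel's theorem are obtained by summing with the
  kernel [exp(-|x_1| - ... - |x_n|)]: its transform, a product of one-dimensional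
  Poisson kernels, has an elementary antiderivative in each variable.  That every
  square-integrable function is a transform, hence that the fractional Laplacians
  exist, follows from Plancherel on truncations and the Riesz-Fischer theorem. *)

Require Import Defs.
From HB Require Import structures.
From mathcomp Require Import all_boot all_order all_algebra.
From mathcomp Require Import all_classical all_reals all_analysis.
From mathcomp Require Import complex measurable_realfun.
From mathcomp Require Import ring lra.

Set Implicit Arguments.
Unset Strict Implicit.
Unset Printing Implicit Defensive.
Import Order.TTheory GRing.Theory Num.Theory.
Import numFieldNormedType.Exports.
Local Open Scope classical_set_scope.
Local Open Scope ring_scope.

(** * Lebesgue measure on R^n *)

Section affine1.
Context {R : realType}.
Local Notation lam := (@lebesgue_measure R).

(** [fourier], [fraclap] and [green] are chosen by [xget] and fall back on 0, so each needs a proof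
    of existence before any computation. Moreover [is_fourier] is a graph defined by L^2 limits: it
    determines values only almost everywhere, and pointwise equalities have to come from continuity.
    The kernel is a product because [lebesgue_rV] is an iterated product, so kernel integrals are
    inductions on the dimension. Its transform decays only quadratically in each variable, but it is
    positive, bounded and of mass one, which suffices for dominated convergence. Plancherel then
    reduces to continuity at 0 of the autocorrelation, that is, to continuity of translations in
    L^2. A further obstacle is that the transform of a test function has to be absolutely
    integrable. Derivatives of [psi] only give finite moments of its power spectrum; the bound |y|
    <= r + y^2 / r, with the resolvent symbol r itself as weight, turns them into integrability, so
    s > n/2 is used a second time there. *)

Lemma measurable_affine (c a : R) :
  measurable_fun setT (fun t : R => c * t + a).
Proof. by apply: measurable_funD => //; exact: measurable_funM. Qed.

(** By uniqueness of Lebesgue measure: [|c|] times the image of [lam] under the map agrees with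
    [lam] on half-open intervals. For [c < 0] the preimage is closed at the other end, with the same
    length. *)
Lemma lebesgue_measure_affine (c a : R) (A : set R) : c != 0 -> measurable A ->
  lam ((fun t : R => c * t + a) @^-1` A) = (`|c|^-1%:E * lam A)%E.
Proof.
move=> c0 mA.
have nc0 : `|c| != 0 by rewrite normr_eq0.
have nn : 0 <= `|c| by [].
pose phi : measurableTypeR R -> measurableTypeR R := fun t => c * t + a.
have mphi : measurable_fun setT phi by exact: measurable_affine.
suff -> : lam A = (`|c|%:E * lam (phi @^-1` A))%E.
  by rewrite muleA -EFinM mulVf// mul1e.
apply: (@lebesgue_measure_unique R (mscale (NngNum nn) (pushforward lam phi))) => //=.
move=> _ [[x y] _ <-] /=.
rewrite /mscale /= /pushforward /=.
have [c_gt0|c_lt0|/eqP] := ltrgtP 0 c; last by rewrite eq_sym (negbTE c0).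
- rewrite (_ : phi @^-1` _ = `](x - a) / c, (y - a) / c]%classic); last first.
    apply/seteqP; split => t /=; rewrite !in_itv/= /phi ltr_pdivrMr// ler_pdivlMr//;
    by rewrite ltrBlDr lerBrDr mulrC.
  rewrite !lebesgue_measure_itv/= !lte_fin ltr_pM2r ?invr_gt0// ltrD2r.
  case: ifPn => _; last by rewrite mule0.
  rewrite -!EFinB -EFinM; congr EFin; rewrite gtr0_norm//; field.
  by rewrite gt_eqF.
- rewrite (_ : phi @^-1` _ = `[(y - a) / c, (x - a) / c[%classic); last first.
    apply/seteqP; split => t /=; rewrite !in_itv/= /phi ltr_ndivlMr// ler_ndivrMr//;
    by rewrite ltrBlDr lerBrDr mulrC andbC.
  rewrite !lebesgue_measure_itv/= !lte_fin ltr_nM2r ?invr_lt0// ltrD2r.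
  case: ifPn => _; last by rewrite mule0.
  rewrite -!EFinB -EFinM; congr EFin; rewrite ltr0_norm//; field.
  by rewrite lt_eqF.
Qed.

Lemma ge0_integral_affine1 (c a : R) (f : R -> \bar R) : c != 0 ->
  measurable_fun setT f -> (forall t, 0 <= f t)%E ->
  (\int[lam]_t f (c * t + a)%R = `|c|^-1%:E * \int[lam]_t f t)%E.
Proof.
move=> c0 mf f0.
pose phi : measurableTypeR R -> measurableTypeR R := fun t => c * t + a.
have mphi : measurable_fun setT phi by exact: measurable_affine.
transitivity (\int[lam]_(t in phi @^-1` setT) (f \o phi) t)%E.
  by rewrite preimage_setT.
rewrite -ge0_integral_pushforward//.
have nn : 0 <= `|c|^-1 by rewrite invr_ge0.
rewrite -[`|c|^-1]/((NngNum nn)%:num) -ge0_integral_mscale//.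
apply: eq_measure_integral => A mA _ /=.
by rewrite /mscale /= -(lebesgue_measure_affine a c0 mA).
Qed.

End affine1.

Section lebesgue_rV.
Context {R : realType}.
Implicit Types n : nat.
Local Notation lam := (@lebesgue_measure R).
Local Notation mu := (lebesgue_rV R).

Lemma cons_rV_ord0 n (t : R) (v : 'rV[R]_n) : cons_rV (t, v) ord0 ord0 = t.
Proof. by have [] := cons_rVK (t, v). Qed.

Lemma cons_rV_lift n (t : R) (v : 'rV[R]_n) j :
  cons_rV (t, v) ord0 (lift ord0 j) = v ord0 j.
Proof. by have [_ /rowP/(_ j)] := cons_rVK (t, v); rewrite mxE. Qed.

Lemma ge0_integral_rVS n (f : 'rV[R]_n.+1 -> \bar R) :
  measurable_fun setT f -> (forall x, 0 <= f x)%E ->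
  (\int[mu n.+1]_x f x = \int[lam]_t \int[mu n]_v f (cons_rV (t, v)))%E.
Proof.
move=> mf f0.
transitivity (\int[pushforward (lam \x mu n)%E (@cons_rV R n)]_x f x)%E.
  by [].
rewrite ge0_integral_pushforward//; last exact: measurable_cons_rV.
rewrite preimage_setT (@fubini_tonelli1 _ _ _ _ _ lam (mu n))//; last first.
  by move=> x; exact: f0.
by apply: measurableT_comp => //; exact: measurable_cons_rV.
Qed.

Lemma lebesgue_rV0 (f : 'rV[R]_0 -> \bar R) :
  measurable_fun setT f -> (\int[mu 0]_x f x = f 0%R)%E.
Proof. by move=> mf; rewrite [LHS]integral_dirac ?diracT ?mul1e. Qed.

Lemma measurable_affine_rV n (c : R) (a : 'rV[R]_n) :
  measurable_fun setT (fun x : 'rV[R]_n => c *: x + a).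
Proof.
apply: measurable_fun_coordP => i.
apply: (eq_measurable_fun (fun x : 'rV[R]_n => c * x ord0 i + a ord0 i)).
  by move=> x _; rewrite !mxE.
exact: (measurableT_comp (measurable_affine c (a ord0 i)) (measurable_coord i)).
Qed.

(** Induction on the dimension: the map acts on each coordinate separately with the same factor, so
    every coordinate contributes one [|c|^-1]. Translations are the case [c = 1], the reflection is
    [c = -1]. *)
Lemma ge0_integral_affine n (c : R) (a : 'rV[R]_n) (f : 'rV[R]_n -> \bar R) :
  c != 0 -> measurable_fun setT f -> (forall x, 0 <= f x)%E ->
  (\int[mu n]_x f (c *: x + a)%R = (`|c| ^- n)%:E * \int[mu n]_x f x)%E.
Proof.
move=> c0; elim: n a f => [|n IH] a f mf f0.
  rewrite !lebesgue_rV0 ?expr0 ?invr1 ?mul1e; first by congr f; apply/rowP => -[].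
    by [].
  exact: (measurableT_comp mf (measurable_affine_rV c a)).
have mcons := @measurable_cons_rV R n.
have mfc : measurable_fun setT (f \o @cons_rV R n) by exact: measurableT_comp.
rewrite ge0_integral_rVS//; last first.
  exact: (measurableT_comp mf (measurable_affine_rV c a)).
rewrite [in RHS]ge0_integral_rVS//.
pose a0 := a ord0 ord0; pose a' := \row_j a ord0 (lift ord0 j).
have E t v : c *: cons_rV (t, v) + a = cons_rV (c * t + a0, c *: v + a').
  apply/rowP => i; rewrite mxE [_ ord0 i]mxE.
  have [j|] := unliftP ord0 i => ->; rewrite ?cons_rV_ord0 ?cons_rV_lift//.
  by rewrite !mxE.
pose g t := (\int[mu n]_v f (cons_rV (t, v)))%E.
transitivity (\int[lam]_t ((`|c| ^- n)%:E * g (c * t + a0)%R))%E.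
  apply: eq_integral => t _; under eq_integral => v _ do rewrite E.
  rewrite (IH a' (fun v => f (cons_rV ((c * t + a0)%R, v))))//.
  exact: (measurableT_comp mfc (pair1_measurable (c * t + a0 : measurableTypeR R))).
have mg : measurable_fun setT g.
  apply: (measurable_fun_fubini_tonelli_F (m2 := mu n) (f \o @cons_rV R n)) => //.
  by move=> x; exact: f0.
have g0 t : (0 <= g t)%E by exact: integral_ge0.
have mh := measurableT_comp mg (measurable_affine c a0).
have cn0 : (0 <= (`|c| ^- n)%:E)%E by rewrite lee_fin invr_ge0 exprn_ge0.
rewrite (ge0_integralZl lam measurableT mh (fun t _ => g0 (c * t + a0)) cn0).
rewrite ge0_integral_affine1// muleA -EFinM; congr (_%:E * _)%E.
by rewrite exprS invfM mulrC.
Qed.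

Lemma measurable_prod_rV n (f : R -> R) : measurable_fun setT f ->
  measurable_fun setT (fun x : 'rV[R]_n => \prod_(i < n) f (x ord0 i)).
Proof.
move=> mf; apply: measurable_prod => i _.
exact: (measurableT_comp mf (measurable_coord i)).
Qed.

Lemma integral_prod_rV n (f : R -> R) (c : R) : measurable_fun setT f ->
  (forall t, 0 <= f t) -> (\int[lam]_t (f t)%:E = c%:E)%E ->
  (\int[mu n]_x (\prod_(i < n) f (x ord0 i))%:E = (c ^+ n)%:E)%E.
Proof.
move=> mf f0 fc; have c0 : 0 <= c.
  by rewrite -lee_fin -fc integral_ge0// => t _; rewrite lee_fin.
elim: n => [|n IH].
  rewrite lebesgue_rV0; first by rewrite big_ord0.
  by apply/measurable_EFinP; exact: measurable_prod_rV.
rewrite ge0_integral_rVS; last 2 first.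
- by apply/measurable_EFinP; exact: measurable_prod_rV.
- by move=> x; rewrite lee_fin prodr_ge0.
under eq_integral => t _.
  under eq_integral => v _.
    rewrite big_ord_recl cons_rV_ord0.
    under eq_bigr => i _ do rewrite cons_rV_lift.
    rewrite EFinM; over.
  rewrite ge0_integralZl//; last 3 first.
  - by apply/measurable_EFinP; exact: measurable_prod_rV.
  - by move=> x _; rewrite lee_fin prodr_ge0.
  - by rewrite lee_fin.
  rewrite IH muleC; over.
rewrite ge0_integralZl//.
- by rewrite fc -EFinM exprSr.
- exact/measurable_EFinP.
- by move=> t _; rewrite lee_fin.
- by rewrite lee_fin exprn_ge0.
Qed.

Lemma rV_ballP n (x y : 'rV[R]_n) (r : R) :
  ball x r y <-> 0 < r /\ forall i, `|x ord0 i - y ord0 i| < r.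
Proof.
split=> -[r0 H]; split=> //; first by move=> i; exact: H.
by move=> i j; rewrite (ord1 i); exact: H.
Qed.

Lemma measurable_rV_ball n (x : 'rV[R]_n) (r : R) : measurable (ball x r).
Proof.
have [r0|r0] := ltP 0 r; last first.
  rewrite (_ : ball x r = set0)//; apply/seteqP; split => // y /rV_ballP[].
  by rewrite ltNge r0.
rewrite (_ : ball x r = \bigcap_(i in [set: 'I_n])
    ((fun y : 'rV[R]_n => y ord0 i : measurableTypeR R) @^-1` ball (x ord0 i) r)).
  apply: fin_bigcap_measurable => // i _; rewrite -[X in measurable X]setTI.
  by apply: measurable_coord => //; exact: measurable_ball.
apply/seteqP; split => [y /rV_ballP[_ H] i _|y H]; first exact: H.
by apply/rV_ballP; split => // i; exact: H.
Qed.

(** The sigma-algebra is generated by the coordinates, so separability is what makes open sets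
    measurable: [U] is the union of the countably many cubes with rational centre and radius 1/(k+1)
    that it contains. Balls are cubes since the norm is the sup norm. *)
Lemma measurable_rV_open n (U : set 'rV[R]_n) : open U -> measurable U.
Proof.
move=> oU.
pose B (p : 'rV[rat]_n * nat) : set 'rV[R]_n :=
  ball (map_mx ratr p.1 : 'rV[R]_n) (p.2.+1%:R^-1).
have -> : U = \bigcup_p (if `[< B p `<=` U >] then B p else set0).
  apply/seteqP; split => [x Ux|x [p _]]; last by case: asboolP => // BU /BU.
  have /nbhs_ballP[e /= e0 eU] := open_nbhs_nbhs (conj oU Ux).
  (* A cube of radius below [e / 2] whose centre is that close to [x] lies in the ball of radius [e]
     around [x]. *)
  have [k ke] : exists k, k.+1%:R^-1 < e / 2.
    by have [k] := ltr_add_invr (divr_gt0 e0 (ltr0Sn R 1)); rewrite add0r; exists k.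
  have [q qx] : exists q : 'rV[rat]_n, forall i, `|ratr (q ord0 i) - x ord0 i| < k.+1%:R^-1.
    have Q i : exists q : rat, `|ratr q - x ord0 i| < k.+1%:R^-1.
      have : x ord0 i - k.+1%:R^-1 < x ord0 i + k.+1%:R^-1.
        by rewrite ltrD2l gtrN // invr_gt0.
      by move=> /rat_in_itvoo[q]; rewrite in_itv/= => q_; exists q; rewrite ltr_distl.
    have [f Hf] := choice Q.
    by exists (\row_i f i) => i; rewrite mxE.
  exists (q, k) => //; case: asboolP => [_|[]].
    by apply/rV_ballP; split; [rewrite invr_gt0|move=> i; rewrite mxE].
  move=> y /rV_ballP[_ Hy]; apply: eU; apply/rV_ballP; split => // i.
  have -> : x ord0 i - y ord0 i = (x ord0 i - ratr (q ord0 i)) + (ratr (q ord0 i) - y ord0 i).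
    by rewrite addrA subrK.
  rewrite (le_lt_trans (ler_normD _ _))// (splitr e) ltrD//.
    by rewrite distrC (lt_trans (qx i)).
  by have := Hy i; rewrite mxE => /lt_trans; apply.
apply: countable_bigcupT_measurable => [|p]; first exact: countableP.
by case: asboolP => // _; exact: measurable_rV_ball.
Qed.

Lemma continuous_measurable_rV n (f : 'rV[R]_n -> R) :
  continuous f -> measurable_fun setT f.
Proof.
move=> cf; apply: (measurability _ (RGenOpens.measurableE R)).
move=> _ [_ [a [b ->] <-]]; rewrite setTI.
apply: measurable_rV_open; apply: open_comp => //; exact: interval_open.
Qed.

(** Open sets are stable under finite intersections, so this equality makes Dynkin's induction from
    open sets available. *)
Lemma measurable_rV_openE n :
  @measurable _ 'rV[R]_n = <<s [set U : set 'rV[R]_n | open U] >>.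
Proof.
apply/seteqP; split; last first.
  apply: smallest_sub; first exact: sigma_algebra_measurable.
  by move=> U /measurable_rV_open.
apply: smallest_sub; first exact: smallest_sigma_algebra.
pose T := g_sigma_algebraType [set U : set 'rV[R]_n | open U].
move=> A; rewrite -bigcup_seq => -[i _ [B mB <-]].
suff : measurable_fun (setT : set T) (fun x : T => (x : 'rV[R]_n) ord0 i) by exact.
apply: (measurability _ (RGenOpens.measurableE R)).
move=> _ [_ [a [b ->] <-]]; rewrite setTI; apply: sub_sigma_algebra => /=.
apply: open_comp; last exact: interval_open.
by move=> x _; exact: coord_continuous.
Qed.

Lemma lebesgue_rV_ball n (x : 'rV[R]_n) (r : R) : 0 < r ->
  (mu n (ball x r) = ((2 * r) ^+ n)%:E)%E.
Proof.
move=> r0; have mb := measurable_rV_ball x r.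
rewrite -[LHS]mul1e -[in LHS](integral_cst (mu n) mb) integral_mkcond/=.
pose f : R -> R := \1_(ball (0 : R) r).
have mf : measurable_fun setT f by apply: measurable_indic; exact: measurable_ball.
have f0 t : 0 <= f t by rewrite /f indicE.
(* The factor 1 and the shift by [- x] give the integrand the form of an affine change of variables,
   which recentres the cube at 0. *)
transitivity (\int[mu n]_y (\prod_(i < n) f ((1 *: y - x) ord0 i))%:E)%E.
  apply: eq_integral => y _; rewrite patchE; case: ifPn.
    rewrite inE => /rV_ballP[_ H]; rewrite big1// => i _.
    by rewrite /f indicE mem_set// /ball/= sub0r normrN !mxE mul1r distrC.
  rewrite notin_setE => /rV_ballP nb.
  have /existsNP[i Hi] : ~ forall i, `|x ord0 i - y ord0 i| < r.
    by move=> H; exact: nb (conj r0 H).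
  rewrite (bigD1 i)//= /f indicE memNset ?mul0r//.
  by rewrite /ball/= sub0r normrN !mxE mul1r distrC.
rewrite (ge0_integral_affine (-x) (f := fun y => (\prod_(i < n) f (y ord0 i))%:E)) ?oner_neq0//.
- rewrite normr1 expr1n invr1 mul1e (@integral_prod_rV _ _ (2 * r))//.
  rewrite integral_indic ?setIT//; last exact: measurable_ball.
  by rewrite [LHS](lebesgue_measure_ball 0 (ltW r0)) mulr_natl.
- by apply/measurable_EFinP; exact: measurable_prod_rV.
- by move=> y; rewrite lee_fin prodr_ge0.
Qed.

Lemma lebesgue_rV_open_gt0 n (U : set 'rV[R]_n) :
  open U -> U !=set0 -> (0 < mu n U)%E.
Proof.
move=> oU [x Ux].
have /nbhs_ballP[e /= e0 eU] := open_nbhs_nbhs (conj oU Ux).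
apply: (@lt_le_trans _ _ (mu n (ball x e))).
  by rewrite lebesgue_rV_ball// lte_fin exprn_gt0// mulr_gt0.
apply: le_measure => //; rewrite inE; first exact: measurable_rV_ball.
exact: measurable_rV_open.
Qed.

(** The set where the functions differ is open, and nonempty open sets have positive measure. This
    turns almost everywhere uniqueness of transforms into pointwise equality. *)
Lemma ae_eq_continuous n (f g : 'rV[R]_n -> R) : continuous f -> continuous g ->
  {ae mu n, forall x, f x = g x} -> f = g.
Proof.
move=> cf cg [N [mN N0 fgN]]; apply/funext => x; apply/eqP/negPn/negP => fgx.
pose U := [set y | f y != g y].
have oU : open U.
  rewrite (_ : U = (f \- g) @^-1` [set~ 0]).
    apply: open_comp => [y _|]; last exact/closed_openC/closed_eq.
    by apply: continuousB; [exact: cf|exact: cg].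
  by apply/seteqP; split => y /=; rewrite /U /= -subr_eq0 => /eqP.
have := lebesgue_rV_open_gt0 oU (ex_intro _ x fgx).
suff : (mu n U <= 0)%E by rewrite leNgt => /negP.
rewrite -N0; apply: le_measure; rewrite ?inE//; first exact: measurable_rV_open.
by apply: subset_trans fgN => y /= /eqP.
Qed.

End lebesgue_rV.

(** * The summation kernel *)

Section one_dim.
Context {R : realType}.
Local Notation lam := (@lebesgue_measure R).

(** The derivative is an unknown [d] with [d = f x]: it can be synthesized from the shape of [F] and
    compared with [f] afterwards, by algebra alone. *)
Lemma even_integral_FTC (f F : R -> R) (l : R) :
  (forall x, 0 <= f x) -> continuous f -> (forall x, f (- x) = f x) ->
  (forall x : R, 0 <= x -> exists2 d, is_derive x 1 F d & d = f x) -> F x @[x --> +oo] --> l ->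
  (\int[lam]_x (f x)%:E = (2 * (l - F 0))%:E)%E.
Proof.
move=> f0 cf evf dF Fl; rewrite ge0_symfun_integralT//; last first.
  by move=> x; rewrite /= evf.
rewrite (_ : [set x | _] = `[0, +oo[%classic); last first.
  by apply/seteqP; split => x/=; rewrite in_itv/= andbT.
rewrite (ge0_continuous_FTC2y (l := l) (F := F))//.
- exact: continuous_subspaceT.
- by move=> x x0; have [d []] := dF x (ltW x0).
- apply: cvg_at_right_filter; apply: differentiable_continuous.
  by apply/derivable1_diffP; have [d []] := dF 0 (lexx _).
- by move=> x; rewrite in_itv/= andbT => x0; rewrite derive1E; have [d [_ ->]] := dF x (ltW x0).
Qed.

Lemma cvgr_expR_bounded (g : R -> R) (M : R) : (forall x, `|g x| <= M) ->
  expR (- x) * g x @[x --> +oo] --> 0.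
Proof.
move=> gM.
have h1 : expR (- x) * M @[x --> +oo] --> 0.
  by rewrite -[X in _ --> X](mul0r M); apply: cvgM; [exact: cvgr_expR|exact: cvg_cst].
apply/norm_cvg0P; apply: (squeeze_cvgr _ (cvg_cst 0) h1).
by apply: nearW => x; rewrite normr_ge0/= normrM ger0_norm ?expR_ge0// ler_wpM2l ?expR_ge0.
Qed.

Let edecay_continuous : continuous (fun x : R => expR (- `|x|)).
Proof.
move=> x; apply: continuous_comp; last exact: continuous_expR.
by apply: continuousN; exact: norm_continuous.
Qed.

Lemma integral_edecay : (\int[lam]_x (expR (- `|x|))%:E = 2%:R%:E)%E.
Proof.
rewrite (@even_integral_FTC _ (fun x => - expR (- x)) 0)//.
- by rewrite oppr0 expR0 sub0r opprK mulr1.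
- by move=> x; rewrite normrN.
- move=> x x0; rewrite ger0_norm//.
  by eexists; first exact: is_deriveN; rewrite /GRing.scale/= mulrN1 opprK.
- by rewrite -[X in _ --> X]oppr0; apply: cvgN; exact: cvgr_expR.
Qed.

Lemma integrable_edecay : lam.-integrable setT (EFin \o (fun x : R => expR (- `|x|))).
Proof.
apply/integrableP; split.
  by apply/measurable_EFinP; exact: continuous_measurable_fun.
under eq_integral => x _ do rewrite /= ger0_norm ?expR_ge0//.
by rewrite integral_edecay ltry.
Qed.

Lemma continuous_cosM (a : R) : continuous (fun x => cos (a * x)).
Proof.
move=> x; apply: continuous_comp; last exact: continuous_cos.
exact: mulrl_continuous.
Qed.

Lemma continuous_sinM (a : R) : continuous (fun x => sin (a * x)).
Proof.
move=> x; apply: continuous_comp; last exact: continuous_sin.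
exact: mulrl_continuous.
Qed.

(** The summand 1 makes the integrand nonnegative, as [even_integral_FTC] requires;
    [Rintegral_edecay_cos] subtracts it again. *)
Lemma integral_edecay1cos (a : R) :
  (\int[lam]_x (expR (- `|x|) * (1 + cos (a * x)))%:E =
   (2 + 2 / (1 + a ^+ 2))%:E)%E.
Proof.
have cf : continuous (fun x : R => expR (- `|x|) * (1 + cos (a * x))).
  move=> x; apply: cvgM; first exact: edecay_continuous.
  by apply: cvgD; [exact: cvg_cst|exact: continuous_cosM].
have a1 : 1 + a ^+ 2 != 0 by rewrite gt_eqF// ltr_pwDl// sqr_ge0.
(* [expR (- x) * g x] is the antiderivative on the half-line: the -1 comes from the summand 1, the
   fraction from the cosine. *)
pose g x := (- 1 + (a * sin (a * x) - cos (a * x)) / (1 + a ^+ 2)).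
rewrite (@even_integral_FTC _ (fun x => expR (- x) * g x) 0)//.
- rewrite oppr0 expR0 mul1r /g mulr0 sin0 cos0; congr EFin; field.
  by rewrite ?[_ ^+ 2 + 1]addrC.
- by move=> x; rewrite normrN mulrN cosN.
- move=> x x0; rewrite ger0_norm// /g.
  eexists; first exact: is_deriveM; rewrite /GRing.scale/=; field.
  by rewrite ?[_ ^+ 2 + 1]addrC.
- apply: (@cvgr_expR_bounded _ (1 + (`|a| + 1) / (1 + a ^+ 2))) => x.
  rewrite (le_trans (ler_normD _ _))// normrN1 lerD// normrM.
  rewrite [X in _ * X]ger0_norm; last by rewrite invr_ge0 addr_ge0// sqr_ge0.
  rewrite ler_wpM2r//; first by rewrite invr_ge0 addr_ge0// sqr_ge0.
  rewrite (le_trans (ler_normB _ _))// lerD//; last by rewrite cos_max.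
  by rewrite normrM ler_piMr ?normr_ge0// sin_max.
Qed.

Lemma integrable_edecay_bounded (g : R -> R) (M : R) : measurable_fun setT g ->
  (forall x, `|g x| <= M) ->
  lam.-integrable setT (EFin \o (fun x : R => expR (- `|x|) * g x)).
Proof.
move=> mg gM.
have := integrableZl measurableT M integrable_edecay.
apply: le_integrable => //.
  apply/measurable_EFinP; apply: measurable_funM => //.
  exact: continuous_measurable_fun.
move=> x _ /=; rewrite lee_fin !normrM mulrC ler_wpM2r ?normr_ge0//.
by rewrite (le_trans (gM x))// ler_norm.
Qed.

Lemma Rintegral_edecay_cos (a : R) :
  (\int[lam]_x (expR (- `|x|) * cos (a * x)) = 2 / (1 + a ^+ 2))%R.
Proof.
have i1 := integrable_edecay.
have ic : lam.-integrable setT (EFin \o (fun x : R => expR (- `|x|) * cos (a * x))).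
  apply: (@integrable_edecay_bounded _ 1) => [|x]; last exact: cos_max.
  by apply: continuous_measurable_fun; exact: continuous_cosM.
have E : (\int[lam]_x (expR (- `|x|) + expR (- `|x|) * cos (a * x)) =
   2 + 2 / (1 + a ^+ 2))%R.
  rewrite /Rintegral -[RHS]/(fine (2 + 2 / (1 + a ^+ 2))%:E) -integral_edecay1cos.
  by congr fine; apply: eq_integral => x _; rewrite mulrDr mulr1.
move: E; rewrite RintegralD// {1}/Rintegral integral_edecay /= => /addrI.
by [].
Qed.

Lemma integral_poisson1 :
  (\int[lam]_x (2 / (1 + (2 * pi * x) ^+ 2))%:E = 1)%E.
Proof.
have P x : 1 + (2 * pi * x) ^+ 2 != 0 :> R by rewrite gt_eqF// ltr_pwDl// sqr_ge0.
have cf : continuous (fun x : R => 2 / (1 + (2 * pi * x) ^+ 2)).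
  move=> x; apply: cvgM; first exact: cvg_cst.
  apply: cvgV => //; apply: cvgD; first exact: cvg_cst.
  by rewrite expr2; apply: cvgM; exact: mulrl_continuous.
rewrite (@even_integral_FTC _ (fun x => pi^-1 * atan (2 * pi * x)) (1 / 2))//.
- by rewrite mulr0 atan0 mulr0 subr0 mul1r divff.
- by move=> x; rewrite mulr_ge0// invr_ge0 addr_ge0// sqr_ge0.
- by move=> x; rewrite mulrN sqrrN.
- move=> x x0; eexists; first exact: is_deriveM.
  have pi0 : pi != 0 :> R by rewrite gt_eqF// pi_gt0.
  rewrite /GRing.scale/=; move: (P x); move: (pi) pi0 => c c0 Px.
  by field; rewrite Px.
- rewrite (_ : 1 / 2 = pi^-1 * (pi / 2)); last first.
    by rewrite mulrA mulVf ?mul1r// gt_eqF// pi_gt0.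
  apply: cvgM; first exact: cvg_cst.
  have h : 2 * pi * x @[x --> +oo] --> (+oo : set_system R).
    apply/cvgryPge => A; near=> x; rewrite -ler_pdivrMl ?mulr_gt0 ?pi_gt0//.
  have := @cvg_comp _ _ _ (fun x : R => 2 * pi * x) (@atan R) _ _ _ h (@cvgy_atan R).
  exact.
Unshelve. all: by end_near. Qed.

(** One factor of the product that will dominate the resolvent symbol. Since [1 < p], the
    antiderivative has the negative exponent [1 - p] and vanishes at infinity. *)
Lemma integral_powR_decay (p : R) : 1 < p ->
  (\int[lam]_x ((1 + `|x|) `^ (- p))%:E = (2 / (p - 1))%:E)%E.
Proof.
move=> p1; have p10 : 1 - p != 0 by rewrite subr_eq0 lt_eqF.
have P (x : R) : 0 < 1 + `|x| by rewrite ltr_pwDl.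
have cf : continuous (fun x : R => (1 + `|x|) `^ (- p)).
  move=> x; apply: (@continuous_comp _ _ _ (fun x : R => 1 + `|x|) (fun y => y `^ (- p))).
    by apply: cvgD; [exact: cvg_cst|exact: norm_continuous].
  apply: differentiable_continuous; apply/derivable1_diffP.
  by have [] := is_derive1_powR (- p) (P x).
rewrite (@even_integral_FTC _ (fun x => (1 - p)^-1 * (1 + x) `^ (1 - p)) 0)//.
- rewrite addr0 powR1 mulr1; congr EFin; field.
  by rewrite p10 subr_eq0 gt_eqF.
- by move=> x; rewrite normrN.
- move=> x x0; rewrite ger0_norm//.
  have d1 : is_derive (1 + x) 1 (fun y : R => y `^ (1 - p)) ((1 - p) * (1 + x) `^ (1 - p - 1)).
    by apply: is_derive1_powR; rewrite ltr_pwDl.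
  have d2 : is_derive x 1 (fun x : R => 1 + x) 1.
    by have := is_deriveD (is_derive_cst (1 : R) x 1) (is_derive_id x 1); rewrite add0r.
  have d3 := @is_derive1_comp _ _ _ _ _ _ d1 d2.
  eexists; first exact: is_deriveM.
  rewrite /GRing.scale/= mulr1 mulrA mulVf// mul1r.
  by rewrite !mulr0 addr0; congr (_ `^ _); ring.
- rewrite -[X in _ --> X](mulr0 (1 - p)^-1); apply: cvgM; first exact: cvg_cst.
  rewrite (_ : (fun x => (1 + x) `^ (1 - p)) = (fun x => ((1 + x) `^ (p - 1))^-1)); last first.
    by apply/funext => x; rewrite -powRN opprB.
  apply/(@gtr0_cvgV0 _ _ _ _ (fun x : R => (1 + x) `^ (p - 1))).
    by near=> x; rewrite powR_gt0// ltr_pwDl//.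
  apply/cvgryPge => A; near=> x.
  have q0 : 0 < p - 1 by rewrite subr_gt0.
  apply: (@le_trans _ _ ((`|A| `^ (p - 1)^-1) `^ (p - 1))).
    by rewrite -powRrM mulVf ?gt_eqF// powRr1// ler_norm.
  apply: ge0_ler_powR; rewrite ?nnegrE ?powR_ge0 ?(ltW q0)//.
    by rewrite addr_ge0//.
  by rewrite (@le_trans _ _ x)// ?lerDr//.
Unshelve. all: by end_near. Qed.

End one_dim.

(** * Integrability of real-valued functions *)

Section real_integrable.
Context d (T : measurableType d) (R : realType).
Variable mu : {measure set T -> \bar R}.
Implicit Types f g : T -> R.
Local Notation Int f := (mu.-integrable setT (EFin \o f)).

Lemma Rint_measurable f : Int f -> measurable_fun setT f.
Proof. by move=> /(measurable_int mu)/measurable_EFinP. Qed.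

Lemma RintD f g : Int f -> Int g -> Int (fun x => f x + g x).
Proof. by move=> fi gi; have := integrableD measurableT fi gi; exact: eq_integrable. Qed.

Lemma RintB f g : Int f -> Int g -> Int (fun x => f x - g x).
Proof. by move=> fi gi; have := integrableB measurableT fi gi; exact: eq_integrable. Qed.

Lemma RintN f : Int f -> Int (fun x => - f x).
Proof. by move=> fi; have := integrableN fi; exact: eq_integrable. Qed.

Lemma RintZl f c : Int f -> Int (fun x => c * f x).
Proof. by move=> fi; have := integrableZl measurableT c fi; exact: eq_integrable. Qed.

Lemma RintZr f c : Int f -> Int (fun x => f x * c).
Proof. by move=> fi; have := integrableZr measurableT c fi; exact: eq_integrable. Qed.

Lemma le_Rint f g : measurable_fun setT f -> (forall x, `|f x| <= g x) ->
  Int g -> Int f.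
Proof.
move=> mf fg; apply: le_integrable => //; first exact/measurable_EFinP.
by move=> x _; rewrite /= lee_fin (le_trans (fg x))// ler_norm.
Qed.

Lemma RintM_bounded f g M : Int f -> measurable_fun setT g ->
  (forall x, `|g x| <= M) -> Int (fun x => f x * g x).
Proof.
move=> fi mg gM; have mf := Rint_measurable fi.
apply: le_Rint (RintZl M (integrable_norm fi)).
  exact: measurable_funM.
by move=> x /=; rewrite normrM mulrC ler_wpM2r.
Qed.

Lemma Rint_norm f : Int f -> Int (fun x => `|f x|).
Proof. by move=> fi; have := integrable_norm fi; exact: eq_integrable. Qed.

Lemma ge0_RintP f : measurable_fun setT f -> (forall x, 0 <= f x) ->
  Int f <-> (\int[mu]_x (f x)%:E < +oo)%E.
Proof.
move=> mf f0; have E : (\int[mu]_x `|(f x)%:E| = \int[mu]_x (f x)%:E)%E.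
  by apply: eq_integral => x _; rewrite /= ger0_norm.
split=> [/integrableP[_]|H]; first by rewrite E.
by apply/integrableP; split; [exact/measurable_EFinP|rewrite E].
Qed.

Lemma EFin_Rintegral f : Int f -> (\int[mu]_x f x)%:E = (\int[mu]_x (f x)%:E)%E.
Proof. by move=> fi; rewrite fineK//; exact: integrable_fin_num. Qed.

End real_integrable.

(** * Affine changes of variables in R^n *)

Section affine.
Context {R : realType} {n : nat}.
Local Notation mu := (lebesgue_rV R n).
Implicit Types (f : 'rV[R]_n -> R) (c : R) (a : 'rV[R]_n).

Lemma integrable_affine f c a : c != 0 -> mu.-integrable setT (EFin \o f) ->
  mu.-integrable setT (EFin \o (fun x => f (c *: x + a))).
Proof.
move=> c0 /integrableP[mf foo]; apply/integrableP; split.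
  exact: (measurableT_comp mf (measurable_affine_rV c a)).
rewrite (ge0_integral_affine a (f := fun x => `|(f x)%:E|%E))//.
  by rewrite lte_mul_pinfty// lee_fin invr_ge0 exprn_ge0.
exact: measurableT_comp.
Qed.

Lemma Rintegral_affine f c a : c != 0 -> mu.-integrable setT (EFin \o f) ->
  \int[mu]_x f (c *: x + a) = `|c| ^- n * \int[mu]_x f x.
Proof.
move=> c0 fi; have /integrableP[mf foo] := fi.
have cn : (0 <= (`|c| ^- n)%:E)%E by rewrite lee_fin invr_ge0 exprn_ge0.
rewrite /Rintegral integralE [in RHS]integralE.
have mp := measurable_funepos mf; have mn := measurable_funeneg mf.
have Ep : (\int[mu]_x (fun x => (f (c *: x + a))%:E)^\+ x =
    (`|c| ^- n)%:E * \int[mu]_x (EFin \o f)^\+ x)%E.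
  by rewrite -(ge0_integral_affine a c0 mp)//; apply: eq_integral => x _; rewrite !funeposE.
have En : (\int[mu]_x (fun x => (f (c *: x + a))%:E)^\- x =
    (`|c| ^- n)%:E * \int[mu]_x (EFin \o f)^\- x)%E.
  by rewrite -(ge0_integral_affine a c0 mn)//; apply: eq_integral => x _; rewrite !funenegE.
rewrite Ep En -muleBr//; last exact: integrable_add_def.
by rewrite fineM// -integralE; exact: integrable_fin_num.
Qed.

Lemma Rintegral_shift f a : mu.-integrable setT (EFin \o f) ->
  \int[mu]_x f (x + a) = \int[mu]_x f x.
Proof.
move=> fi; rewrite -[RHS]mul1r -[X in _ = X * _]invr1 -[X in _ = X^-1 * _](expr1n _ n).
rewrite -[X in X ^+ _]normr1 -(Rintegral_affine a (oner_neq0 _) fi).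
by apply: eq_Rintegral => x _; rewrite scale1r.
Qed.

Lemma Rintegral_opp f : mu.-integrable setT (EFin \o f) ->
  \int[mu]_x f (- x) = \int[mu]_x f x.
Proof.
move=> fi; rewrite -[RHS]mul1r -[X in _ = X * _]invr1 -[X in _ = X^-1 * _](expr1n _ n).
rewrite -[X in X ^+ _](normrN1 R) -(Rintegral_affine 0 _ fi) ?oppr_eq0 ?oner_neq0//.
by apply: eq_Rintegral => x _; rewrite scaleN1r addr0.
Qed.

Lemma ge0_integral_shift (f : 'rV[R]_n -> \bar R) a : measurable_fun setT f ->
  (forall x, 0 <= f x)%E -> (\int[mu]_x f (x + a)%R = \int[mu]_x f x)%E.
Proof.
move=> mf f0; rewrite -[RHS]mul1e.
have := ge0_integral_affine a (oner_neq0 _) mf f0.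
rewrite normr1 expr1n invr1 => <-.
by apply: eq_integral => x _; rewrite scale1r.
Qed.

Lemma ge0_integral_opp (f : 'rV[R]_n -> \bar R) : measurable_fun setT f ->
  (forall x, 0 <= f x)%E -> (\int[mu]_x f (- x)%R = \int[mu]_x f x)%E.
Proof.
move=> mf f0; rewrite -[RHS]mul1e.
have N1 : (-1 : R) != 0 by rewrite oppr_eq0 oner_neq0.
have := ge0_integral_affine 0 N1 mf f0.
rewrite normrN1 expr1n invr1 => <-.
by apply: eq_integral => x _; rewrite scaleN1r addr0.
Qed.

End affine.

Section integrable_rVS.
Context {R : realType} {n : nat}.
Local Notation lam := (@lebesgue_measure R).
Local Notation mu := (lebesgue_rV R).

Lemma integral_rVS (f : 'rV[R]_n.+1 -> \bar R) : (mu n.+1).-integrable setT f ->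
  (\int[mu n.+1]_x f x = \int[lam]_t \int[mu n]_v f (cons_rV (t, v)))%E.
Proof.
move=> fi; have /integrableP[mf foo] := fi.
have mc := @measurable_cons_rV R n.
have fci : (lam \x mu n)%E.-integrable setT (f \o @cons_rV R n).
  apply/integrableP; split; first exact: measurableT_comp.
  have mcf : measurable_fun setT (fun x => `|f x|%E) by exact: measurableT_comp.
  rewrite (fubini_tonelli1 (fun x => `|(f \o @cons_rV R n) x|%E))//; last first.
    by apply: (measurableT_comp mcf).
  by move: foo; rewrite ge0_integral_rVS.
transitivity (\int[pushforward (lam \x mu n)%E (@cons_rV R n)]_x f x)%E => //.
by rewrite integral_pushforward// preimage_setT -integral12_prod_meas1.
Qed.

End integrable_rVS.

(** * The product kernel and its Poisson transform *)

Section poisson.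
Context {R : realType}.
Local Notation lam := (@lebesgue_measure R).
Local Notation mu := (lebesgue_rV R).

(** Oddness, reduced to nonnegative integrands: the reflection exchanges 1 + sin and 1 - sin, whose
    weighted integrals are therefore equal. *)
Lemma Rintegral_edecay_sin (a : R) :
  (\int[lam]_x (expR (- `|x|) * sin (a * x)) = 0)%R.
Proof.
have i1 := @integrable_edecay R.
have msin : measurable_fun setT (fun x : R => sin (a * x)).
  by apply: continuous_measurable_fun; exact: continuous_sinM.
have mexp : measurable_fun setT (fun x : R => expR (- `|x|)).
  by have /measurable_EFinP := measurable_int _ i1.
have isn : lam.-integrable setT (EFin \o (fun x : R => expR (- `|x|) * sin (a * x))).
  by apply: (@integrable_edecay_bounded _ _ 1) => // x; exact: sin_max.
pose f (x : R) := (expR (- `|x|) * (1 + sin (a * x)))%:E.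
have mf : measurable_fun setT f.
  apply/measurable_EFinP; apply: measurable_funM => //.
  exact: measurable_funD.
have f0 x : (0 <= f x)%E.
  by rewrite lee_fin mulr_ge0 ?expR_ge0// -lerBlDl sub0r sin_geN1.
have N1 : (-1 : R) != 0 by rewrite oppr_eq0 oner_neq0.
have := ge0_integral_affine1 0 N1 mf f0.
rewrite normrN1 invr1 mul1e => /(congr1 fine).
rewrite (_ : fine (\int[lam]_t f t) = (\int[lam]_x (expR (- `|x|) + expR (- `|x|) * sin (a * x)))%R); last first.
  by congr fine; apply: eq_integral => x _; rewrite /f mulrDr mulr1.
rewrite (_ : fine _ = (\int[lam]_x (expR (- `|x|) - expR (- `|x|) * sin (a * x)))%R); last first.
  congr fine; apply: eq_integral => x _.
  by rewrite /f addr0 mulN1r normrN mulrN sinN mulrDr mulr1 mulrN.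
rewrite RintegralB// RintegralD// => /addrI /esym /eqP.
by rewrite -addr_eq0 -mulr2n mulrn_eq0 => /eqP.
Qed.

Lemma integral_edecay_phase (a b : R) :
  (\int[lam]_x (expR (- `|x|) * cos (a * x + b))%:E =
   (2 / (1 + a ^+ 2) * cos b)%:E)%E.
Proof.
have msin : measurable_fun setT (fun x : R => sin (a * x)).
  by apply: continuous_measurable_fun; exact: continuous_sinM.
have mcos : measurable_fun setT (fun x : R => cos (a * x)).
  by apply: continuous_measurable_fun; exact: continuous_cosM.
have isn : lam.-integrable setT (EFin \o (fun x : R => expR (- `|x|) * sin (a * x))).
  by apply: (@integrable_edecay_bounded _ _ 1) => // x; exact: sin_max.
have ic : lam.-integrable setT (EFin \o (fun x : R => expR (- `|x|) * cos (a * x))).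
  by apply: (@integrable_edecay_bounded _ _ 1) => // x; exact: cos_max.
have ics : lam.-integrable setT (EFin \o (fun x : R => (expR (- `|x|) * cos (a * x)) * cos b)).
  have := integrableZr measurableT (cos b) ic.
  by apply: eq_integrable.
have iss : lam.-integrable setT (EFin \o (fun x : R => (expR (- `|x|) * sin (a * x)) * sin b)).
  have := integrableZr measurableT (sin b) isn.
  by apply: eq_integrable.
have E x : expR (- `|x|) * cos (a * x + b) = (expR (- `|x|) * cos (a * x)) * cos b -
    (expR (- `|x|) * sin (a * x)) * sin b.
  by rewrite cosD mulrBr !mulrA.
under eq_integral => x _ do rewrite E.
rewrite -[LHS]fineK; last first.
  by apply: integrable_fin_num => //; exact: RintB.
congr EFin; rewrite -/(Rintegral _ _ _) RintegralB// !RintegralZr//.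
by rewrite Rintegral_edecay_cos Rintegral_edecay_sin mul0r subr0.
Qed.

Definition edecay n (x : 'rV[R]_n) : R := \prod_(i < n) expR (- `|x ord0 i|).

(** In each variable a Cauchy density of mass one; this product differs from the radial Poisson
    kernel of a half-space. *)
Definition poisson n (x : 'rV[R]_n) : R :=
  \prod_(i < n) (2 / (1 + (2 * pi * x ord0 i) ^+ 2)).

Lemma edecay_ge0 n (x : 'rV[R]_n) : 0 <= edecay x.
Proof. by apply: prodr_ge0 => i _; exact: expR_ge0. Qed.

Lemma edecay_le1 n (x : 'rV[R]_n) : edecay x <= 1.
Proof. by apply: prodr_ile1 => i _; rewrite expR_ge0 /= expR_le1 oppr_le0. Qed.

Lemma poisson_ge0 n (x : 'rV[R]_n) : 0 <= poisson x.
Proof.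
by apply: prodr_ge0 => i _; rewrite divr_ge0// addr_ge0// sqr_ge0.
Qed.

Lemma measurable_edecay1 : measurable_fun setT (fun t : R => expR (- `|t|)).
Proof. by have /measurable_EFinP := measurable_int _ (@integrable_edecay R). Qed.

Lemma measurable_edecay n : measurable_fun setT (@edecay n).
Proof. exact: measurable_prod_rV measurable_edecay1. Qed.

Lemma measurable_poisson n : measurable_fun setT (@poisson n).
Proof.
apply: (@measurable_prod_rV _ _ (fun t => 2 / (1 + (2 * pi * t) ^+ 2))).
apply: continuous_measurable_fun => x; apply: cvgM; first exact: cvg_cst.
apply: cvgV; first by rewrite gt_eqF// ltr_pwDl// sqr_ge0.
apply: cvgD; first exact: cvg_cst.
by rewrite expr2; apply: cvgM; exact: mulrl_continuous.
Qed.

Lemma integral_edecay_rV n : (\int[mu n]_x (edecay x)%:E = (2 ^+ n)%:E)%E.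
Proof.
apply: (@integral_prod_rV _ _ (fun t => expR (- `|t|)) 2).
- exact: measurable_edecay1.
- by move=> t; exact: expR_ge0.
- exact: integral_edecay.
Qed.

Lemma integral_poisson n : (\int[mu n]_x (poisson x)%:E = 1)%E.
Proof.
rewrite (@integral_prod_rV _ _ (fun t => 2 / (1 + (2 * pi * t) ^+ 2)) 1)//.
- by rewrite expr1n.
- apply: continuous_measurable_fun => x; apply: cvgM; first exact: cvg_cst.
  apply: cvgV; first by rewrite gt_eqF// ltr_pwDl// sqr_ge0.
  apply: cvgD; first exact: cvg_cst.
  by rewrite expr2; apply: cvgM; exact: mulrl_continuous.
- by move=> t; rewrite divr_ge0// addr_ge0// sqr_ge0.
- exact: integral_poisson1.
Qed.

Lemma integrable_edecay_rV n : (mu n).-integrable setT (EFin \o @edecay n).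
Proof.
apply/integrableP; split; first by apply/measurable_EFinP; exact: measurable_edecay.
under eq_integral => x _ do rewrite /= ger0_norm ?edecay_ge0//.
by rewrite integral_edecay_rV ltry.
Qed.

Lemma integrable_poisson n : (mu n).-integrable setT (EFin \o @poisson n).
Proof.
apply/integrableP; split; first by apply/measurable_EFinP; exact: measurable_poisson.
under eq_integral => x _ do rewrite /= ger0_norm ?poisson_ge0//.
by rewrite integral_poisson ltry.
Qed.

Lemma measurable_dotv n (z : 'rV[R]_n) : measurable_fun setT (dotv z).
Proof.
apply: measurable_sum => i; apply: measurable_funM => //.
exact: measurable_coord.
Qed.

Lemma measurable_cos : measurable_fun setT (@cos R).
Proof. by apply: continuous_measurable_fun; exact: continuous_cos. Qed.

Lemma measurable_sin : measurable_fun setT (@sin R).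
Proof. by apply: continuous_measurable_fun; exact: continuous_sin. Qed.

Lemma dotvC n (x y : 'rV[R]_n) : dotv x y = dotv y x.
Proof. by apply: eq_bigr => i _; rewrite mulrC. Qed.

Lemma integrable_edecay_phase n (z : 'rV[R]_n) (b : R) :
  (mu n).-integrable setT (EFin \o (fun x => edecay x * cos (2 * pi * dotv x z + b))).
Proof.
apply: le_integrable (integrable_edecay_rV n) => //.
  apply/measurable_EFinP; apply: measurable_funM; first exact: measurable_edecay.
  apply: (measurableT_comp measurable_cos); apply: measurable_funD => //.
  apply: measurable_funM => //; under [X in measurable_fun _ X]eq_fun do rewrite dotvC.
  exact: measurable_dotv.
move=> x _; rewrite /= lee_fin normrM ler_piMr// cos_max//.
Qed.

(** The free phase [b] makes the induction close: splitting off the first coordinate [t] leaves the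
    same integral in one dimension less, with the contribution of [t] absorbed into the phase. *)
Lemma integral_edecay_poisson n (z : 'rV[R]_n) (b : R) :
  (\int[mu n]_x (edecay x * cos (2 * pi * dotv x z + b))%:E =
   (poisson z * cos b)%:E)%E.
Proof.
elim: n z b => [|n IH] z b.
  rewrite lebesgue_rV0; first by rewrite /edecay /poisson /dotv !big_ord0 mulr0 add0r.
  exact: measurable_int (integrable_edecay_phase z b).
rewrite integral_rVS; last exact: integrable_edecay_phase.
pose z' : 'rV[R]_n := \row_j z ord0 (lift ord0 j).
have E t v : edecay (cons_rV (t, v)) * cos (2 * pi * dotv (cons_rV (t, v)) z + b) =
    expR (- `|t|) * (edecay v * cos (2 * pi * dotv v z' + (2 * pi * z ord0 ord0 * t + b))).
  rewrite /edecay /dotv !big_ord_recl cons_rV_ord0 mulrA; congr (_ * _ * cos _).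
    by apply: eq_bigr => i _; rewrite cons_rV_lift.
  rewrite (_ : \sum_(i < n) cons_rV (t, v) ord0 (lift ord0 i) * _ =
     \sum_(i < n) v ord0 i * z' ord0 i); first by ring.
  by apply: eq_bigr => i _; rewrite cons_rV_lift mxE.
under eq_integral => t _.
  under eq_integral => v _ do rewrite E EFinM.
  rewrite integralZl//; last exact: integrable_edecay_phase.
  rewrite IH -EFinM mulrCA; over.
rewrite /=.
transitivity ((poisson z')%:E * \int[lam]_t (expR (- `|t|) * cos (2 * pi * z ord0 ord0 * t + b))%:E)%E.
  rewrite -integralZl//; apply: integrable_edecay_bounded => [|x]; last exact: cos_max.
  apply: (measurableT_comp measurable_cos); exact: measurable_affine.
rewrite integral_edecay_phase -EFinM; congr EFin.
rewrite /poisson big_ord_recl; under eq_bigr do rewrite mxE.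
by rewrite mulrA; congr (_ * _); rewrite mulrC.
Qed.

Lemma Rintegral_edecay_scale n (e : R) (z : 'rV[R]_n) : 0 < e ->
  \int[mu n]_x (edecay (e *: x) * cos (2 * pi * dotv x z)) = e ^- n * poisson (e^-1 *: z).
Proof.
move=> e0.
transitivity (\int[mu n]_x (edecay (e *: x + 0) * cos (2 * pi * dotv (e *: x + 0) (e^-1 *: z) + 0))).
  apply: eq_Rintegral => x _; rewrite !addr0; congr (_ * cos (_ * _)).
  by apply: eq_bigr => i _; rewrite !mxE mulrACA mulfV ?mul1r// gt_eqF.
rewrite (Rintegral_affine (f := fun x => edecay x * cos (2 * pi * dotv x (e^-1 *: z) + 0)) 0).
- by rewrite /Rintegral integral_edecay_poisson/= cos0 mulr1 gtr0_norm.
- by rewrite gt_eqF.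
- exact: integrable_edecay_phase.
Qed.

End poisson.

(** * Continuity of translations in L^2 *)

Section dominated.
Context d (T : measurableType d) (R : realType).
Variable mu : {measure set T -> \bar R}.
Local Notation Int f := (mu.-integrable setT (EFin \o f)).

Lemma Rdominated_convergence (f_ : nat -> T -> R) (f g : T -> R) :
  (forall k, measurable_fun setT (f_ k)) -> Int g ->
  (forall k x, `|f_ k x| <= g x) -> (forall x, f_ k x @[k --> \oo] --> f x) ->
  Int f /\ \int[mu]_x f_ k x @[k --> \oo] --> \int[mu]_x f x.
Proof.
move=> mf_ gi fg ff.
have mf : measurable_fun setT f.
  by apply: (measurable_fun_cvg (h := f_)) => // x _; exact: ff.
have mef_ k : measurable_fun setT (EFin \o f_ k) by exact/measurable_EFinP.
have mef : measurable_fun setT (EFin \o f) by exact/measurable_EFinP.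
have eff : {ae mu, forall x, setT x -> (EFin \o f_ k) x @[k --> \oo] --> (EFin \o f) x}.
  by apply: aeW => x _; apply: cvg_EFin; [exact: nearW|exact: ff].
have efg : {ae mu, forall x k, setT x -> (`|(EFin \o f_ k) x| <= (EFin \o g) x)%E}.
  by apply: aeW => x k _ /=; rewrite lee_fin.
have [fi _ cvg] := dominated_convergence measurableT mef_ mef eff gi efg.
split => //; apply: fine_cvg; rewrite fineK; last exact: integrable_fin_num.
exact: cvg.
Qed.

Lemma dominated_cvg0 (f_ : nat -> T -> R) (g : T -> R) (e : R) : 0 < e ->
  (forall k, measurable_fun setT (f_ k)) -> Int g ->
  (forall k x, 0 <= f_ k x <= g x) -> (forall x, f_ k x @[k --> \oo] --> 0) ->
  \forall k \near \oo, (\int[mu]_x (f_ k x)%:E <= e%:E)%E.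
Proof.
move=> e0 mf_ gi fg ff.
have fi k : Int (f_ k).
  by apply: le_Rint gi => // x; have /andP[f0 ?] := fg k x; rewrite ger0_norm.
have [|_ cvg] := @Rdominated_convergence f_ (cst 0) g mf_ gi _ ff.
  by move=> k x; have /andP[f0 ?] := fg k x; rewrite ger0_norm.
move: cvg; rewrite Rintegral_cst// mul0r => /cvgr0Pnorm_le /(_ _ e0).
apply: filterS => k; rewrite ger0_norm; last first.
  by apply: Rintegral_ge0 => x _; have /andP[] := fg k x.
by rewrite -EFin_Rintegral// lee_fin.
Qed.

(** The L^2 triangle inequalities below are pointwise inequalities between squares, integrated by
    this lemma even when some integrals are infinite. Each is proved by exhibiting the difference of
    its two sides as a square or a positive multiple of a sum of squares. *)
Lemma ge0_integral_le_comb (f g h : T -> R) (a b : R) :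
  measurable_fun setT f -> measurable_fun setT g -> measurable_fun setT h ->
  (forall x, 0 <= f x) -> (forall x, 0 <= g x) -> (forall x, 0 <= h x) ->
  0 <= a -> 0 <= b -> (forall x, f x <= a * g x + b * h x) ->
  (\int[mu]_x (f x)%:E <= a%:E * \int[mu]_x (g x)%:E + b%:E * \int[mu]_x (h x)%:E)%E.
Proof.
move=> mf mg mh f0 g0 h0 a0 b0 fgh.
have eg : measurable_fun setT (fun x => (g x)%:E) by exact/measurable_EFinP.
have eh : measurable_fun setT (fun x => (h x)%:E) by exact/measurable_EFinP.
have eg0 x : setT x -> (0 <= (g x)%:E)%E by rewrite lee_fin.
have eh0 x : setT x -> (0 <= (h x)%:E)%E by rewrite lee_fin.
rewrite -(ge0_integralZl mu measurableT eg eg0)//.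
rewrite -(ge0_integralZl mu measurableT eh eh0)//.
rewrite -(ge0_integralD mu measurableT).
- apply: ge0_le_integral => //.
  + by move=> x _; rewrite lee_fin.
  + exact/measurable_EFinP.
  + by apply: emeasurable_funD; exact: measurable_funeM.
  + by move=> x _; rewrite -!EFinM -EFinD lee_fin.
- by move=> x _; rewrite -EFinM lee_fin mulr_ge0.
- exact: measurable_funeM.
- by move=> x _; rewrite -EFinM lee_fin mulr_ge0.
- exact: measurable_funeM.
Qed.

End dominated.

Section translation.
Import HBNNSimple.
Context {R : realType} {n : nat}.
Local Notation E := 'rV[R]_n.
Local Notation mu := (lebesgue_rV R n).
Implicit Types f g : E -> R.
Local Notation Int f := (mu.-integrable setT (EFin \o f)).

Definition trans_defect f (y : E) : \bar R :=
  (\int[mu]_x ((f (x - y) - f x) ^+ 2)%:E)%E.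

Lemma measurable_shift d (T : measurableType d) (f : E -> T) y : measurable_fun setT f ->
  measurable_fun setT (fun x : E => f (x - y)).
Proof.
move=> mf; apply: (eq_measurable_fun (fun x : E => f (1 *: x - y))).
  by move=> x _ /=; rewrite scale1r.
exact: (measurableT_comp mf (measurable_affine_rV 1 (- y))).
Qed.

Lemma measurable_sqr d (T : measurableType d) (f : T -> R) : measurable_fun setT f ->
  measurable_fun setT (fun x => (f x) ^+ 2).
Proof. by move=> mf; exact: measurable_funX. Qed.

Lemma measurable_shiftB2 f y : measurable_fun setT f ->
  measurable_fun setT (fun x : E => (f (x - y) - f x) ^+ 2).
Proof.
by move=> mf; apply: measurable_sqr; apply: measurable_funB => //; exact: measurable_shift.
Qed.

Variable y_ : nat -> E.
Hypothesis y_0 : y_ k @[k --> \oo] --> (0 : E).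

(** L^2 continuity of translations along the fixed sequence [y_]. The eventual bound in the extended
    reals does not presuppose that [f] is square integrable. *)
Definition trans_cont f : Prop := measurable_fun setT f /\
  forall e, 0 < e -> \forall k \near \oo, (trans_defect f (y_ k) <= e%:E)%E.

Lemma trans_contD f g : trans_cont f -> trans_cont g ->
  trans_cont (fun x => f x + g x).
Proof.
move=> [mf Tf] [mg Tg]; split; first exact: measurable_funD.
move=> e e0; have e4 : 0 < e / 4 by rewrite divr_gt0.
near=> k.
apply: (@le_trans _ _ (2%:E * trans_defect f (y_ k) + 2%:E * trans_defect g (y_ k))%E).
  apply: ge0_integral_le_comb => //; try exact: measurable_shiftB2.
  - by apply: measurable_shiftB2; exact: measurable_funD.
  - by move=> x; exact: sqr_ge0.
  - by move=> x; exact: sqr_ge0.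
  - by move=> x; exact: sqr_ge0.
  - move=> x.
    set a := f (x - _); set b := g (x - _).
    rewrite -subr_ge0 (_ : _ - _ = (a - f x - (b - g x)) ^+ 2) ?sqr_ge0//; ring.
have -> : e%:E = (2%:E * (e / 4)%:E + 2%:E * (e / 4)%:E)%E.
  by rewrite -!EFinM -EFinD; congr EFin; field.
by apply: leeD; rewrite lee_pmul2l//; near: k; [exact: Tf|exact: Tg].
Unshelve. all: by end_near. Qed.

Lemma trans_contZ c f : trans_cont f -> trans_cont (fun x => c * f x).
Proof.
move=> [mf Tf]; split; first exact: measurable_funM.
move=> e e0; have e1 : 0 < e / (c ^+ 2 + 1).
  by rewrite divr_gt0// ltr_wpDl// sqr_ge0.
have := Tf _ e1; apply: filterS => k /= Tk.
rewrite /trans_defect; under eq_integral => x _ do rewrite -mulrBr exprMn EFinM.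
rewrite ge0_integralZl//=; last 3 first.
- by apply/measurable_EFinP; exact: measurable_shiftB2.
- by move=> x _; rewrite lee_fin sqr_ge0.
- by rewrite lee_fin sqr_ge0.
apply: (le_trans (lee_wpmul2l _ Tk)); rewrite ?lee_fin ?sqr_ge0//.
by rewrite mulrCA ler_piMr ?(ltW e0)// ler_pdivrMr ?mul1r ?lerDl// ltr_wpDl// sqr_ge0.
Qed.

Lemma trans_contB f g : trans_cont f -> trans_cont g ->
  trans_cont (fun x => f x - g x).
Proof.
move=> Tf Tg; rewrite (_ : (fun _ => _) = (fun x => f x + (-1) * g x)); last first.
  by apply/funext => x; rewrite mulN1r.
by apply: trans_contD => //; exact: trans_contZ.
Qed.

Lemma trans_cont0 : trans_cont (fun=> 0).
Proof.
split=> // e e0; apply: nearW => k; rewrite /trans_defect.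
under eq_integral do rewrite subr0 expr0n/=.
by rewrite integral0 lee_fin ltW.
Qed.

Lemma trans_cont_sum I (s : seq I) (f_ : I -> E -> R) :
  (forall i, trans_cont (f_ i)) -> trans_cont (fun x => \sum_(i <- s) f_ i x).
Proof.
move=> Tf; elim: s => [|i s IH].
  by under eq_fun do rewrite big_nil; exact: trans_cont0.
by under eq_fun do rewrite big_cons; exact: trans_contD.
Qed.

(** Translating [f - g] does not change its norm, so the defect of [f] exceeds a multiple of that of
    [g] by at most a multiple of the squared distance from [f] to [g]. *)
Lemma trans_cont_lim f : measurable_fun setT f ->
  (forall e, 0 < e -> exists2 g, trans_cont g &
     (\int[mu]_x ((f x - g x) ^+ 2)%:E <= e%:E)%E) ->
  trans_cont f.
Proof.
(* 10 = 2 (2 + 2) + 2: the defect of [f - g] costs two squared distances, and the defect of [g] is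
   added to it. *)
move=> mf fg; split => // e e0; have e10 : 0 < e / 10 by rewrite divr_gt0.
have [g [mg Tg] gfe] := fg _ e10.
near=> k.
have mfg : measurable_fun setT (fun x => f x - g x) by exact: measurable_funB.
have mfg2 := measurable_sqr mfg.
pose I := (\int[mu]_x ((f x - g x) ^+ 2)%:E)%E.
have I1 : (\int[mu]_x ((f (x - y_ k) - g (x - y_ k)) ^+ 2)%:E = I)%E.
  apply: (@ge0_integral_shift _ _ (fun x => ((f x - g x) ^+ 2)%:E)).
    exact/measurable_EFinP.
  by move=> x; rewrite lee_fin sqr_ge0.
have D1 : (trans_defect (fun x => (f x - g x)%R) (y_ k) <= 2%:E * I + 2%:E * I)%E.
  rewrite -[X in (2%:E * X + _)%E]I1.
  apply: ge0_integral_le_comb => //; try by move=> x; exact: sqr_ge0.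
  - exact: measurable_shiftB2.
  - exact: (measurable_shift _ mfg2).
  - move=> x; set a := f (x - _) - _; set b := f x - g x.
    rewrite -subr_ge0 (_ : _ - _ = (a + b) ^+ 2) ?sqr_ge0//; ring.
apply: (@le_trans _ _ (2%:E * trans_defect (fun x => (f x - g x)%R) (y_ k) +
    2%:E * trans_defect g (y_ k))%E).
  apply: ge0_integral_le_comb => //; try by move=> x; exact: sqr_ge0.
  - exact: measurable_shiftB2.
  - exact: measurable_shiftB2.
  - exact: measurable_shiftB2.
  - move=> x; set a := f (x - _); set b := g (x - _).
    rewrite -subr_ge0 (_ : _ - _ = (a - f x - b *+ 2 + g x *+ 2) ^+ 2) ?sqr_ge0//; ring.
have -> : e%:E = (2%:E * (2%:E * (e / 10)%:E + 2%:E * (e / 10)%:E) + 2%:E * (e / 10)%:E)%E.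
  by rewrite -!(EFinM, EFinD); congr EFin; field.
apply: leeD; rewrite lee_pmul2l//; last by near: k; exact: Tg.
by rewrite (le_trans D1)// leeD// lee_pmul2l.
Unshelve. all: by end_near. Qed.

Lemma Rint_indic (A : set E) : measurable A -> (mu A < +oo)%E -> Int (\1_A : E -> R).
Proof.
move=> mA Aoo; apply/ge0_RintP => //.
by rewrite integral_indic// setIT.
Qed.

(** For an indicator the defect is twice the measure of [U] minus twice that of its overlap with its
    translate. Openness makes the overlap converge to [U]: a point of [U] stays in [U] under small
    shifts. *)
Lemma trans_cont_open (U : set E) : open U -> (mu U < +oo)%E ->
  trans_cont (\1_U : E -> R).
Proof.
move=> oU Uoo; have mU := measurable_rV_open oU.
have m1 : measurable_fun setT (\1_U : E -> R) by exact: measurable_indic.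
have i1 := Rint_indic mU Uoo.
have i1k k : Int (fun x => \1_U (x - y_ k) : R).
  have := integrable_affine (- y_ k) (oner_neq0 R) i1.
  by apply: eq_integrable => // x _ /=; rewrite scale1r.
split=> // e e0.
pose h k x : R := \1_U x * \1_U (x - y_ k).
have mh k : measurable_fun setT (h k).
  by apply: measurable_funM => //; exact: measurable_shift.
have hh k x : `|h k x| <= (\1_U x : R).
  by rewrite /h !indicE -natrM ger0_norm// ler_nat; do 2 case: (_ \in _).
have h1 x : h k x @[k --> \oo] --> (\1_U x : R).
  have [Ux|Ux] := pselect (U x); last first.
    rewrite (_ : h ^~ x = cst 0) ?indicE ?memNset//; first exact: cvg_cst.
    by apply/funext => k; rewrite /h indicE memNset// mul0r.
  apply: cvg_near_cst.
  have xy : x - y_ k @[k --> \oo] --> x.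
    by rewrite -[X in _ --> X]subr0; apply: cvgB; [exact: cvg_cst|exact: y_0].
  have : \forall k \near \oo, U (x - y_ k).
    exact: (xy U (open_nbhs_nbhs (conj oU Ux))).
  apply: filterS => k Uk.
  by rewrite /h !indicE !mem_set// mulr1.
have [_ cv] := Rdominated_convergence mh i1 hh h1.
have e2 : 0 < e / 2 by rewrite divr_gt0.
have /cvgrPdist_le /(_ _ e2) := cv; apply: filterS => k /= ke.
have ik : Int (h k) by exact: le_Rint i1.
have E1 : trans_defect \1_U (y_ k) =
    (\int[mu]_x ((\1_U (x - y_ k) + \1_U x) - 2 * h k x))%:E.
  rewrite EFin_Rintegral; last by apply: RintB; [exact: RintD|exact: RintZl].
  apply: eq_integral => x _; congr EFin.
  by rewrite /h !indicE; do 2 case: (_ \in _) => /=; ring.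
rewrite E1 lee_fin RintegralB//; [|exact: RintD|exact: RintZl].
rewrite RintegralD// RintegralZl// (Rintegral_shift (- y_ k) i1).
move: ke; rewrite ler_norml => /andP[_]; lra.
Qed.

Lemma lebesgue_rV_ball_fin (N : nat) : (mu (ball (0%R : E) N.+1%:R) < +oo)%E.
Proof. by rewrite lebesgue_rV_ball// ltry. Qed.

(** Dynkin's induction from open sets. Intersecting with a fixed cube keeps all measures finite, and
    complements become differences of indicators. *)
Lemma trans_cont_bounded (N : nat) (A : set E) : measurable A ->
  trans_cont (\1_(A `&` ball (0 : E) N.+1%:R) : E -> R).
Proof.
set Q := ball _ _ => mA; have oQ : open Q by exact: ball_open.
have mQ := measurable_rV_open oQ; have Qoo := lebesgue_rV_ball_fin N.
have iQ := Rint_indic mQ Qoo.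
move: A mA; rewrite measurable_rV_openE.
apply: (@dynkin_induction _ _ _ (fun A => trans_cont (\1_(A `&` Q) : E -> R))).
- exact: measurable_rV_openE.
- by move=> A B; exact: openI.
- by rewrite setTI; exact: trans_cont_open.
- move=> U oU; apply: trans_cont_open; first exact: openI.
  apply: le_lt_trans Qoo; apply: le_measure => //; rewrite ?inE//.
  by apply: measurableI => //; exact: measurable_rV_open.
- move=> A mA TA; have TQ := trans_cont_open oQ Qoo.
  rewrite (_ : \1_(_ `&` Q) = (fun x => \1_Q x - \1_(A `&` Q) x) :> (E -> R)).
    exact: trans_contB.
  apply/funext => x; rewrite !indicE !in_setI in_setC.
  by do 2 case: (_ \in _) => /=; rewrite ?subr0 ?subrr.
- move=> F mF tF TF.
  have mFQ : measurable (\bigcup_k F k `&` Q).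
    by apply: measurableI => //; exact: bigcup_measurable.
  have mf : measurable_fun setT (\1_(\bigcup_k F k `&` Q) : E -> R) by exact: measurable_indic.
  apply: trans_cont_lim => // e e0.
  (* The indicators of the partial unions, by disjointness; they converge in L^2 under the
     domination by [\1_Q]. *)
  pose g m x : R := \sum_(i < m) \1_(F i `&` Q) x.
  have Tg m : trans_cont (g m) by exact: trans_cont_sum.
  have gE m x i : F i x -> g m x = (i < m)%:R * \1_Q x.
    move=> Fx; have F0 (j : 'I_m) : val j != i -> \1_(F j `&` Q) x = 0 :> R.
      move=> ji; rewrite indicE memNset// => -[Fj _]; move/eqP: ji; apply.
      by apply: (tF (val j) i) => //; exists x.
    rewrite /g; case: ltnP => im.
      rewrite (bigD1 (Ordinal im))//= big1; last first.
        by move=> j ji; apply: F0; apply: contraNneq ji => ji; exact/eqP/val_inj.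
      by rewrite addr0 mul1r !indicE in_setI mem_set.
    by rewrite mul0r big1// => j _; apply: F0; rewrite neq_ltn (leq_trans (ltn_ord j)).
  have g0 m x : ~ (\bigcup_k F k) x -> g m x = 0.
    move=> nF; rewrite /g big1// => i _; rewrite indicE memNset// => -[Fi _].
    by apply: nF; exists i.
  have := @dominated_cvg0 _ _ _ mu (fun m x => (\1_(\bigcup_k F k `&` Q) x - g m x) ^+ 2)
    (\1_Q) e e0.
  case.
  - move=> m; apply: measurable_sqr; apply: measurable_funB => //.
    by have [] := Tg m.
  - exact: iQ.
  - move=> m x; rewrite sqr_ge0/=.
    have [[i _ Fi]|nF] := pselect ((\bigcup_k F k) x).
      rewrite (gE _ _ i)// !indicE in_setI mem_set/=; last by exists i.
      by case: ltnP => _; case: (_ \in _) => /=; rewrite ?mul1r ?mul0r ?subrr ?subr0 ?expr1n ?expr0n.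
    by rewrite g0// indicE memNset ?subr0 ?expr0n ?indicE// => -[/nF].
  - move=> x; apply: cvg_near_cst.
    have [[i _ Fi]|nF] := pselect ((\bigcup_k F k) x).
      exists i.+1 => // m /= im.
      rewrite (gE _ _ i)// im !indicE in_setI [_ \in \bigcup_k _]mem_set/=; last by exists i.
      by rewrite mul1r subrr expr0n.
    by apply: nearW => m; rewrite g0// indicE memNset ?subr0 ?expr0n// => -[/nF].
  by move=> m _ /(_ m (leqnn m)) H; exists (g m).
Qed.

Lemma trans_cont_nnsfun (f : {nnsfun E >-> R}) (N : nat) :
  trans_cont (fun x => f x * \1_(ball (0 : E) N.+1%:R) x).
Proof.
under eq_fun => x do rewrite fimfunE fsbig_finite//= mulr_suml.
apply: trans_cont_sum => r.
rewrite (_ : (fun _ => _) =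
    (fun x => r * \1_(f @^-1` [set r] `&` ball (0 : E) N.+1%:R) x)).
  by apply: trans_contZ; apply: trans_cont_bounded; exact: measurable_sfunP.
by apply/funext => x; rewrite -mulrA !indicE in_setI -natrM mulnb.
Qed.

(** The simple approximations from below are cut off to growing cubes, since the indicators treated
    so far are those of bounded sets; domination by [f ^+ 2] gives convergence in L^2. *)
Lemma trans_cont_ge0 f : measurable_fun setT f -> (forall x, 0 <= f x) ->
  Int (fun x => (f x) ^+ 2) -> trans_cont f.
Proof.
move=> mf f0 if2; apply: trans_cont_lim => // e e0.
have mef : measurable_fun setT (EFin \o f) by exact/measurable_EFinP.
pose a k := nnsfun_approx measurableT mef k.
have acvg x : a k x @[k --> \oo] --> f x.
  have /fine_cvg : (EFin \o (a ^~ x)) k @[k --> \oo] --> (f x)%:E.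
    by apply: cvg_nnsfun_approx => //= ? _; rewrite lee_fin.
  exact.
have ale k x : a k x <= f x.
  have nd : nondecreasing_seq (a ^~ x : nat -> R).
    by move=> i j ij; exact/lefP/nd_nnsfun_approx.
  have cv : cvgn (a ^~ x : nat -> R) by apply/cvg_ex; exists (f x); exact: acvg.
  by have := nondecreasing_cvgn_le nd cv k; rewrite (cvg_lim _ (acvg x)).
pose g k x := a k x * \1_(ball (0 : E) k.+1%:R) x.
have := @dominated_cvg0 _ _ _ mu (fun k x => (f x - g k x) ^+ 2) (fun x => f x ^+ 2) e e0.
case.
- move=> k; apply: measurable_sqr; apply: measurable_funB => //.
  by have [] := trans_cont_nnsfun (a k) k.
- exact: if2.
- move=> k x; rewrite sqr_ge0/= /g indicE.
  have a0 : 0 <= a k x by [].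
  case: (_ \in _); rewrite ?mulr0 ?subr0// mulr1 ler_sqr ?nnegrE ?subr_ge0//.
  by rewrite gerBl.
- move=> x; rewrite -[X in _ --> X](_ : (f x - f x) ^+ 2 = 0); last by rewrite subrr expr0n.
  have h : f x - g k x @[k --> \oo] --> f x - f x.
    apply: cvgB; first exact: cvg_cst.
    rewrite -[X in _ --> X]mulr1; apply: cvgM; first exact: acvg.
    apply: cvg_near_cst.
    have [m xm] : exists m : nat, `|x| < m%:R.
      by exists (Num.bound `|x|); rewrite archi_boundP.
    exists m => // k /= mk; rewrite indicE mem_set//.
    rewrite mx_norm_ball /ball_/= sub0r normrN (lt_le_trans xm)// ler_nat.
    by rewrite (leq_trans mk).
  by rewrite expr2; under eq_fun do rewrite expr2; exact: cvgM.
by move=> m _ /(_ m (leqnn m)) H; exists (g m) => //; exact: trans_cont_nnsfun.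
Qed.

Lemma trans_cont_L2 f : measurable_fun setT f -> Int (fun x => (f x) ^+ 2) ->
  trans_cont f.
Proof.
move=> mf if2.
rewrite (_ : f = (fun x => Num.max (f x) 0 - Num.max (- f x) 0)); last first.
  apply/funext => x; case: (leP 0 (f x)) => fx.
    by rewrite (max_idPr _) ?subr0// oppr_le0.
  by rewrite max_l ?oppr_ge0 ?(ltW fx)// sub0r opprK.
apply: trans_contB.
- apply: trans_cont_ge0.
  + exact: measurable_maxr.
  + by move=> x; rewrite le_max lexx orbT.
  + apply: le_Rint if2; first by apply: measurable_sqr; exact: measurable_maxr.
    move=> x; rewrite ger0_norm ?sqr_ge0//.
    by case: (leP 0 (f x)) => // _; rewrite expr0n/= sqr_ge0.
- have mNf : measurable_fun setT (fun x => - f x) by exact: measurable_funN.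
  apply: trans_cont_ge0.
  + exact: measurable_maxr.
  + by move=> x; rewrite le_max lexx orbT.
  + apply: le_Rint if2; first by apply: measurable_sqr; exact: measurable_maxr.
    move=> x; rewrite ger0_norm ?sqr_ge0//.
    by case: (leP 0 (- f x)) => // _; rewrite ?sqrrN// expr0n/= sqr_ge0.
Qed.

End translation.

Lemma cvg_prodr (R : realType) (I : Type) (s : seq I) (f : I -> nat -> R) (l : I -> R) :
  (forall i, f i k @[k --> \oo] --> l i) ->
  \prod_(i <- s) f i k @[k --> \oo] --> \prod_(i <- s) l i.
Proof.
move=> fl; elim: s => [|i s IH].
  by rewrite big_nil; under eq_cvg do rewrite big_nil; exact: cvg_cst.
by rewrite big_cons; under eq_cvg do rewrite big_cons; exact: cvgM.
Qed.

Lemma normrM_le (R : realFieldType) (u v : R) :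
  `|u * v| <= 2^-1 * u ^+ 2 + 2^-1 * v ^+ 2.
Proof.
have h1 := sqr_ge0 (u - v); have h2 := sqr_ge0 (u + v).
by rewrite ler_norml; apply/andP; split; nra.
Qed.

Section sequential.
Context {R : realType} {n : nat}.
Local Notation E := 'rV[R]_n.

(** Dominated convergence is about sequences; they detect continuity because the balls of radius
    1/(k+1) form a base at [x]. *)
Lemma seq_continuous_at (f : E -> R) (x : E) :
  (forall y_ : nat -> E, y_ k @[k --> \oo] --> x -> f (y_ k) @[k --> \oo] --> f x) ->
  f y @[y --> x] --> f x.
Proof.
move=> fs; have FF : Filter (nbhs x) := nbhs_filter x.
apply/cvgrPdist_lt => e e0; apply: contrapT => nf.
have /choice[y_ Hy] : forall k : nat, exists y, ball x k.+1%:R^-1 y /\ ~ `|f x - f y| < e.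
  move=> k; apply: contrapT => H; apply: nf.
  have k0 : 0 < k.+1%:R^-1 :> R by rewrite invr_gt0.
  apply: filterS (nbhsx_ballx x _ k0) => y xy /=.
  by apply: contrapT => yf; apply: H; exists y.
have /fs/cvgrPdist_lt/(_ _ e0)[N _ /(_ N (leqnn N))] : y_ k @[k --> \oo] --> x.
  apply/cvg_ballP => d d0.
  have [m md] : exists m : nat, m.+1%:R^-1 < d.
    by have [m] := ltr_add_invr d0; rewrite add0r; exists m.
  exists m => // k /= mk; have [] := Hy k; rewrite -ball_normE /= => yk _.
  by apply: (lt_trans yk); apply: le_lt_trans md; rewrite lef_pV2 ?posrE// ler_nat.
by have [_] := Hy N.
Qed.

End sequential.

(** * Plancherel's identity for real functions *)

Section kernel_fubini.
Context {R : realType} {n : nat}.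
Local Notation E := 'rV[R]_n.
Local Notation mu := (lebesgue_rV R n).
Implicit Types f g : E -> R.
Local Notation Int f := (mu.-integrable setT (EFin \o f)).

Lemma measurable_dotv2 : measurable_fun setT (fun p : E * E => dotv p.1 p.2).
Proof.
apply: measurable_sum => i; apply: measurable_funM.
  exact: (measurableT_comp (measurable_coord i) measurable_fst).
exact: (measurableT_comp (measurable_coord i) measurable_snd).
Qed.

Lemma kernel_integrable f g (k : E * E -> R) : Int f -> Int g ->
  measurable_fun setT k -> (forall p, `|k p| <= 1) ->
  (mu \x mu)%E.-integrable setT (EFin \o (fun p => f p.1 * g p.2 * k p)).
Proof.
move=> fi gi mk k1; have mf := Rint_measurable fi; have mg := Rint_measurable gi.
have mF : measurable_fun setT (fun p : E * E => f p.1 * g p.2 * k p).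
  apply: measurable_funM => //; apply: measurable_funM.
    exact: (measurableT_comp mf measurable_fst).
  exact: (measurableT_comp mg measurable_snd).
apply/integrable12ltyP; first exact/measurable_EFinP.
apply: (@le_lt_trans _ _ (\int[mu]_x \int[mu]_y (`|f x| * `|g y|)%:E)%E).
  have mfn : measurable_fun setT (fun x => `|f x|) by exact: measurableT_comp.
  have mgn : measurable_fun setT (fun x => `|g x|) by exact: measurableT_comp.
  have mFn : measurable_fun setT (fun p : E * E => `|(f p.1 * g p.2 * k p)%:E|%E).
    by apply: measurableT_comp => //; exact/measurable_EFinP.
  have mGn : measurable_fun setT (fun p : E * E => (`|f p.1| * `|g p.2|)%:E).
    apply/measurable_EFinP; apply: measurable_funM.
      exact: (measurableT_comp mfn measurable_fst).
    exact: (measurableT_comp mgn measurable_snd).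
  apply: ge0_le_integral => //.
  - by move=> x _; exact: integral_ge0.
  - exact: (measurable_fun_fubini_tonelli_F (fun p : E * E => `|(f p.1 * g p.2 * k p)%:E|%E)).
  - exact: (measurable_fun_fubini_tonelli_F (fun p : E * E => (`|f p.1| * `|g p.2|)%:E)).
  - move=> x _; apply: ge0_le_integral => //.
    + exact: (measurableT_comp mFn (pair1_measurable x)).
    + exact: (measurableT_comp mGn (pair1_measurable x)).
    + by move=> y _; rewrite /= lee_fin !normrM ler_piMr// mulr_ge0.
have gin := Rint_norm gi; have fin := Rint_norm fi.
under eq_integral => x _.
  under eq_integral => y _ do rewrite EFinM.
  rewrite integralZl// -EFin_Rintegral// -EFinM; over.
rewrite -EFin_Rintegral ?ltry//; exact: RintZr.
Qed.

(** For [k] a cosine or sine of the phase this is the multiplication formula of the Fourier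
    transform. *)
Lemma kernel_fubini f g (k : E * E -> R) : Int f -> Int g ->
  measurable_fun setT k -> (forall p, `|k p| <= 1) ->
  \int[mu]_x (f x * \int[mu]_y (g y * k (x, y))) =
  \int[mu]_y (g y * \int[mu]_x (f x * k (x, y))).
Proof.
move=> fi gi mk k1; have ki := kernel_integrable fi gi mk k1.
have mk1 x : measurable_fun setT (fun y => k (x, y)).
  exact: (measurableT_comp mk (pair1_measurable x)).
have mk2 y : measurable_fun setT (fun x => k (x, y)).
  exact: (measurableT_comp mk (pair2_measurable y)).
have gki x : Int (fun y => g y * k (x, y)) by exact: RintM_bounded gi (mk1 x) _.
have fki y : Int (fun x => f x * k (x, y)) by exact: RintM_bounded fi (mk2 y) _.
have E1 : (\int[mu]_x \int[mu]_y (f x * g y * k (x, y))%:E =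
    \int[mu]_x (f x * \int[mu]_y (g y * k (x, y)))%:E)%E.
  apply: eq_integral => x _; rewrite -RintegralZl// EFin_Rintegral; last exact: RintZl.
  by apply: eq_integral => y _; rewrite mulrA.
have E2 : (\int[mu]_y \int[mu]_x (f x * g y * k (x, y))%:E =
    \int[mu]_y (g y * \int[mu]_x (f x * k (x, y)))%:E)%E.
  apply: eq_integral => y _; rewrite -RintegralZl// EFin_Rintegral; last exact: RintZl.
  by apply: eq_integral => x _; rewrite mulrA [f _ * _]mulrC.
by rewrite /Rintegral -E1 -E2; congr fine; exact: (Fubini ki).
Qed.

End kernel_fubini.

(** * Cosine and sine transforms of real functions *)

Section real_fourier.
Context {R : realType} {n : nat}.
Local Notation E := 'rV[R]_n.
Local Notation mu := (lebesgue_rV R n).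
Implicit Types a : E -> R.
Local Notation Int f := (mu.-integrable setT (EFin \o f)).

Definition phase (x xi : E) : R := 2 * pi * dotv x xi.

(** The transform of a real function [a] is [fcos a - i fsin a]; keeping the two parts separate
    keeps the proof of Plancherel's identity real. *)
Definition fcos a (xi : E) : R := \int[mu]_x (a x * cos (phase x xi)).
Definition fsin a (xi : E) : R := \int[mu]_x (a x * sin (phase x xi)).

Lemma phaseC x y : phase x y = phase y x.
Proof. by rewrite /phase dotvC. Qed.

Lemma phaseNr x y : phase x (- y) = - phase x y.
Proof.
rewrite /phase -mulrN; congr (_ * _); rewrite /dotv -sumrN.
by apply: eq_bigr => i _; rewrite mxE mulrN.
Qed.

Lemma phaseB x y z : phase (x - y) z = phase x z - phase y z.
Proof.
rewrite /phase -mulrBr; congr (_ * _); rewrite /dotv -sumrB.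
by apply: eq_bigr => i _; rewrite !mxE mulrBl.
Qed.

Lemma phaseD x y z : phase (x + y) z = phase x z + phase y z.
Proof.
rewrite /phase -mulrDr; congr (_ * _); rewrite /dotv -big_split.
by apply: eq_bigr => i _; rewrite !mxE mulrDl.
Qed.

Lemma measurable_phase2 : measurable_fun setT (fun p : E * E => phase p.1 p.2).
Proof. by apply: measurable_funM => //; exact: measurable_dotv2. Qed.

Lemma measurable_cos2 : measurable_fun setT (fun p : E * E => cos (phase p.1 p.2)).
Proof. exact: (measurableT_comp measurable_cos measurable_phase2). Qed.

Lemma measurable_sin2 : measurable_fun setT (fun p : E * E => sin (phase p.1 p.2)).
Proof. exact: (measurableT_comp measurable_sin measurable_phase2). Qed.

Lemma measurable_cosl (xi : E) : measurable_fun setT (fun x : E => cos (phase x xi)).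
Proof. exact: (measurableT_comp measurable_cos2 (pair2_measurable xi)). Qed.

Lemma measurable_sinl (xi : E) : measurable_fun setT (fun x : E => sin (phase x xi)).
Proof. exact: (measurableT_comp measurable_sin2 (pair2_measurable xi)). Qed.

Lemma Rint_cos a xi : Int a -> Int (fun x => a x * cos (phase x xi)).
Proof.
move=> ai; apply: (RintM_bounded ai (measurable_cosl xi) (M := 1)) => x; exact: cos_max.
Qed.

Lemma Rint_sin a xi : Int a -> Int (fun x => a x * sin (phase x xi)).
Proof.
move=> ai; apply: (RintM_bounded ai (measurable_sinl xi) (M := 1)) => x; exact: sin_max.
Qed.

Lemma fcos_bound a xi : Int a -> `|fcos a xi| <= \int[mu]_x `|a x|.
Proof.
move=> ai; apply: le_trans (le_normr_Rintegral measurableT (Rint_cos xi ai)) _.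
apply: le_Rintegral => //; [exact/Rint_norm/Rint_cos|exact: Rint_norm|].
by move=> x _; rewrite normrM ler_piMr// cos_max.
Qed.

Lemma fsin_bound a xi : Int a -> `|fsin a xi| <= \int[mu]_x `|a x|.
Proof.
move=> ai; apply: le_trans (le_normr_Rintegral measurableT (Rint_sin xi ai)) _.
apply: le_Rintegral => //; [exact/Rint_norm/Rint_sin|exact: Rint_norm|].
by move=> x _; rewrite normrM ler_piMr// sin_max.
Qed.

Lemma fcosN a xi : fcos a (- xi) = fcos a xi.
Proof. by apply: eq_Rintegral => x _; rewrite phaseNr cosN. Qed.

Lemma fsinN a xi : Int a -> fsin a (- xi) = - fsin a xi.
Proof.
move=> ai; rewrite -[RHS]mulN1r -RintegralZl//; last exact: Rint_sin.
by apply: eq_Rintegral => x _; rewrite phaseNr sinN mulrN mulN1r.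
Qed.

Lemma continuous_dotv (x : E) : continuous (dotv x).
Proof.
apply: (@continuous_big _ _ +%R 0 xpredT add_continuous) => i _ xi.
have FF : Filter (nbhs xi) := nbhs_filter xi.
by apply: cvgM; [exact: cvg_cst|exact: coord_continuous].
Qed.

Lemma phase_cvg (x xi : E) (y_ : nat -> E) : y_ k @[k --> \oo] --> xi ->
  phase x (y_ k) @[k --> \oo] --> phase x xi.
Proof.
move=> yxi; apply: cvgM; first exact: cvg_cst.
exact: (@cvg_comp _ _ _ y_ (dotv x) _ _ _ yxi (@continuous_dotv x xi)).
Qed.

Lemma cos_phase_cvg (x xi : E) (y_ : nat -> E) : y_ k @[k --> \oo] --> xi ->
  cos (phase x (y_ k)) @[k --> \oo] --> cos (phase x xi).
Proof.
move=> /(@phase_cvg x) yxi.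
exact: (@cvg_comp _ _ _ (fun k => phase x (y_ k)) (@cos R) _ _ _ yxi (@continuous_cos R (phase x xi))).
Qed.

Lemma sin_phase_cvg (x xi : E) (y_ : nat -> E) : y_ k @[k --> \oo] --> xi ->
  sin (phase x (y_ k)) @[k --> \oo] --> sin (phase x xi).
Proof.
move=> /(@phase_cvg x) yxi.
exact: (@cvg_comp _ _ _ (fun k => phase x (y_ k)) (@sin R) _ _ _ yxi (@continuous_sin R (phase x xi))).
Qed.

Lemma continuous_fcos a : Int a -> continuous (fcos a).
Proof.
move=> ai xi; apply: seq_continuous_at => y_ yxi.
have [||||_] := @Rdominated_convergence _ _ _ mu
  (fun k x => a x * cos (phase x (y_ k))) (fun x => a x * cos (phase x xi)) (fun x => `|a x|).
- by move=> k; exact/Rint_measurable/Rint_cos.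
- exact: Rint_norm.
- by move=> k x; rewrite normrM ler_piMr// cos_max.
- by move=> x; apply: cvgM; [exact: cvg_cst|exact: cos_phase_cvg].
by [].
Qed.

Lemma continuous_fsin a : Int a -> continuous (fsin a).
Proof.
move=> ai xi; apply: seq_continuous_at => y_ yxi.
have [||||_] := @Rdominated_convergence _ _ _ mu
  (fun k x => a x * sin (phase x (y_ k))) (fun x => a x * sin (phase x xi)) (fun x => `|a x|).
- by move=> k; exact/Rint_measurable/Rint_sin.
- exact: Rint_norm.
- by move=> k x; rewrite normrM ler_piMr// sin_max.
- by move=> x; apply: cvgM; [exact: cvg_cst|exact: sin_phase_cvg].
by [].
Qed.

Lemma measurable_fcos a : Int a -> measurable_fun setT (fcos a).
Proof. by move=> ai; apply: continuous_measurable_rV; exact: continuous_fcos. Qed.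

Lemma measurable_fsin a : Int a -> measurable_fun setT (fsin a).
Proof. by move=> ai; apply: continuous_measurable_rV; exact: continuous_fsin. Qed.

(** Summation weights: they increase to 1 with [k], and their transform is the Poisson kernel at
    scale 1/(k+1). *)
Definition ehat k (xi : E) : R := edecay (k.+1%:R^-1 *: xi).

Lemma k1_gt0 k : 0 < k.+1%:R^-1 :> R. Proof. by rewrite invr_gt0. Qed.

Lemma Rint_ehat k : Int (ehat k).
Proof.
have := integrable_affine 0 (lt0r_neq0 (k1_gt0 k)) (integrable_edecay_rV n).
by apply: eq_integrable => // x _; rewrite /= addr0.
Qed.

Lemma ehat_ge0 k xi : 0 <= ehat k xi. Proof. exact: edecay_ge0. Qed.

Lemma ehat_le1 k xi : ehat k xi <= 1. Proof. exact: edecay_le1. Qed.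

Lemma nd_ehat xi : nondecreasing_seq (fun k => ehat k xi).
Proof.
move=> i j ij; apply: ler_prod => l _; rewrite expR_ge0/= ler_expR lerN2 !mxE !normrM.
by rewrite ler_wpM2r// !ger0_norm// lef_pV2 ?posrE// ler_nat.
Qed.

Lemma cvg_k1 : (k.+1%:R^-1 : R) @[k --> \oo] --> 0.
Proof. exact: cvg_harmonic. Qed.

Lemma cvg_ehat xi : ehat k xi @[k --> \oo] --> (1 : R).
Proof.
rewrite (_ : (fun k => _) = (fun k => \prod_(i < n) expR (- `|k.+1%:R^-1 * xi ord0 i|))); last first.
  by apply/funext => k; apply: eq_bigr => i _; rewrite mxE.
rewrite [X in _ --> X](_ : _ = \prod_(i < n) (1 : R)); last by rewrite big1.
apply: cvg_prodr => i.
rewrite -[X in _ --> X]expR0.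
have h : - `|k.+1%:R^-1 * xi ord0 i| @[k --> \oo] --> (0 : R).
  rewrite -[X in _ --> X]oppr0; apply: cvgN.
  rewrite -[X in _ --> X](normr0 R); apply: cvg_norm.
  rewrite -[X in _ --> X](mul0r (xi ord0 i)); apply: cvgM; last exact: cvg_cst.
  exact: cvg_k1.
exact: (@cvg_comp _ _ _ (fun k => - `|k.+1%:R^-1 * xi ord0 i|) (@expR R) _ _ _ h (@continuous_expR R 0)).
Qed.

Lemma poisson_le (y : E) : poisson y <= 2 ^+ n.
Proof.
rewrite -[X in _ ^+ X]card_ord -prodr_const.
apply: ler_prod => i _; rewrite divr_ge0 ?addr_ge0 ?sqr_ge0//=.
by rewrite ler_pdivrMr ?ltr_pwDl ?sqr_ge0// mulrDr mulr1 lerDl mulr_ge0// sqr_ge0.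
Qed.

(** The inner integral is the Poisson kernel at scale e = 1/(k+1), taken at [x - y], so the left
    side is a convolution. The substitution y = x - e w moves the scale from the kernel into [a],
    where the limit in [k] can be taken under a fixed density. *)
Lemma poisson_average a (x : E) k : Int a -> 
  \int[mu]_y (a y * \int[mu]_xi (ehat k xi * cos (phase (x - y) xi))) =
  \int[mu]_w (a (x - k.+1%:R^-1 *: w) * poisson w).
Proof.
move=> ai; have k0 := k1_gt0 k; set e := k.+1%:R^-1 in k0 *.
have ne0 : - e != 0 by rewrite oppr_eq0 gt_eqF.
pose f y := a y * poisson (e^-1 *: (x - y)).
have fi : Int f.
  apply: (RintM_bounded ai (M := 2 ^+ n)) => [|y].
    apply: (eq_measurable_fun (fun y : E => poisson ((- e^-1) *: y + e^-1 *: x))).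
      by move=> y _; rewrite scalerBr scaleNr addrC.
    exact: (measurableT_comp (@measurable_poisson R n) (measurable_affine_rV _ _)).
  by rewrite ger0_norm ?poisson_ge0// poisson_le.
transitivity (e ^- n * \int[mu]_y f y).
  rewrite -RintegralZl//; apply: eq_Rintegral => y _.
  under eq_Rintegral => xi _ do rewrite phaseC.
  rewrite /f mulrCA; congr (_ * _).
  exact: (Rintegral_edecay_scale (x - y) k0).
rewrite -[X in X ^- n](gtr0_norm k0) -normrN -(Rintegral_affine x ne0 fi).
apply: eq_Rintegral => w _; rewrite /f scaleNr addrC; congr (_ * poisson _).
by rewrite opprB addrC subrK scalerA mulVf ?scale1r// gt_eqF.
Qed.

Lemma Rint_mul a (b : E -> R) : measurable_fun setT a -> measurable_fun setT b ->
  Int (fun x => a x ^+ 2) -> Int (fun x => b x ^+ 2) -> Int (fun x => a x * b x).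
Proof.
move=> ma mb ia ib; apply: le_Rint (RintD (RintZl 2^-1 ia) (RintZl 2^-1 ib)).
  exact: measurable_funM.
by move=> x; exact: normrM_le.
Qed.

Lemma Rint_shift a y : Int a -> Int (fun x => a (x - y)).
Proof.
move=> ai; have := integrable_affine (- y) (oner_neq0 R) ai.
by apply: eq_integrable => // x _ /=; rewrite scale1r.
Qed.

Definition autocorr a (y : E) : R := \int[mu]_x (a x * a (x - y)).

(** * Autocorrelation and the weighted energy *)

Section autocorr.
Variable a : E -> R.
Hypotheses (ma : measurable_fun setT a) (a2 : Int (fun x => a x ^+ 2)).

Lemma Rint_autocorr y : Int (fun x => a x * a (x - y)).
Proof.
apply: Rint_mul => //; first exact: measurable_shift.
exact: (Rint_shift y a2).
Qed.

Lemma autocorr_bound y : \int[mu]_x `|a x * a (x - y)| <= \int[mu]_x (a x ^+ 2).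
Proof.
have a2y := Rint_shift y a2.
apply: (@le_trans _ _ (\int[mu]_x (2^-1 * a x ^+ 2 + 2^-1 * a (x - y) ^+ 2))).
  apply: le_Rintegral => //; first exact/Rint_norm/Rint_autocorr.
    by apply: RintD; exact: RintZl.
  by move=> x _; exact: normrM_le.
rewrite RintegralD//; [|exact: RintZl|exact: RintZl].
rewrite !RintegralZl// (Rintegral_shift (- y) a2).
set u := Rintegral _ _ _; lra.
Qed.

(** The link with translations: the autocorrelation tends to the squared norm of [a] exactly when
    the defect tends to 0. *)
Lemma trans_defect_autocorr y :
  trans_defect a y = (2 * (\int[mu]_x (a x ^+ 2)) - 2 * autocorr a y)%:E.
Proof.
have a2y := Rint_shift y a2; have iA := Rint_autocorr y.
transitivity (\int[mu]_x ((a (x - y) ^+ 2 + a x ^+ 2) - 2 * (a x * a (x - y))))%:E.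
  rewrite EFin_Rintegral; last by apply: RintB; [exact: RintD|exact: RintZl].
  by apply: eq_integral => x _; congr EFin; ring.
rewrite RintegralB//; [|exact: RintD|exact: RintZl].
rewrite RintegralD// RintegralZl// (Rintegral_shift (- y) a2).
by congr EFin; rewrite -/(autocorr a y) [2 * Rintegral _ _ _]mulr_natl mulr2n.
Qed.

Lemma autocorr_cvg (y_ : nat -> E) : y_ k @[k --> \oo] --> (0 : E) ->
  autocorr a (y_ k) @[k --> \oo] --> \int[mu]_x (a x ^+ 2).
Proof.
move=> y0; have [_ T] := trans_cont_L2 y0 ma a2.
apply/cvgrPdist_le => e e0; have := T _ e0; apply: filterS => k.
have A := trans_defect_autocorr (y_ k); rewrite A lee_fin => H.
have : (0 <= trans_defect a (y_ k))%E by apply: integral_ge0 => x _; rewrite lee_fin sqr_ge0.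
by rewrite A lee_fin => H0; rewrite ger0_norm; lra.
Qed.

Lemma measurable_sub_scale (e : R) : measurable_fun setT (fun p : E * E => p.1 - e *: p.2).
Proof.
apply: measurable_fun_coordP => i.
apply: (eq_measurable_fun (fun p : E * E => p.1 ord0 i - e * p.2 ord0 i)).
  by move=> p _; rewrite !mxE.
apply: measurable_funB; first exact: (measurableT_comp (measurable_coord i) measurable_fst).
by apply: measurable_funM => //; exact: (measurableT_comp (measurable_coord i) measurable_snd).
Qed.

(** Absolute convergence is seen by integrating in [x] first: for every shift the inner integral is
    at most the squared norm of [a], and [poisson] is integrable. *)
Lemma autocorr_fubini (e : R) : Int a -> e != 0 ->
  \int[mu]_x (a x * \int[mu]_w (a (x - e *: w) * poisson w)) =
  \int[mu]_w (poisson w * autocorr a (e *: w)).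
Proof.
move=> ai e0; pose H (p : E * E) := a p.1 * a (p.1 - e *: p.2) * poisson p.2.
have mH : measurable_fun setT H.
  apply: measurable_funM; last exact: (measurableT_comp (@measurable_poisson R n) measurable_snd).
  apply: measurable_funM; first exact: (measurableT_comp ma measurable_fst).
  exact: (measurableT_comp ma (measurable_sub_scale e)).
have iH : (mu \x mu)%E.-integrable setT (EFin \o H).
  apply/integrable21ltyP; first exact/measurable_EFinP.
  pose M := \int[mu]_x (a x ^+ 2).
  have bH w : (\int[mu]_x `|(EFin \o H) (x, w)| <= (poisson w * M)%:E)%E.
    have i1 := Rint_norm (Rint_autocorr (e *: w)).
    have -> : (\int[mu]_x `|(EFin \o H) (x, w)| =
        (\int[mu]_x (`|a x * a (x - e *: w)| * poisson w))%:E)%E.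
      rewrite EFin_Rintegral; last exact: RintZr.
      by apply: eq_integral => x _; rewrite /= normrM [X in _ * X]ger0_norm ?poisson_ge0.
    by rewrite RintegralZr// lee_fin mulrC ler_wpM2l ?poisson_ge0// autocorr_bound.
  apply: (@le_lt_trans _ _ (\int[mu]_w (poisson w * M)%:E)%E).
    have mHn : measurable_fun setT (fun p : E * E => `|(EFin \o H) p|%E).
      by apply: measurableT_comp => //; exact/measurable_EFinP.
    apply: ge0_le_integral => //.
    - by move=> w _; exact: integral_ge0.
    - exact: (measurable_fun_fubini_tonelli_G (fun p : E * E => `|(EFin \o H) p|%E)).
    - by apply/measurable_EFinP; apply: measurable_funM => //; exact: measurable_poisson.
  rewrite -EFin_Rintegral ?ltry//; apply: RintZr; exact: integrable_poisson.
have mP : measurable_fun setT (@poisson R n) := @measurable_poisson R n.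
have ne0 : - e != 0 by rewrite oppr_eq0.
have i1 x : Int (fun w => a (x - e *: w) * poisson w).
  apply: (RintM_bounded (M := 2 ^+ n) _ mP) => [|w].
    have := integrable_affine x ne0 ai.
    by apply: eq_integrable => // w _ /=; rewrite scaleNr addrC.
  by rewrite ger0_norm ?poisson_ge0// poisson_le.
have E1 : (\int[mu]_x (a x * \int[mu]_w (a (x - e *: w) * poisson w))%:E =
    \int[mu]_x \int[mu]_w (EFin \o H) (x, w))%E.
  apply: eq_integral => x _; rewrite -RintegralZl// EFin_Rintegral; last exact: RintZl.
  by apply: eq_integral => w _; rewrite /= mulrA.
have E2 : (\int[mu]_w (poisson w * autocorr a (e *: w))%:E =
    \int[mu]_w \int[mu]_x (EFin \o H) (x, w))%E.
  apply: eq_integral => w _; rewrite mulrC -RintegralZr//; last exact: Rint_autocorr.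
  rewrite EFin_Rintegral; last by apply: RintZr; exact: Rint_autocorr.
  by [].
by rewrite /Rintegral E1 E2 (Fubini iH).
Qed.

(** The integrand is signed, whereas Tonelli gives measurability in the parameter for nonnegative
    ones; so the autocorrelation is recovered from the integral [G] of the square of a sum. *)
Lemma measurable_autocorr (e : R) : measurable_fun setT (fun w : E => autocorr a (e *: w)).
Proof.
pose H (p : E * E) := a p.1 * a (p.1 - e *: p.2).
have mH : measurable_fun setT H.
  apply: measurable_funM; first exact: (measurableT_comp ma measurable_fst).
  exact: (measurableT_comp ma (measurable_sub_scale e)).
have iD w := RintD (Rint_shift (e *: w) a2) (RintD a2 (RintZl 2 (Rint_autocorr (e *: w)))).
pose G (w : E) := (\int[mu]_x ((a x + a (x - e *: w)) ^+ 2)%:E)%E.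
have mG : measurable_fun setT G.
  apply: (measurable_fun_fubini_tonelli_G (fun p : E * E => ((a p.1 + a (p.1 - e *: p.2)) ^+ 2)%:E)).
    apply/measurable_EFinP; apply: measurable_sqr; apply: measurable_funD.
      exact: (measurableT_comp ma measurable_fst).
    exact: (measurableT_comp ma (measurable_sub_scale e)).
  by move=> p; rewrite lee_fin sqr_ge0.
have GE w : fine (G w) = 2 * (\int[mu]_x (a x ^+ 2)) + 2 * autocorr a (e *: w).
  transitivity (\int[mu]_x (a (x - e *: w) ^+ 2 + (a x ^+ 2 + 2 * (a x * a (x - e *: w))))).
    by apply: eq_Rintegral => x _; ring.
  have i1 := Rint_shift (e *: w) a2; have i3 := RintZl 2 (Rint_autocorr (e *: w)).
  rewrite (RintegralD measurableT i1 (RintD a2 i3)) (RintegralD measurableT a2 i3).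
  rewrite (RintegralZl _ measurableT (Rint_autocorr (e *: w))) (Rintegral_shift (- (e *: w)) a2).
  by rewrite addrA [2 * Rintegral _ _ _]mulr_natl mulr2n.
apply: (eq_measurable_fun (fun w => 2^-1 * fine (G w) - \int[mu]_x (a x ^+ 2))).
  by move=> w _; rewrite GE mulrDr !mulrA mulVf// !mul1r addrC addKr.
apply: measurable_funB => //; apply: measurable_funM => //.
exact: (measurableT_comp (fine_measurable measurableT) mG).
Qed.

(** In each square one of the two factors is written out as an integral and moved outside by Fubini.
    The formula for the cosine of a difference then reunites the cosine and sine terms into
    [poisson_average]. *)
Lemma energy_autocorr k : Int a ->
  \int[mu]_xi (ehat k xi * (fcos a xi ^+ 2 + fsin a xi ^+ 2)) =
  \int[mu]_w (poisson w * autocorr a (k.+1%:R^-1 *: w)).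
Proof.
move=> ai; rewrite -(autocorr_fubini ai (lt0r_neq0 (k1_gt0 k))).
have ie := Rint_ehat k.
have iC : Int (fun xi => ehat k xi * fcos a xi).
  exact: RintM_bounded ie (measurable_fcos ai) (fun xi => fcos_bound xi ai).
have iS : Int (fun xi => ehat k xi * fsin a xi).
  exact: RintM_bounded ie (measurable_fsin ai) (fun xi => fsin_bound xi ai).
have iCC : Int (fun xi => ehat k xi * fcos a xi * fcos a xi).
  exact: RintM_bounded iC (measurable_fcos ai) (fun xi => fcos_bound xi ai).
have iSS : Int (fun xi => ehat k xi * fsin a xi * fsin a xi).
  exact: RintM_bounded iS (measurable_fsin ai) (fun xi => fsin_bound xi ai).
have mc : measurable_fun setT (fun p : E * E => cos (phase p.2 p.1)).
  exact: (measurableT_comp measurable_cos2 (@measurable_swap _ _ E E)).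
have ms : measurable_fun setT (fun p : E * E => sin (phase p.2 p.1)).
  exact: (measurableT_comp measurable_sin2 (@measurable_swap _ _ E E)).
pose I1 x := \int[mu]_xi (ehat k xi * fcos a xi * cos (phase x xi)).
pose I2 x := \int[mu]_xi (ehat k xi * fsin a xi * sin (phase x xi)).
have F1 : \int[mu]_xi (ehat k xi * fcos a xi * fcos a xi) = \int[mu]_x (a x * I1 x).
  apply: (kernel_fubini iC ai mc) => p; exact: cos_max.
have F2 : \int[mu]_xi (ehat k xi * fsin a xi * fsin a xi) = \int[mu]_x (a x * I2 x).
  apply: (kernel_fubini iS ai ms) => p; exact: sin_max.
transitivity (\int[mu]_x (a x * I1 x) + \int[mu]_x (a x * I2 x)).
  rewrite -F1 -F2 -(RintegralD measurableT iCC iSS).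
  by apply: eq_Rintegral => xi _; rewrite !expr2 mulrDr !mulrA.
have iI1 : Int (fun x => a x * I1 x).
  apply: (RintM_bounded ai (M := \int[mu]_xi `|ehat k xi * fcos a xi|)) => [|x].
    have := measurable_fcos iC.
    apply: eq_measurable_fun => x _; apply: eq_Rintegral => xi _; by rewrite phaseC.
  have := fcos_bound x iC; rewrite /fcos /I1.
  by under eq_Rintegral => xi _ do rewrite phaseC.
have iI2 : Int (fun x => a x * I2 x).
  apply: (RintM_bounded ai (M := \int[mu]_xi `|ehat k xi * fsin a xi|)) => [|x].
    have := measurable_fsin iS.
    apply: eq_measurable_fun => x _; apply: eq_Rintegral => xi _; by rewrite phaseC.
  have := fsin_bound x iS; rewrite /fsin /I2.
  by under eq_Rintegral => xi _ do rewrite phaseC.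
rewrite -(RintegralD measurableT iI1 iI2); apply: eq_Rintegral => x _.
rewrite -mulrDr; congr (_ * _).
have jC : Int (fun xi => ehat k xi * fcos a xi * cos (phase x xi)).
  by under [X in EFin \o X]eq_fun => xi do rewrite phaseC; exact: Rint_cos.
have jS : Int (fun xi => ehat k xi * fsin a xi * sin (phase x xi)).
  by under [X in EFin \o X]eq_fun => xi do rewrite phaseC; exact: Rint_sin.
rewrite -(poisson_average x k ai) -(RintegralD measurableT jC jS).
have mk : measurable_fun setT (fun p : E * E => cos (phase (x - p.2) p.1)).
  apply: (measurableT_comp measurable_cos).
  apply: (eq_measurable_fun (fun p : E * E => phase x p.1 - phase p.2 p.1)).
    by move=> p _; rewrite phaseB.
  apply: measurable_funB.
    exact: (measurableT_comp (measurableT_comp measurable_phase2 (pair1_measurable x)) measurable_fst).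
  exact: (measurableT_comp measurable_phase2 (@measurable_swap _ _ E E)).
rewrite -(kernel_fubini ie ai mk); last by move=> p; exact: cos_max.
apply: eq_Rintegral => xi _; rewrite -!mulrA -mulrDr; congr (_ * _).
rewrite /fcos /fsin.
rewrite -(@RintegralZr _ _ _ mu setT _ (cos (phase x xi)) measurableT (Rint_cos xi ai)).
rewrite -(@RintegralZr _ _ _ mu setT _ (sin (phase x xi)) measurableT (Rint_sin xi ai)).
have kC := RintZr (cos (phase x xi)) (Rint_cos xi ai).
have kS := RintZr (sin (phase x xi)) (Rint_sin xi ai).
rewrite -(RintegralD measurableT kC kS); apply: eq_Rintegral => y _ /=.
by rewrite phaseB cosB; ring.
Qed.

End autocorr.

(** The limit of [energy_autocorr]. The energy side uses monotone convergence, which does not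
    presuppose finite energy; the other side uses dominated convergence, the autocorrelation being
    bounded by the squared norm of [a]. *)
Lemma plancherel_real a : Int a -> Int (fun x => a x ^+ 2) ->
  (\int[mu]_xi (fcos a xi ^+ 2 + fsin a xi ^+ 2)%:E = \int[mu]_x (a x ^+ 2)%:E)%E.
Proof.
move=> ai a2; have ma := Rint_measurable ai.
pose Q xi := fcos a xi ^+ 2 + fsin a xi ^+ 2.
have Q0 xi : 0 <= Q xi by rewrite addr_ge0 ?sqr_ge0.
have mQ : measurable_fun setT Q.
  by apply: measurable_funD; apply: measurable_sqr; [exact: measurable_fcos|exact: measurable_fsin].
have iQ k : Int (fun xi => ehat k xi * Q xi).
  apply: (RintM_bounded (Rint_ehat k) mQ (M := (\int[mu]_x `|a x|) ^+ 2 + (\int[mu]_x `|a x|) ^+ 2)) => xi.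
  rewrite ger0_norm// lerD// -[X in X <= _]real_normK ?num_real//.
    by rewrite ler_sqr ?nnegrE ?Rintegral_ge0// fcos_bound.
  by rewrite ler_sqr ?nnegrE ?Rintegral_ge0// fsin_bound.
have c1 : (\int[mu]_xi (ehat k xi * Q xi)%:E)%E @[k --> \oo] --> (\int[mu]_xi (Q xi)%:E)%E.
  have -> : (\int[mu]_xi (Q xi)%:E = \int[mu]_xi limn (fun k => (ehat k xi * Q xi)%:E))%E.
    apply: eq_integral => xi _; apply/esym/cvg_lim => //.
    apply: cvg_EFin; first exact: nearW.
    rewrite -[X in _ --> X]mul1r; apply: cvgM; last exact: cvg_cst.
    exact: cvg_ehat.
  apply: cvg_monotone_convergence => //.
  - by move=> k; apply/measurable_EFinP; exact: Rint_measurable (iQ k).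
  - by move=> k xi _; rewrite lee_fin mulr_ge0// ehat_ge0.
  - by move=> xi _ i j ij; rewrite lee_fin ler_wpM2r// nd_ehat.
have [||||_ c2] := @Rdominated_convergence _ _ _ mu
  (fun k w => poisson w * autocorr a (k.+1%:R^-1 *: w))
  (fun w => poisson w * \int[mu]_x (a x ^+ 2))
  (fun w => poisson w * \int[mu]_x (a x ^+ 2)).
- move=> k; apply: measurable_funM; first exact: measurable_poisson.
  exact: measurable_autocorr.
- by apply: RintZr; exact: integrable_poisson.
- move=> k w; rewrite normrM ger0_norm ?poisson_ge0// ler_wpM2l ?poisson_ge0//.
  apply: le_trans (autocorr_bound ma a2 (k.+1%:R^-1 *: w)).
  by apply: le_normr_Rintegral => //; exact: Rint_autocorr.
- move=> w; apply: cvgM; first exact: cvg_cst.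
  apply: autocorr_cvg => //.
  rewrite -[X in _ --> X](scale0r w); apply: cvgZr_tmp; exact: cvg_k1.
have c3 : (\int[mu]_xi (ehat k xi * Q xi)%:E)%E @[k --> \oo] --> (\int[mu]_x (a x ^+ 2))%:E.
  under eq_fun => k do rewrite -EFin_Rintegral// energy_autocorr//.
  apply: cvg_EFin; first exact: nearW.
  have P1 : \int[mu]_x poisson x = 1 :> R by rewrite /Rintegral integral_poisson.
  by move: c2; rewrite RintegralZr ?P1 ?mul1r//; exact: integrable_poisson.
by rewrite -(EFin_Rintegral a2) -(cvg_lim _ c3)// (cvg_lim _ c1).
Qed.

End real_fourier.

Local Open Scope complex_scope.

(** * The L^2 Fourier transform *)

Section complex_fourier.
Context {R : realType} {n : nat}.
Local Notation E := 'rV[R]_n.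
Local Notation mu := (lebesgue_rV R n).
Implicit Types (f g u v : E -> R[i]) (c : R[i]).
Local Notation Int f := (mu.-integrable setT (EFin \o f)).
Local Notation Re := complex.Re.
Local Notation Im := complex.Im.

Lemma normc2 (z : R[i]) : Normc.normc z ^+ 2 = Re z ^+ 2 + Im z ^+ 2.
Proof. by case: z => x y /=; rewrite sqr_sqrtr// addr_ge0// sqr_ge0. Qed.

Lemma cReD (x y : R[i]) : Re (x + y) = Re x + Re y.
Proof. by case: x => a b; case: y. Qed.
Lemma cImD (x y : R[i]) : Im (x + y) = Im x + Im y.
Proof. by case: x => a b; case: y. Qed.
Lemma cReN (x : R[i]) : Re (- x) = - Re x. Proof. by case: x. Qed.
Lemma cImN (x : R[i]) : Im (- x) = - Im x. Proof. by case: x. Qed.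
Lemma cReM (x y : R[i]) : Re (x * y) = Re x * Re y - Im x * Im y.
Proof. by case: x => a b; case: y. Qed.
Lemma cImM (x y : R[i]) : Im (x * y) = Re x * Im y + Im x * Re y.
Proof. by case: x => a b; case: y. Qed.

Definition cmeasurable f : Prop :=
  measurable_fun setT (fun x => Re (f x)) /\ measurable_fun setT (fun x => Im (f x)).

Lemma sqnorm2E f : sqnorm2 f = (\int[mu]_x (Re (f x) ^+ 2 + Im (f x) ^+ 2)%:E)%E.
Proof. by apply: eq_integral => x _; rewrite normc2. Qed.

Lemma sqnorm2_ge0 f : (0 <= sqnorm2 f)%E.
Proof. by apply: integral_ge0 => x _; rewrite lee_fin sqr_ge0. Qed.

Lemma cmeasurable_normc2 f : cmeasurable f ->
  measurable_fun setT (fun x => Normc.normc (f x) ^+ 2).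
Proof.
move=> [mr mi]; under eq_fun do rewrite normc2.
by apply: measurable_funD; exact: measurable_sqr.
Qed.

Lemma L2P f : L2 f <-> [/\ cmeasurable f, Int (fun x => Re (f x) ^+ 2) &
  Int (fun x => Im (f x) ^+ 2)].
Proof.
split=> [[mr mi foo]|[[mr mi] ir ii]].
- have mf : cmeasurable f by [].
  have i2 : Int (fun x => Normc.normc (f x) ^+ 2).
    apply/ge0_RintP; [exact: cmeasurable_normc2|by move=> x; exact: sqr_ge0|exact: foo].
  split => //.
  + apply: le_Rint i2; first exact: measurable_sqr.
    by move=> x; rewrite normc2 ger0_norm ?sqr_ge0// lerDl sqr_ge0.
  + apply: le_Rint i2; first exact: measurable_sqr.
    by move=> x; rewrite normc2 ger0_norm ?sqr_ge0// lerDr sqr_ge0.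
- split => //; rewrite sqnorm2E; apply/ge0_RintP => //.
  + by apply: measurable_funD; exact: measurable_sqr.
  + by move=> x; rewrite addr_ge0 ?sqr_ge0.
  + exact: RintD.
Qed.

Lemma L2_cmeasurable f : L2 f -> cmeasurable f.
Proof. by case. Qed.

Lemma L1_cmeasurable f : L1 f -> cmeasurable f.
Proof.
move=> [fr fi]; split; first exact: (@Rint_measurable _ _ _ mu (fun x => Re (f x)) fr).
exact: (@Rint_measurable _ _ _ mu (fun x => Im (f x)) fi).
Qed.

Lemma cmeasurableD f g c : cmeasurable f -> cmeasurable g ->
  cmeasurable (fun x => f x + c * g x).
Proof.
move=> [fr fi] [gr gi]; split.
- under eq_fun do rewrite cReD cReM.
  by apply: measurable_funD => //; apply: measurable_funB; exact: measurable_funM.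
- under eq_fun do rewrite cImD cImM.
  by apply: measurable_funD => //; apply: measurable_funD; exact: measurable_funM.
Qed.

Lemma cmeasurableB f g : cmeasurable f -> cmeasurable g ->
  cmeasurable (fun x => f x - g x).
Proof.
move=> mf mg; have := cmeasurableD (-1) mf mg.
by under eq_fun do rewrite mulN1r.
Qed.

Lemma sqnorm2_comb f g c : cmeasurable f -> cmeasurable g ->
  (sqnorm2 (fun x => (f x + c * g x)%R) <=
   2%:E * sqnorm2 f + (2 * Normc.normc c ^+ 2)%:E * sqnorm2 g)%E.
Proof.
move=> mf mg; apply: ge0_integral_le_comb => //; try by move=> x; exact: sqr_ge0.
- exact: (cmeasurable_normc2 (cmeasurableD c mf mg)).
- exact: cmeasurable_normc2.
- exact: cmeasurable_normc2.
- by rewrite mulr_ge0// sqr_ge0.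
- move=> x; rewrite !normc2 !(cReD, cImD, cReM, cImM).
  set a := Re (f x); set b := Im (f x); set p := Re (g x); set q := Im (g x).
  set s := Re c; set t := Im c.
  rewrite -subr_ge0 (_ : _ - _ = (a - (s * p - t * q)) ^+ 2 + (b - (s * q + t * p)) ^+ 2).
    by rewrite addr_ge0 ?sqr_ge0.
  by ring.
Qed.

(** Young's inequality with a free parameter: the constant before [g] tends to 1 with [d], as is
    needed to keep an isometry in the limit; the constant 2 of [sqnorm2_comb] would be too large. *)
Lemma sqnorm2_tri f g (d : R) : 0 < d -> cmeasurable f -> cmeasurable g ->
  (sqnorm2 f <= (1 + d)%:E * sqnorm2 g + (1 + d^-1)%:E * sqnorm2 (fun x => (f x - g x)%R))%E.
Proof.
move=> d0 mf mg; apply: ge0_integral_le_comb => //; try by move=> x; exact: sqr_ge0.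
- exact: cmeasurable_normc2.
- exact: cmeasurable_normc2.
- exact: (cmeasurable_normc2 (cmeasurableB mf mg)).
- by rewrite addr_ge0// ltW.
- by rewrite addr_ge0// invr_ge0 ltW.
- move=> x; rewrite !normc2 !(cReD, cImD, cReN, cImN).
  set a := Re (f x); set b := Im (f x); set p := Re (g x); set q := Im (g x).
  rewrite -subr_ge0 (_ : _ - _ = ((d * p - (a - p)) ^+ 2 + (d * q - (b - q)) ^+ 2) / d).
    by rewrite divr_ge0 ?(ltW d0)// addr_ge0 ?sqr_ge0.
  by field; rewrite gt_eqF.
Qed.

Lemma sqnorm2N f : sqnorm2 (fun x => - f x) = sqnorm2 f.
Proof. by apply: eq_integral => x _; rewrite !normc2 cReN cImN !sqrrN. Qed.

Lemma sqnorm2_subC f g : sqnorm2 (fun x => f x - g x) = sqnorm2 (fun x => g x - f x).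
Proof. by rewrite -sqnorm2N; apply: eq_integral => x _; rewrite opprB. Qed.

Lemma L2D f g c : L2 f -> L2 g -> L2 (fun x => f x + c * g x).
Proof.
move=> Lf Lg; have mf := L2_cmeasurable Lf; have mg := L2_cmeasurable Lg.
have [mr mi] := cmeasurableD c mf mg; split => //.
apply: le_lt_trans (sqnorm2_comb c mf mg) _.
have [_ _ f2] := Lf; have [_ _ g2] := Lg.
by rewrite lte_add_pinfty// lte_mul_pinfty// lee_fin// mulr_ge0// sqr_ge0.
Qed.

Lemma L2B f g : L2 f -> L2 g -> L2 (fun x => f x - g x).
Proof. by move=> Lf Lg; have := L2D (-1) Lf Lg; under eq_fun do rewrite mulN1r. Qed.

Lemma L1D f g c : L1 f -> L1 g -> L1 (fun x => f x + c * g x).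
Proof.
move=> [fr fi] [gr gi]; split.
- under eq_fun do rewrite cReD cReM.
  by apply: RintD => //; apply: RintB; exact: RintZl.
- under eq_fun do rewrite cImD cImM.
  by apply: RintD => //; apply: RintD; exact: RintZl.
Qed.

Section fourier1.
Variable f : E -> R[i].
Hypothesis Lf : L1 f.
Let a x := Re (f x).
Let b x := Im (f x).
Let ai : Int a. Proof. exact: Lf.1. Qed.
Let bi : Int b. Proof. exact: Lf.2. Qed.

Lemma Re_fourier1 xi : Re (fourier1 f xi) = fcos a xi + fsin b xi.
Proof.
rewrite /fourier1 /Cintegral /= -(RintegralD measurableT (Rint_cos xi ai) (Rint_sin xi bi)).
by apply: eq_Rintegral => x _; rewrite cReM /= cosN sinN mulrN opprK.
Qed.

Lemma Im_fourier1 xi : Im (fourier1 f xi) = fcos b xi - fsin a xi.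
Proof.
rewrite /fourier1 /Cintegral /= -(RintegralB measurableT (Rint_cos xi bi) (Rint_sin xi ai)).
by apply: eq_Rintegral => x _; rewrite cImM /= cosN sinN mulrN addrC.
Qed.

Lemma continuous_Re_fourier1 : continuous (fun xi => Re (fourier1 f xi)).
Proof.
under eq_fun do rewrite Re_fourier1; move=> xi; have FF := nbhs_filter xi.
by apply: cvgD; [exact: continuous_fcos|exact: continuous_fsin].
Qed.

Lemma continuous_Im_fourier1 : continuous (fun xi => Im (fourier1 f xi)).
Proof.
under eq_fun do rewrite Im_fourier1; move=> xi; have FF := nbhs_filter xi.
by apply: cvgB; [exact: continuous_fcos|exact: continuous_fsin].
Qed.

Lemma cmeasurable_fourier1 : cmeasurable (fourier1 f).
Proof.
by split; apply: continuous_measurable_rV;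
  [exact: continuous_Re_fourier1|exact: continuous_Im_fourier1].
Qed.

(** For f = a + i b the squared modulus of the transform is the sum of those of [a] and [b] and
    twice a cross term [X], which is odd in [xi] and integrates to 0. *)
Lemma plancherel1 : L2 f -> sqnorm2 (fourier1 f) = sqnorm2 f.
Proof.
move=> /L2P[_ a2 b2].
have Pa := plancherel_real ai a2; have Pb := plancherel_real bi b2.
have mca := measurable_fcos ai; have msa := measurable_fsin ai.
have mcb := measurable_fcos bi; have msb := measurable_fsin bi.
have iA : Int (fun xi => fcos a xi ^+ 2 + fsin a xi ^+ 2).
  apply/ge0_RintP; first by apply: measurable_funD; exact: measurable_sqr.
    by move=> xi; rewrite addr_ge0 ?sqr_ge0.
  by rewrite Pa -EFin_Rintegral// ltry.
have iB : Int (fun xi => fcos b xi ^+ 2 + fsin b xi ^+ 2).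
  apply/ge0_RintP; first by apply: measurable_funD; exact: measurable_sqr.
    by move=> xi; rewrite addr_ge0 ?sqr_ge0.
  by rewrite Pb -EFin_Rintegral// ltry.
pose X xi := fcos a xi * fsin b xi - fcos b xi * fsin a xi.
have iX : Int X.
  apply: le_Rint (RintD iA iB).
    by apply: measurable_funB; exact: measurable_funM.
  move=> xi; apply: le_trans (ler_normB _ _) _.
  apply: le_trans (lerD (normrM_le _ _) (normrM_le _ _)) _.
  have := sqr_ge0 (fcos a xi); have := sqr_ge0 (fcos b xi).
  have := sqr_ge0 (fsin a xi); have := sqr_ge0 (fsin b xi).
  move: (fcos a xi ^+ 2) (fcos b xi ^+ 2) (fsin a xi ^+ 2) (fsin b xi ^+ 2) => p q r s.
  lra.
have X0 : \int[mu]_xi X xi = 0.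
  have : \int[mu]_xi X xi = - \int[mu]_xi X xi.
    rewrite -[LHS](Rintegral_opp iX) -mulN1r -RintegralZl//.
    by apply: eq_Rintegral => xi _; rewrite /X !fcosN !fsinN//; ring.
  by move=> /eqP; rewrite -addr_eq0 -mulr2n mulrn_eq0 => /eqP.
rewrite !sqnorm2E.
transitivity (\int[mu]_xi ((fcos a xi ^+ 2 + fsin a xi ^+ 2) +
   ((fcos b xi ^+ 2 + fsin b xi ^+ 2) + 2 * X xi)))%:E.
  rewrite EFin_Rintegral; last by apply: RintD => //; apply: RintD => //; exact: RintZl.
  by apply: eq_integral => xi _; rewrite Re_fourier1 Im_fourier1 /X; congr EFin; ring.
have iX2 := RintZl 2 iX.
rewrite (RintegralD measurableT iA (RintD iB iX2)) (RintegralD measurableT iB iX2).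
rewrite (RintegralZl _ measurableT iX) X0 mulr0 addr0.
have -> : (\int[mu]_x (a x ^+ 2 + b x ^+ 2)%:E)%E = (\int[mu]_x (a x ^+ 2 + b x ^+ 2))%:E.
  by rewrite EFin_Rintegral//; exact: RintD.
rewrite (RintegralD measurableT a2 b2) !EFinD !EFin_Rintegral// Pa Pb.
by rewrite -!EFin_Rintegral.
Qed.

End fourier1.

Lemma fourier1D f g c xi : L1 f -> L1 g ->
  fourier1 (fun x => f x + c * g x) xi = fourier1 f xi + c * fourier1 g xi.
Proof.
move=> Lf Lg; have Lh := L1D c Lf Lg; have [fr fi] := Lf; have [gr gi] := Lg.
have CD (p q r : E -> R) s t : Int p -> Int q -> Int r ->
   fcos (fun x => p x + (s * q x + t * r x)) xi = fcos p xi + (s * fcos q xi + t * fcos r xi).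
  move=> ip iq ir.
  have jp := Rint_cos xi ip; have jq := RintZl s (Rint_cos xi iq); have jr := RintZl t (Rint_cos xi ir).
  rewrite /fcos -(RintegralZl _ measurableT (Rint_cos xi iq)) -(RintegralZl _ measurableT (Rint_cos xi ir)).
  rewrite -(RintegralD measurableT jq jr) -(RintegralD measurableT jp (RintD jq jr)).
  by apply: eq_Rintegral => x _; ring.
have SD (p q r : E -> R) s t : Int p -> Int q -> Int r ->
   fsin (fun x => p x + (s * q x + t * r x)) xi = fsin p xi + (s * fsin q xi + t * fsin r xi).
  move=> ip iq ir.
  have jp := Rint_sin xi ip; have jq := RintZl s (Rint_sin xi iq); have jr := RintZl t (Rint_sin xi ir).
  rewrite /fsin -(RintegralZl _ measurableT (Rint_sin xi iq)) -(RintegralZl _ measurableT (Rint_sin xi ir)).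
  rewrite -(RintegralD measurableT jq jr) -(RintegralD measurableT jp (RintD jq jr)).
  by apply: eq_Rintegral => x _; ring.
have ER : (fun x => Re (f x + c * g x)) = (fun x => Re (f x) + (Re c * Re (g x) + (- Im c) * Im (g x))).
  by apply/funext => x; rewrite cReD cReM mulNr.
have EI : (fun x => Im (f x + c * g x)) = (fun x => Im (f x) + (Re c * Im (g x) + Im c * Re (g x))).
  by apply/funext => x; rewrite cImD cImM.
apply/eqP; rewrite eq_complex; apply/andP; split; apply/eqP.
- rewrite cReD cReM !Re_fourier1// Im_fourier1// ER EI CD// SD//; ring.
- rewrite cImD cImM !Im_fourier1// Re_fourier1// ER EI CD// SD//; ring.
Qed.

Lemma cvg0_le (u_ v_ w_ : nat -> \bar R) (a b : R) : 0 <= a -> 0 <= b ->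
  (forall k, 0 <= u_ k)%E -> (forall k, u_ k <= a%:E * v_ k + b%:E * w_ k)%E ->
  v_ k @[k --> \oo] --> 0%E -> w_ k @[k --> \oo] --> 0%E -> u_ k @[k --> \oo] --> 0%E.
Proof.
move=> a0 b0 u0 uvw v0 w0.
have h : (a%:E * v_ k + b%:E * w_ k)%E @[k --> \oo] --> 0%E.
  rewrite -[X in _ --> X]adde0; apply: cvgeD => //.
    by rewrite -[X in _ --> X](mule0 a%:E); apply: cvgeZl.
  by rewrite -[X in _ --> X](mule0 b%:E); apply: cvgeZl.
apply: (squeeze_cvge _ (cvg_cst 0%E) h).
by apply: nearW => k; rewrite u0 uvw.
Qed.

Lemma is_fourierD f g f' g' c : is_fourier f g -> is_fourier f' g' ->
  is_fourier (fun x => f x + c * f' x) (fun xi => g xi + c * g' xi).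
Proof.
move=> [Lf Lg [F [LF Ff Fg]]] [Lf' Lg' [F' [LF' Ff' Fg']]].
split; [exact: L2D|exact: L2D|].
exists (fun k x => F k x + c * F' k x); split.
- by move=> k; have [? ?] := LF k; have [? ?] := LF' k; split; [exact: L1D|exact: L2D].
- apply: (@cvg0_le _ _ _ 2 (2 * Normc.normc c ^+ 2)) Ff Ff' => //.
  + by rewrite mulr_ge0// sqr_ge0.
  + by move=> k; exact: sqnorm2_ge0.
  + move=> k; rewrite (_ : (fun x => _ - _) = (fun x => (F k x - f x) + c * (F' k x - f' x))).
      by apply: sqnorm2_comb; apply: cmeasurableB; apply: L2_cmeasurable => //; have [] := LF k; have [] := LF' k.
    by apply/funext => x; ring.
- apply: (@cvg0_le _ _ _ 2 (2 * Normc.normc c ^+ 2)) Fg Fg' => //.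
  + by rewrite mulr_ge0// sqr_ge0.
  + by move=> k; exact: sqnorm2_ge0.
  + move=> k; have [L _] := LF k; have [L' _] := LF' k.
    rewrite (_ : (fun x => _ - _) = (fun x => (fourier1 (F k) x - g x) + c * (fourier1 (F' k) x - g' x))).
      by apply: sqnorm2_comb; apply: cmeasurableB;
        [exact: cmeasurable_fourier1|exact: L2_cmeasurable|exact: cmeasurable_fourier1|exact: L2_cmeasurable].
    by apply/funext => x; rewrite fourier1D//; ring.
Qed.

Lemma is_fourierB f g f' g' : is_fourier f g -> is_fourier f' g' ->
  is_fourier (fun x => f x - f' x) (fun xi => g xi - g' xi).
Proof.
move=> H H'; have := is_fourierD (-1) H H'.
rewrite (_ : (fun x => _) = (fun x => f x - f' x)); last by apply/funext => x; rewrite mulN1r.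
by rewrite (_ : (fun x => g x + _) = (fun x => g x - g' x)); last by apply/funext => x; rewrite mulN1r.
Qed.

(* (1 + d)^2 is the loss of the two triangle inequalities through F k. *)
Lemma sqnorm2_limit_le f g (F G : nat -> E -> R[i]) : L2 f -> L2 g ->
  (forall k, cmeasurable (F k)) -> (forall k, cmeasurable (G k)) ->
  (forall k, sqnorm2 (F k) = sqnorm2 (G k)) ->
  sqnorm2 (fun x => F k x - f x) @[k --> \oo] --> 0%E ->
  sqnorm2 (fun x => G k x - g x) @[k --> \oo] --> 0%E ->
  (sqnorm2 f <= sqnorm2 g)%E.
Proof.
move=> Lf Lg mF mG FG Ff Gg.
have [mf mg] := (L2_cmeasurable Lf, L2_cmeasurable Lg).
have [_ _ f2] := Lf; have [_ _ g2] := Lg.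
have step (d : R) : 0 < d -> (sqnorm2 f <= ((1 + d) * (1 + d))%:E * sqnorm2 g)%E.
  move=> d0; have d10 : 0 <= 1 + d by rewrite addr_ge0// ltW.
  have dV : 0 <= 1 + d^-1 by rewrite addr_ge0// invr_ge0 ltW.
  pose r k := ((1 + d)%:E * ((1 + d^-1)%:E * sqnorm2 (fun x => (G k x - g x)%R)) +
     (1 + d^-1)%:E * sqnorm2 (fun x => (F k x - f x)%R))%E.
  have r0 : r k @[k --> \oo] --> 0%E.
    rewrite -[X in _ --> X]adde0; apply: cvgeD => //.
      rewrite -[X in _ --> X](mule0 (1 + d)%:E); apply: cvgeZl => //.
      by rewrite -[X in _ --> X](mule0 (1 + d^-1)%:E); apply: cvgeZl.
    by rewrite -[X in _ --> X](mule0 (1 + d^-1)%:E); apply: cvgeZl.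
  have le k : (sqnorm2 f <= ((1 + d) * (1 + d))%:E * sqnorm2 g + r k)%E.
    apply: le_trans (sqnorm2_tri d0 mf (mF k)) _.
    rewrite sqnorm2_subC /r addeA leeD2r// FG.
    apply: le_trans (lee_wpmul2l _ (sqnorm2_tri d0 (mG k) mg)) _; first by rewrite lee_fin.
    by rewrite ge0_muleDr ?mule_ge0 ?sqnorm2_ge0 ?lee_fin// muleA EFinM.
  have lim : (((1 + d) * (1 + d))%:E * sqnorm2 g + r k)%E @[k --> \oo] -->
      (((1 + d) * (1 + d))%:E * sqnorm2 g)%E.
    rewrite -[X in _ --> X]adde0; apply: cvgeD => //; last exact: cvg_cst.
    by rewrite fin_num_adde_defl.
  by rewrite -(cvg_lim _ lim)//; apply: lime_ge; [apply/cvg_ex; eexists; exact: lim|exact: nearW].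
have gfin : sqnorm2 g \is a fin_num by rewrite ge0_fin_numE// sqnorm2_ge0.
have lim : (((1 + k.+1%:R^-1 : R) * (1 + k.+1%:R^-1))%:E * sqnorm2 g)%E @[k --> \oo] --> (1%:E * sqnorm2 g)%E.
  apply: cvgeZr => //; apply: cvg_EFin; first exact: nearW.
  have h1 : (1 + k.+1%:R^-1 : R) @[k --> \oo] --> (1 : R).
    rewrite -[X in _ --> X]addr0; apply: cvgD; first exact: cvg_cst.
    exact: cvg_harmonic.
  by rewrite -[X in _ --> X]mulr1; exact: cvgM.
rewrite -[leRHS]mul1e -(cvg_lim _ lim)//; apply: lime_ge; first by apply/cvg_ex; eexists; exact: lim.
by apply: nearW => k; apply: step; rewrite invr_gt0.
Qed.

Lemma is_fourier_isometry f g : is_fourier f g -> sqnorm2 f = sqnorm2 g.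
Proof.
move=> [Lf Lg [F [LF Ff Fg]]].
have mF k : cmeasurable (F k) by apply: L1_cmeasurable; have [] := LF k.
have mG k : cmeasurable (fourier1 (F k)) by apply: cmeasurable_fourier1; have [] := LF k.
have FG k : sqnorm2 (F k) = sqnorm2 (fourier1 (F k)) by have [? ?] := LF k; rewrite plancherel1.
apply/eqP; rewrite eq_le; apply/andP; split.
  exact: sqnorm2_limit_le Ff Fg.
by apply: (sqnorm2_limit_le _ _ mG mF _ Fg Ff).
Qed.

End complex_fourier.

(** * Uniqueness, conjugation and Parseval's identity *)

Section fourier_graph.
Context {R : realType} {n : nat}.
Local Notation E := 'rV[R]_n.
Local Notation mu := (lebesgue_rV R n).
Implicit Types (f g u v : E -> R[i]) (c : R[i]).
Local Notation Int f := (mu.-integrable setT (EFin \o f)).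
Local Notation Re := complex.Re.
Local Notation Im := complex.Im.

Lemma ae_sqnorm2 f g : cmeasurable f -> cmeasurable g ->
  {ae mu, forall x, f x = g x} -> sqnorm2 f = sqnorm2 g.
Proof.
move=> mf mg fg; apply: ae_eq_integral => //.
- by apply/measurable_EFinP; exact: cmeasurable_normc2.
- by apply/measurable_EFinP; exact: cmeasurable_normc2.
- by apply: filterS fg => x fgx _; rewrite fgx.
Qed.

Lemma ae_L2 f g : L2 f -> cmeasurable g -> {ae mu, forall x, f x = g x} -> L2 g.
Proof.
move=> [mr mi f2] mg fg; have [mgr mgi] := mg.
by split => //; rewrite -(ae_sqnorm2 (conj mr mi) mg fg).
Qed.

Lemma ae_is_fourier f g h : is_fourier f g -> cmeasurable h ->
  {ae mu, forall x, g x = h x} -> is_fourier f h.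
Proof.
move=> [Lf Lg [F [LF Ff Fg]]] mh gh; have Lh := ae_L2 Lg mh gh.
split => //; exists F; split => //.
suff -> : (fun k => sqnorm2 (fun xi => fourier1 (F k) xi - h xi)) =
  (fun k => sqnorm2 (fun xi => fourier1 (F k) xi - g xi)) by [].
apply/funext => k; have [LFk _] := LF k; have mFk := cmeasurable_fourier1 LFk.
apply: ae_sqnorm2.
- exact: cmeasurableB.
- by apply: cmeasurableB => //; exact: L2_cmeasurable.
- by apply: filterS gh => x ->.
Qed.

Lemma sqnorm2_eq0 f : cmeasurable f -> sqnorm2 f = 0%E ->
  {ae mu, forall x, f x = 0}.
Proof.
move=> mf f0; have mf2 := cmeasurable_normc2 mf.
have /(ae_eq_integral_abs mu measurableT) [+ _] :
  measurable_fun setT (EFin \o (fun x => Normc.normc (f x) ^+ 2)) by exact/measurable_EFinP.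
rewrite (_ : (\int[mu]_(x in setT) _)%E = sqnorm2 f); last first.
  by apply: eq_integral => x _; rewrite /= ger0_norm ?sqr_ge0.
move=> /(_ f0); apply: filterS => x /(_ I)[] /eqP.
by rewrite sqrf_eq0 => /eqP /Normc.eq0_normc.
Qed.

(** By linearity the difference has transform 0, and the isometry makes its norm 0. *)
Lemma is_fourier_uniq_l f f' g : is_fourier f g -> is_fourier f' g ->
  {ae mu, forall x, f x = f' x}.
Proof.
move=> H H'; have D := is_fourierB H H'; have [LD _ _] := D.
have := is_fourier_isometry D.
rewrite [RHS](_ : _ = 0%E); last first.
  by apply: integral0_eq => x _; rewrite subrr normc2 /= expr0n addr0.
move=> /(sqnorm2_eq0 (L2_cmeasurable LD)); apply: filterS => x /eqP.
by rewrite subr_eq0 => /eqP.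
Qed.

Lemma is_fourier_uniq_r f g g' : is_fourier f g -> is_fourier f g' ->
  {ae mu, forall x, g x = g' x}.
Proof.
move=> H H'; have D := is_fourierB H H'; have [_ LD _] := D.
have := is_fourier_isometry D.
rewrite [LHS](_ : _ = 0%E); last first.
  by apply: integral0_eq => x _; rewrite subrr normc2 /= expr0n addr0.
move=> /esym /(sqnorm2_eq0 (L2_cmeasurable LD)); apply: filterS => x /eqP.
by rewrite subr_eq0 => /eqP.
Qed.

Lemma is_fourierP f g : is_fourier f g -> is_fourier f (fourier f).
Proof. by move=> H; rewrite /fourier; apply: (@xgetPex _ (fun=> 0) [set g | is_fourier f g]); exists g. Qed.

Lemma is_fourierZ f g c : is_fourier f g ->
  is_fourier (fun x => c * f x) (fun x => c * g x).
Proof.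
(* [c * f] is written as [f + (c - 1) * f]. *)
move=> H; have := is_fourierD (c - 1) H H.
rewrite (_ : (fun x => _) = (fun x => c * f x)); last by apply/funext => x; ring.
by rewrite (_ : (fun x => g x + _) = (fun x => c * g x)); last by apply/funext => x; ring.
Qed.

Lemma cReC (z : R[i]) : Re (conjc z) = Re z. Proof. by case: z. Qed.
Lemma cImC (z : R[i]) : Im (conjc z) = - Im z. Proof. by case: z. Qed.

Lemma cmeasurable_conj f : cmeasurable f -> cmeasurable (fun x => conjc (f x)).
Proof.
move=> [mr mi]; split; first by under eq_fun do rewrite cReC.
by under eq_fun do rewrite cImC; exact: measurable_funN.
Qed.

Lemma measurable_opp_rV : measurable_fun setT (fun x : E => - x).
Proof.
apply: (eq_measurable_fun (fun x : E => -1 *: x + 0)).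
  by move=> x _; rewrite scaleN1r addr0.
exact: measurable_affine_rV.
Qed.

Lemma cmeasurable_opp f : cmeasurable f -> cmeasurable (fun x => f (- x)).
Proof.
move=> [mr mi]; split.
  exact: (measurableT_comp mr measurable_opp_rV).
exact: (measurableT_comp mi measurable_opp_rV).
Qed.

Lemma sqnorm2_conj f : sqnorm2 (fun x => conjc (f x)) = sqnorm2 f.
Proof. by apply: eq_integral => x _; rewrite !normc2 cReC cImC sqrrN. Qed.

Lemma sqnorm2_opp f : cmeasurable f -> sqnorm2 (fun x => f (- x)) = sqnorm2 f.
Proof.
move=> mf; apply: (ge0_integral_opp (f := fun x => (Normc.normc (f x) ^+ 2)%:E)).
  by apply/measurable_EFinP; exact: cmeasurable_normc2.
by move=> x; rewrite lee_fin sqr_ge0.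
Qed.

Lemma L2_conj f : L2 f -> L2 (fun x => conjc (f x)).
Proof.
move=> Lf; have [mr mi] := cmeasurable_conj (L2_cmeasurable Lf).
by split => //; rewrite sqnorm2_conj; have [] := Lf.
Qed.

Lemma L2_opp f : L2 f -> L2 (fun x => f (- x)).
Proof.
move=> Lf; have mf := L2_cmeasurable Lf; have [mr mi] := cmeasurable_opp mf.
by split => //; rewrite sqnorm2_opp//; have [] := Lf.
Qed.

Lemma L1_conj f : L1 f -> L1 (fun x => conjc (f x)).
Proof.
move=> [fr fi]; split; first by under eq_fun do rewrite cReC.
under eq_fun do rewrite cImC; exact: (@RintN _ _ _ mu (fun x => Im (f x)) fi).
Qed.

Lemma fcosZ (r : R) (a : E -> R) xi : Int a ->
  fcos (fun x => r * a x) xi = r * fcos a xi.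
Proof.
move=> ai; rewrite -(RintegralZl _ measurableT (Rint_cos xi ai)).
by apply: eq_Rintegral => x _; rewrite mulrA.
Qed.

Lemma fsinZ (r : R) (a : E -> R) xi : Int a ->
  fsin (fun x => r * a x) xi = r * fsin a xi.
Proof.
move=> ai; rewrite -(RintegralZl _ measurableT (Rint_sin xi ai)).
by apply: eq_Rintegral => x _; rewrite mulrA.
Qed.

Lemma fourier1_conj f xi : L1 f ->
  fourier1 (fun x => conjc (f x)) xi = conjc (fourier1 f (- xi)).
Proof.
move=> Lf; have Lc := L1_conj Lf; have [fr fi] := Lf.
have ER : (fun x => Re (conjc (f x))) = (fun x => Re (f x)).
  by apply/funext => x; rewrite cReC.
have EI : (fun x => Im (conjc (f x))) = (fun x => - 1 * Im (f x)).
  by apply/funext => x; rewrite cImC mulN1r.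
have Cm : fcos (fun x => -1 * Im (f x)) xi = - fcos (fun x => Im (f x)) xi.
  by rewrite fcosZ// mulN1r.
have Sm : fsin (fun x => -1 * Im (f x)) xi = - fsin (fun x => Im (f x)) xi.
  by rewrite fsinZ// mulN1r.
apply/eqP; rewrite eq_complex cReC cImC !Re_fourier1// !Im_fourier1//.
rewrite ER EI Cm Sm !fcosN !fsinN// eqxx /=.
by apply/eqP; ring.
Qed.

Lemma is_fourier_conj f g : is_fourier f g ->
  is_fourier (fun x => conjc (f x)) (fun xi => conjc (g (- xi))).
Proof.
move=> [Lf Lg [F [LF Ff Fg]]]; split; [exact: L2_conj|exact/L2_conj/L2_opp|].
exists (fun k x => conjc (F k x)); split.
- by move=> k; have [? ?] := LF k; split; [exact: L1_conj|exact: L2_conj].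
- suff -> : (fun k => sqnorm2 (fun x => conjc (F k x) - conjc (f x))) =
    (fun k => sqnorm2 (fun x => F k x - f x)) by [].
  apply/funext => k.
  by rewrite -[RHS]sqnorm2_conj; apply: eq_integral => x _; rewrite rmorphB.
- suff -> : (fun k => sqnorm2 (fun xi => fourier1 (fun x => conjc (F k x)) xi - conjc (g (- xi)))) =
    (fun k => sqnorm2 (fun xi => fourier1 (F k) xi - g xi)) by [].
  apply/funext => k; have [LFk _] := LF k.
  rewrite -[RHS]sqnorm2_conj -[RHS]sqnorm2_opp; last first.
    apply: cmeasurable_conj; apply: cmeasurableB; first exact: cmeasurable_fourier1.
    exact: L2_cmeasurable.
  by apply: eq_integral => x _; rewrite fourier1_conj// rmorphB.
Qed.

(* The real part of the hermitian product, which polarizes [sqnorm2]. *)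
Definition dotr f g : R := \int[mu]_x (Re (f x) * Re (g x) + Im (f x) * Im (g x)).

Lemma dotr_polar f g : L2 f -> L2 g -> dotr f g =
  (fine (sqnorm2 (fun x => f x + 1 * g x)) - fine (sqnorm2 (fun x => f x - g x))) / 4.
Proof.
move=> Lf Lg; rewrite !sqnorm2E -/(Rintegral _ _ _) -/(Rintegral _ _ _).
have /L2P[_ ip1 ip2] := L2D 1 Lf Lg; have /L2P[_ im1 im2] := L2B Lf Lg.
rewrite -(RintegralB measurableT (RintD ip1 ip2) (RintD im1 im2)) mulrC.
rewrite -(RintegralZl _ measurableT (RintB (RintD ip1 ip2) (RintD im1 im2))).
apply: eq_Rintegral => x _; by rewrite !mul1r !(cReD, cImD, cReN, cImN); field.
Qed.

Lemma is_fourier_dotr u g v h : is_fourier u g -> is_fourier v h ->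
  dotr u v = dotr g h.
Proof.
move=> Hu Hv; have [Lu Lg _] := Hu; have [Lv Lh _] := Hv.
rewrite !dotr_polar//.
by rewrite (is_fourier_isometry (is_fourierD 1 Hu Hv)) (is_fourier_isometry (is_fourierB Hu Hv)).
Qed.

(** Conjugating [u] turns the bilinear pairing into a hermitian product, and the factor [- 'i]
    brings its imaginary part into a real one. *)
Lemma pairing_dotr u v :
  pairing u v = dotr (fun x => conjc (u x)) v +i* dotr (fun x => conjc (u x)) (fun x => - 'i * v x).
Proof.
rewrite /pairing /Cintegral; congr (_ +i* _); apply: eq_Rintegral => x _.
  by rewrite cReM cReC cImC mulNr.
by rewrite cImM !(cReM, cImM, cReN, cImN, cReC, cImC) /=; ring.
Qed.

(** The reflection comes from the absence of conjugation in [pairing]: conjugating [u] conjugates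
    and reflects its transform, and the two conjugations cancel. *)
Lemma parseval u g v h : is_fourier u g -> is_fourier v h ->
  pairing u v = pairing (fun xi => g (- xi)) h.
Proof.
move=> Hu Hv; rewrite !pairing_dotr; have Hc := is_fourier_conj Hu.
by rewrite (is_fourier_dotr Hc Hv) (is_fourier_dotr Hc (is_fourierZ (- 'i) Hv)).
Qed.

End fourier_graph.

(** * Inversion and truncation *)

Section inversion.
Context {R : realType} {n : nat}.
Local Notation E := 'rV[R]_n.
Local Notation mu := (lebesgue_rV R n).
Implicit Types (f g u v : E -> R[i]) (a b p q : E -> R).
Local Notation Int f := (mu.-integrable setT (EFin \o f)).
Local Notation Re := complex.Re.
Local Notation Im := complex.Im.

Lemma Rint_mul_fcos a b : Int a -> Int b -> Int (fun x => a x * fcos b x).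
Proof.
move=> ai bi; apply: (RintM_bounded ai (measurable_fcos bi)) => x.
exact: fcos_bound.
Qed.

Lemma Rint_mul_fsin a b : Int a -> Int b -> Int (fun x => a x * fsin b x).
Proof.
move=> ai bi; apply: (RintM_bounded ai (measurable_fsin bi)) => x.
exact: fsin_bound.
Qed.

Lemma fcos_sym a b : Int a -> Int b ->
  \int[mu]_x (a x * fcos b x) = \int[mu]_x (b x * fcos a x).
Proof.
move=> ai bi.
have := kernel_fubini ai bi (@measurable_cos2 R n) (fun=> cos_max _) => /= <-.
apply: eq_Rintegral => x _; congr (_ * _); apply: eq_Rintegral => y _.
by rewrite phaseC.
Qed.

Lemma fsin_sym a b : Int a -> Int b ->
  \int[mu]_x (a x * fsin b x) = \int[mu]_x (b x * fsin a x).
Proof.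
move=> ai bi.
have := kernel_fubini ai bi (@measurable_sin2 R n) (fun=> sin_max _) => /= <-.
apply: eq_Rintegral => x _; congr (_ * _); apply: eq_Rintegral => y _.
by rewrite phaseC.
Qed.

(** The adjoint of the transform is the inverse transform: four instances of the multiplication
    formula, one for each pairing of a real or imaginary part of [f] with one of [g]. *)
Lemma dotr_fourier1 f g : L1 f -> L1 g ->
  dotr (fourier1 f) g = dotr f (fun x => fourier1 g (- x)).
Proof.
move=> Lf Lg; have [fr fi] := Lf; have [gr gi] := Lg.
pose p x := Re (f x); pose q x := Im (f x); pose a x := Re (g x); pose b x := Im (g x).
have [ip iq ia ib] : [/\ Int p, Int q, Int a & Int b] by [].
have j1 := Rint_mul_fcos ia ip; have j2 := Rint_mul_fsin ia iq.
have j3 := Rint_mul_fcos ib iq; have j4 := Rint_mul_fsin ib ip.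
have k1 := Rint_mul_fcos ip ia; have k2 := Rint_mul_fsin ip ib.
have k3 := Rint_mul_fcos iq ib; have k4 := Rint_mul_fsin iq ia.
transitivity (\int[mu]_x ((a x * fcos p x + a x * fsin q x) + (b x * fcos q x - b x * fsin p x))).
  by apply: eq_Rintegral => x _; rewrite Re_fourier1// Im_fourier1// -/p -/q -/(a x) -/(b x); ring.
rewrite (RintegralD measurableT (RintD j1 j2) (RintB j3 j4)).
rewrite (RintegralD measurableT j1 j2) (RintegralB measurableT j3 j4).
transitivity (\int[mu]_x ((p x * fcos a x - p x * fsin b x) + (q x * fcos b x + q x * fsin a x))); last first.
  apply: eq_Rintegral => x _; rewrite Re_fourier1// Im_fourier1// !fcosN !fsinN//.
  by rewrite -/a -/b -/(p x) -/(q x); ring.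
rewrite (RintegralD measurableT (RintB k1 k2) (RintD k3 k4)).
rewrite (RintegralB measurableT k1 k2) (RintegralD measurableT k3 k4).
have E1 := fcos_sym ia ip; have E2 := fsin_sym ia iq.
have E3 := fcos_sym ib iq; have E4 := fsin_sym ib ip.
move: (\int[mu]_x (a x * fcos p x)) (\int[mu]_x (a x * fsin q x)) E1 E2 => _ _ -> ->.
move: (\int[mu]_x (b x * fcos q x)) (\int[mu]_x (b x * fsin p x)) E3 E4 => _ _ -> ->.
move: (\int[mu]_x (p x * fcos a x)) (\int[mu]_x (p x * fsin b x)) => A B.
by move: (\int[mu]_x (q x * fcos b x)) (\int[mu]_x (q x * fsin a x)) => C D; ring.
Qed.

Lemma sqnorm2_subE f g : L2 f -> L2 g -> sqnorm2 (fun x => f x - g x) =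
  (fine (sqnorm2 f) + fine (sqnorm2 g) - 2 * dotr f g)%:E.
Proof.
move=> Lf Lg; rewrite !sqnorm2E -/(Rintegral _ _ _) -/(Rintegral _ _ _).
have /L2P[[mfr mfi] f1 f2] := Lf; have /L2P[[mgr mgi] g1 g2] := Lg.
have /L2P[_ d1 d2] := L2B Lf Lg.
have ip : Int (fun x => Re (f x) * Re (g x) + Im (f x) * Im (g x)).
  by apply: RintD; exact: Rint_mul.
rewrite -EFin_Rintegral; last exact: RintD.
rewrite -(RintegralZl _ measurableT ip) -(RintegralD measurableT (RintD f1 f2) (RintD g1 g2)).
rewrite -(RintegralB measurableT (RintD (RintD f1 f2) (RintD g1 g2)) (RintZl 2 ip)).
by congr EFin; apply: eq_Rintegral => x _; rewrite !(cReD, cImD, cReN, cImN); ring.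
Qed.

Lemma L2_fourier1 f : L1 f -> L2 f -> L2 (fourier1 f).
Proof.
move=> L1f L2f; have [mr mi] := cmeasurable_fourier1 L1f.
by split => //; rewrite plancherel1//; have [] := L2f.
Qed.

(** Both squares are expanded: the norms agree by Plancherel, the cross terms by adjointness. This
    converts approximation of functions into approximation of transforms before inversion is
    known. *)
Lemma sqnorm2_fourier1_sub f g : L1 f -> L2 f -> L1 g -> L2 g ->
  sqnorm2 (fun xi => fourier1 f xi - g xi) =
  sqnorm2 (fun x => f x - fourier1 g (- x)).
Proof.
move=> L1f L2f L1g L2g.
have Lf' := L2_fourier1 L1f L2f; have Lg' := L2_opp (L2_fourier1 L1g L2g).
rewrite !sqnorm2_subE// dotr_fourier1// plancherel1//.
by rewrite sqnorm2_opp ?plancherel1//; exact: cmeasurable_fourier1.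
Qed.

Lemma is_fourier_fourier1 f : L1 f -> L2 f -> is_fourier f (fourier1 f).
Proof.
move=> L1f L2f; split => //; first exact: L2_fourier1.
exists (fun=> f); split => //.
  rewrite (_ : (fun _ => _) = (fun=> 0%E)); first exact: cvg_cst.
  by apply/funext => k; apply: integral0_eq => x _; rewrite subrr normc2 /= expr0n addr0.
rewrite (_ : (fun _ => _) = (fun=> 0%E)); first exact: cvg_cst.
by apply/funext => k; apply: integral0_eq => x _; rewrite subrr normc2 /= expr0n addr0.
Qed.

Definition box (k : nat) : set E := ball (0 : E) k.+1%:R.

Lemma box01 k (x : E) : 0 <= (\1_(box k) x : R) <= 1.
Proof. by rewrite indicE; case: (_ \in _); rewrite lexx ler01. Qed.

Lemma measurable_box k : measurable (box k).
Proof. exact: measurable_rV_ball. Qed.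

Lemma cvg_box (x : E) : (\1_(box k) x : R) @[k --> \oo] --> (1 : R).
Proof.
apply: cvg_near_cst; have xm := archi_boundP (normr_ge0 x).
exists (Num.bound `|x|) => // k /= mk; rewrite indicE mem_set//.
rewrite /box mx_norm_ball /ball_/= sub0r normrN (lt_le_trans xm)// ler_nat.
by rewrite (leq_trans mk).
Qed.

Definition truncate k f : E -> R[i] := fun x => (\1_(box k) x)%:C * f x.

Lemma Re_truncate k f x : Re (truncate k f x) = \1_(box k) x * Re (f x).
Proof. by rewrite cReM /= mul0r subr0. Qed.

Lemma Im_truncate k f x : Im (truncate k f x) = \1_(box k) x * Im (f x).
Proof. by rewrite cImM /= mul0r addr0. Qed.

Lemma truncate_L12 k f : L2 f -> L1 (truncate k f) /\ L2 (truncate k f).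
Proof.
move=> /L2P[[mr mi] r2 i2].
have m1 : measurable_fun setT (\1_(box k) : E -> R) by apply: measurable_indic; exact: measurable_box.
have i1 : Int (fun x => (\1_(box k) x) ^+ 2).
  have := Rint_indic (measurable_box k) (@lebesgue_rV_ball_fin R n k).
  apply: eq_integrable => // x _ /=; rewrite indicE.
  by case: (_ \in _); rewrite ?expr1n// expr0n.
have sq (y x : R) : 0 <= x <= 1 -> `|(x * y) ^+ 2| <= y ^+ 2.
  move=> /andP[x0 x1]; rewrite ger0_norm ?sqr_ge0// exprMn ler_piMl ?sqr_ge0//.
  by rewrite expr_le1.
split; split.
- by under eq_fun do rewrite Re_truncate; exact: Rint_mul.
- by under eq_fun do rewrite Im_truncate; exact: Rint_mul.
- by under eq_fun do rewrite Re_truncate; exact: measurable_funM.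
- by under eq_fun do rewrite Im_truncate; exact: measurable_funM.
- have h1 : Int (fun x => (\1_(box k) x * Re (f x)) ^+ 2).
    apply: (le_Rint _ _ r2); first by apply: measurable_sqr; exact: measurable_funM.
    by move=> x; apply: sq; exact: box01.
  have h2 : Int (fun x => (\1_(box k) x * Im (f x)) ^+ 2).
    apply: (le_Rint _ _ i2); first by apply: measurable_sqr; exact: measurable_funM.
    by move=> x; apply: sq; exact: box01.
  rewrite sqnorm2E; under eq_integral do rewrite Re_truncate Im_truncate.
  by rewrite -EFin_Rintegral ?ltry//; exact: RintD.
Qed.

Lemma cvg_truncate f : L2 f ->
  sqnorm2 (fun x => truncate k f x - f x) @[k --> \oo] --> 0%E.
Proof.
move=> Lf; have /L2P[mf r2 i2] := Lf.
pose h k x := Normc.normc (truncate k f x - f x) ^+ 2.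
have mk k : measurable_fun setT (h k).
  apply: cmeasurable_normc2; apply: cmeasurableB => //.
  by have [_ /L2_cmeasurable] := truncate_L12 k Lf.
have E1 k x : h k x = (1 - \1_(box k) x) ^+ 2 * Normc.normc (f x) ^+ 2.
  by rewrite /h !normc2 !(cReD, cImD, cReN, cImN) Re_truncate Im_truncate; ring.
have i0 : Int (fun x => Normc.normc (f x) ^+ 2).
  by under eq_fun do rewrite normc2; exact: RintD.
have hk k x : `|h k x| <= Normc.normc (f x) ^+ 2.
  have /andP[b0 b1] := box01 k x.
  rewrite ger0_norm ?sqr_ge0// E1 ler_piMl ?sqr_ge0// expr_le1//; lra.
have h0 x : h k x @[k --> \oo] --> (0 : R).
  rewrite (_ : h ^~ x = (fun k => (1 - \1_(box k) x) ^+ 2 * Normc.normc (f x) ^+ 2)); last first.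
    by apply/funext => k; exact: E1.
  rewrite -[X in _ --> X](mul0r (Normc.normc (f x) ^+ 2)).
  apply: cvgM; last exact: cvg_cst.
  rewrite -[X in _ --> X](_ : (1 - 1) ^+ 2 = 0); last by rewrite subrr expr0n.
  have hb : 1 - (\1_(box k) x : R) @[k --> \oo] --> (1 - 1 : R).
    by apply: cvgB; [exact: cvg_cst|exact: cvg_box].
  by rewrite expr2; under eq_fun do rewrite expr2; exact: cvgM.
have [_ cv] := Rdominated_convergence mk i0 hk h0.
rewrite (_ : (fun _ => _) = (fun k => (\int[mu]_x h k x)%:E)); last first.
  by apply/funext => k; rewrite EFin_Rintegral//; exact: le_Rint i0.
apply: cvg_EFin; first exact: nearW.
move: cv; rewrite [X in _ --> X -> _](_ : _ = 0)//.
by rewrite /Rintegral integral0.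
Qed.

(** The inverse transform of [g] need not be in L^1, so it is truncated to cubes. By
    [sqnorm2_fourier1_sub] the transforms of the truncations are exactly as far from [g] as the
    truncations are from the inverse transform. *)
Lemma is_fourier_inverse g : L1 g -> L2 g ->
  is_fourier (fun x => fourier1 g (- x)) g.
Proof.
move=> L1g L2g; have Lq := L2_opp (L2_fourier1 L1g L2g).
split => //; exists (fun k => truncate k (fun x => fourier1 g (- x))); split.
- by move=> k; exact: truncate_L12.
- exact: cvg_truncate.
- rewrite (_ : (fun _ => _) = (fun k => sqnorm2 (fun x =>
    truncate k (fun x => fourier1 g (- x)) x - fourier1 g (- x)))); first exact: cvg_truncate.
  apply/funext => k; have [? ?] := truncate_L12 k Lq.
  exact: sqnorm2_fourier1_sub.
Qed.

End inversion.

(** * Completeness of L^2 *)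

Section riesz_fischer.
Context d (T : measurableType d) (R : realType) (mu : {measure set T -> \bar R}).

Lemma sum_geometric_le2 (q : R) N : 0 <= q -> q <= 2^-1 ->
  \sum_(0 <= j < N) q ^+ j <= 2.
Proof.
move=> q0 q1; suff : \sum_(0 <= j < N) q ^+ j <= 2 - 2 * q ^+ N.
  by move/le_trans; apply; rewrite gerBl mulr_ge0// exprn_ge0.
elim: N => [|N IH]; first by rewrite big_nil expr0 mulr1 subrr.
rewrite big_nat_recr//= exprS.
have : q * q ^+ N <= 2^-1 * q ^+ N by rewrite ler_wpM2r// exprn_ge0.
by move: IH; move: (q * q ^+ N) (q ^+ N) (\sum_(_ <= _ < _) _) => a b c ? ?; lra.
Qed.

Lemma riesz_fischer (v : nat -> T -> R) : (forall j, measurable_fun setT (v j)) ->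
  (forall j l, (j <= l)%N -> (\int[mu]_x ((v l x - v j x) ^+ 2)%:E <= (8^-1 ^+ j)%:E)%E) ->
  exists2 w : T -> R, measurable_fun setT w &
    forall j, (\int[mu]_x ((w x - v j x) ^+ 2)%:E <= (8^-1 ^+ j)%:E)%E.
Proof.
move=> mv cauchy.
(* The weights 2^j keep [S] integrable, while by AM-GM
   |dv j| <= 2^-j / 2 + 2^j (dv j)^2 / 2, so [v] converges wherever S < oo. *)
pose dv j x := v j.+1 x - v j x.
pose e j x : \bar R := (2 ^+ j * dv j x ^+ 2)%:E.
pose S x := (\sum_(0 <= j <oo) e j x)%E.
have e0 j x : (0 <= e j x)%E by rewrite lee_fin mulr_ge0 ?sqr_ge0// exprn_ge0.
have me j : measurable_fun setT (e j).
  apply/measurable_EFinP; apply: measurable_funM => //; apply: measurable_funX.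
  exact: measurable_funB.
have mS : measurable_fun setT S by exact: ge0_emeasurable_sum.
have S0 x : (0 <= S x)%E by apply: nneseries_ge0.
have Soo : (\int[mu]_x S x < +oo)%E.
  apply: (@le_lt_trans _ _ 2%:E); last exact: ltry.
  rewrite integral_nneseries//; apply: lime_le.
    by apply: is_cvg_nneseries => j _ _; exact: integral_ge0.
  (* The weight 2^j against the rate 8^-j leaves a geometric series of ratio 1/4. *)
  apply: nearW => N; apply: (@le_trans _ _ (\sum_(0 <= j < N) 4^-1 ^+ j)%:E); last first.
    by rewrite lee_fin sum_geometric_le2 ?invr_ge0// lef_pV2 ?posrE// ler_nat.
  rewrite -sumEFin; apply: lee_sum => j _.
  rewrite /e; under eq_integral do rewrite EFinM.
  rewrite ge0_integralZl//.
  - apply: le_trans (lee_wpmul2l _ (cauchy j j.+1 (leqnSn j))) _; first by rewrite lee_fin exprn_ge0.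
    by rewrite -EFinM lee_fin -exprMn (_ : 2 * 8^-1 = 4^-1)//; field.
  - by apply/measurable_EFinP; apply: measurable_funX; exact: measurable_funB.
  - by move=> x _; rewrite lee_fin sqr_ge0.
pose A := [set x | (S x < +oo)%E].
have mA : measurable A.
  by rewrite -[A]setTI; exact: emeasurable_fun_infty_o.
have aeA : {ae mu, forall x, A x}.
  have iS : mu.-integrable setT S.
    apply/integrableP; split => //; rewrite [ltLHS](_ : _ = \int[mu]_x S x)%E//.
    by apply: eq_integral => x _; rewrite gee0_abs.
  have := integrable_ae measurableT iS; apply: filterS => x /(_ I).
  by rewrite ge0_fin_numE.
have cvA x : A x -> cvgn (v ^~ x : nat -> R).
  move=> Ax; have Sfin : S x \is a fin_num by rewrite ge0_fin_numE.
  have : cvgn (series (telescope (v ^~ x))).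
    apply: normed_cvg; apply: nondecreasing_is_cvgn.
      by apply: nondecreasing_series => k _ _; exact: normr_ge0.
    exists (1 + fine (S x) / 2) => _ [N _ <-]; rewrite /series/=.
    apply: (@le_trans _ _ (\sum_(0 <= j < N) (2^-1 ^+ j / 2 + 2 ^+ j * dv j x ^+ 2 / 2))).
      apply: ler_sum => j _; rewrite /telescope -/(dv j x).
      rewrite exprVn; have p0 : 0 < 2 ^+ j :> R by exact: exprn_gt0.
      rewrite -(real_normK (num_real (dv j x))); move: `|dv j x| => t.
      move: (2 ^+ j) p0 => p p0; have pV : p * p^-1 = 1 by rewrite divff// gt_eqF.
      rewrite -subr_ge0 (_ : _ - _ = p * (p^-1 - t) ^+ 2 / 2).
        by rewrite divr_ge0// mulr_ge0 ?sqr_ge0// ltW.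
      by field; rewrite gt_eqF.
    rewrite big_split/= -!mulr_suml; apply: lerD.
      by rewrite ler_pdivrMr// mul1r sum_geometric_le2// invr_ge0.
    rewrite ler_pM2r// -lee_fin fineK// -sumEFin.
    exact: (nneseries_lim_ge N (fun j _ _ => e0 j x)).
  move=> /cvg_ex[l cl]; apply/cvg_ex; exists (v 0%N x + l).
  rewrite (_ : v ^~ x = (fun k => v 0%N x + series (telescope (v ^~ x)) k)); last first.
    by apply/funext => k; exact: (eq_sum_telescope (v ^~ x) k).
  by apply: cvgD => //; exact: cvg_cst.
(* The indicator sets [w] to 0 where [S] is infinite, so the limit exists everywhere and is
   measurable. *)
pose w x := lim (\1_A x * v k x @[k --> \oo]).
have cw x : \1_A x * v k x @[k --> \oo] --> w x.
  have [Ax|Ax] := pselect (A x).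
    have /cvg_ex[l cl] := cvA x Ax.
    suff h : \1_A x * v k x @[k --> \oo] --> l by rewrite /w (cvg_lim _ h).
    by rewrite indicE mem_set//; under eq_fun do rewrite mul1r.
  suff h : \1_A x * v k x @[k --> \oo] --> (0 : R) by rewrite /w (cvg_lim _ h).
  rewrite indicE memNset//; under eq_fun do rewrite mul0r.
  exact: cvg_cst.
have m1 : measurable_fun setT (\1_A : T -> R) by exact: measurable_indic.
have mw : measurable_fun setT w.
  by apply: (measurable_fun_cvg (h := fun k x => \1_A x * v k x)) => // k; exact: measurable_funM.
exists w => // j.
(* The shift by [j] keeps every index within the reach of the Cauchy bound at [j], which Fatou's
   lemma carries over to the limit. *)
pose h k x := ((\1_A x * v (k + j)%N x - \1_A x * v j x) ^+ 2)%:E.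
have mh k : measurable_fun setT (h k).
  by apply/measurable_EFinP; apply: measurable_funX; apply: measurable_funB; exact: measurable_funM.
have limh x : h k x @[k --> \oo] --> ((w x - \1_A x * v j x) ^+ 2)%:E.
  apply: cvg_EFin; first exact: nearW.
  have hs : \1_A x * v (k + j)%N x - \1_A x * v j x @[k --> \oo] --> w x - \1_A x * v j x.
    apply: cvgB; last exact: cvg_cst.
    have := cw x; rewrite -(cvg_shiftn j); exact.
  by rewrite expr2; exact: cvgM.
have -> : (\int[mu]_x ((w x - v j x) ^+ 2)%:E = \int[mu]_x limn_einf (h ^~ x))%E.
  apply: ae_eq_integral => //.
  - by apply/measurable_EFinP; apply: measurable_funX; exact: measurable_funB.
  - apply: (eq_measurable_fun (fun x => ((w x - \1_A x * v j x) ^+ 2)%:E)).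
      by move=> x _; rewrite (cvg_limn_einf_sup (limh x)).
    apply/measurable_EFinP; apply: measurable_funX; apply: measurable_funB => //.
    exact: measurable_funM.
  - apply: filterS aeA => x Ax _; rewrite (cvg_limn_einf_sup (limh x)).
    by rewrite indicE mem_set// mul1r.
apply: le_trans (fatou mu measurableT mh _) _.
  by move=> k x _; rewrite lee_fin sqr_ge0.
rewrite limn_einf_lim; apply: lime_le; first exact: is_cvg_einfs.
apply: nearW => k; apply: (@le_trans _ _ (\int[mu]_x h k x)%E).
  by apply: ereal_inf_lbound; exists k => //=.
apply: le_trans (cauchy j (k + j)%N (leq_addl _ _)).
apply: ge0_le_integral => //.
- by move=> x _; rewrite lee_fin sqr_ge0.
- by apply/measurable_EFinP; apply: measurable_funX; exact: measurable_funB.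
- move=> x _; rewrite lee_fin -mulrBr exprMn ler_piMl ?sqr_ge0//.
Qed.

End riesz_fischer.

(** * Surjectivity of the L^2 transform *)

Section surjectivity.
Context {R : realType} {n : nat}.
Local Notation E := 'rV[R]_n.
Local Notation mu := (lebesgue_rV R n).
Implicit Types (f g u v : E -> R[i]).
Local Notation Re := complex.Re.
Local Notation Im := complex.Im.

Lemma cvg0_eventually (u_ : nat -> \bar R) (e : R) : 0 < e ->
  u_ k @[k --> \oo] --> 0%E -> \forall k \near \oo, (u_ k <= e%:E)%E.
Proof.
move=> e0 /fine_cvgP[fin cv].
have {}cv : fine (u_ k) @[k --> \oo] --> (0 : R) by exact: cv.
have /cvgrPdist_le /(_ _ e0) {}cv := cv.
apply: filterS2 fin cv => k fk; rewrite sub0r normrN => h.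
by rewrite -(fineK fk) lee_fin (le_trans (ler_norm _)).
Qed.

Lemma cvg_eighth (c : R) : ((c * 8^-1 ^+ j)%:E : \bar R) @[j --> \oo] --> 0%E.
Proof.
apply: cvg_EFin; first exact: nearW.
have h : (8^-1 : R) ^+ j @[j --> \oo] --> (0 : R).
  by apply: cvg_expr; rewrite ger0_norm ?invr_ge0// invf_lt1// ltr1n.
by rewrite -[X in _ --> X](mulr0 c); apply: cvgM => //; exact: cvg_cst.
Qed.

(* The inverse transforms of truncations of [g] are Cauchy in L^2. *)
Lemma is_fourier_surj g : L2 g -> exists u, is_fourier u g.
Proof.
move=> Lg.
have q0 j : 0 < 8^-1 ^+ j :> R by rewrite exprn_gt0// invr_gt0.
(* The factor 1/4 prepares [dU]: two such distances add up through [tri] to 2/4 + 2/4. *)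
have /choice[N HN] : forall j, exists k,
    (sqnorm2 (fun x => (truncate k g x - g x)%R) <= (4^-1 * 8^-1 ^+ j)%:E)%E.
  move=> j; have c0 : 0 < 4^-1 * 8^-1 ^+ j :> R by rewrite mulr_gt0// invr_gt0.
  have [k _ Hk] := cvg0_eventually c0 (cvg_truncate Lg).
  by exists k; apply: Hk => /=.
pose G j := truncate (N j) g.
have LG j : L1 (G j) /\ L2 (G j) by exact: truncate_L12.
have mg := L2_cmeasurable Lg.
have mG j : cmeasurable (G j) by have [_ /L2_cmeasurable] := LG j.
pose U j x := fourier1 (G j) (- x).
have HU j : is_fourier (U j) (G j) by have [? ?] := LG j; exact: is_fourier_inverse.
have LU j : L2 (U j) by have [] := HU j.
have mU j : cmeasurable (U j) := L2_cmeasurable (LU j).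
have tri u v w (a b : R) : cmeasurable u -> cmeasurable v -> cmeasurable w ->
    (sqnorm2 (fun x => (u x - v x)%R) <= a%:E)%E -> (sqnorm2 (fun x => (v x - w x)%R) <= b%:E)%E ->
    (sqnorm2 (fun x => (u x - w x)%R) <= (2 * a + 2 * b)%:E)%E.
  move=> mu' mv mw ha hb.
  have := sqnorm2_comb 1 (cmeasurableB mu' mv) (cmeasurableB mv mw).
  rewrite (_ : (fun x => _) = (fun x => u x - w x)); last by apply/funext => x; ring.
  move/le_trans; apply; rewrite (EFinD (2 * a)) (EFinM 2 a) (EFinM 2 b); apply: leeD; first exact: lee_wpmul2l.
  rewrite (_ : 2 * _ = 2); first exact: lee_wpmul2l.
  by rewrite /= expr0n addr0 expr1n sqrtr1 expr1n mulr1.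
have dU j l : (j <= l)%N -> (sqnorm2 (fun x => (U l x - U j x)%R) <= (8^-1 ^+ j)%:E)%E.
  move=> jl; rewrite (is_fourier_isometry (is_fourierB (HU l) (HU j))).
  have h1 := HN l; have h2 := HN j; rewrite sqnorm2_subC in h2.
  apply: le_trans (tri _ _ _ _ _ (mG l) mg (mG j) h1 h2) _; rewrite lee_fin.
  have : 8^-1 ^+ l <= 8^-1 ^+ j :> R.
    by rewrite ler_wiXn2l// ?invr_ge0// invf_le1// ler1n.
  by move: (8^-1 ^+ l) (8^-1 ^+ j) => a b; lra.
(* [riesz_fischer] is about real functions, so real and imaginary parts get separate limits; this
   doubles the bound in [Hu]. *)
have [wr mwr Hwr] : exists2 w : E -> R, measurable_fun setT w &
    forall j, (\int[mu]_x ((w x - Re (U j x)) ^+ 2)%:E <= (8^-1 ^+ j)%:E)%E.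
  apply: riesz_fischer; first by move=> j; have [] := mU j.
  move=> j l jl; apply: le_trans (dU j l jl); rewrite sqnorm2E.
  apply: ge0_le_integral => //.
  - by move=> x _; rewrite lee_fin sqr_ge0.
  - apply/measurable_EFinP; apply: measurable_sqr; apply: measurable_funB.
      by have [] := mU l.
    by have [] := mU j.
  - by have [? ?] := cmeasurableB (mU l) (mU j); apply/measurable_EFinP; apply: measurable_funD; exact: measurable_sqr.
  - by move=> x _; rewrite lee_fin cReD cReN lerDl sqr_ge0.
have [wi mwi Hwi] : exists2 w : E -> R, measurable_fun setT w &
    forall j, (\int[mu]_x ((w x - Im (U j x)) ^+ 2)%:E <= (8^-1 ^+ j)%:E)%E.
  apply: riesz_fischer; first by move=> j; have [] := mU j.
  move=> j l jl; apply: le_trans (dU j l jl); rewrite sqnorm2E.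
  apply: ge0_le_integral => //.
  - by move=> x _; rewrite lee_fin sqr_ge0.
  - apply/measurable_EFinP; apply: measurable_sqr; apply: measurable_funB.
      by have [] := mU l.
    by have [] := mU j.
  - by have [? ?] := cmeasurableB (mU l) (mU j); apply/measurable_EFinP; apply: measurable_funD; exact: measurable_sqr.
  - by move=> x _; rewrite lee_fin cImD cImN lerDr sqr_ge0.
pose u x := wr x +i* wi x.
have mu' : cmeasurable u by split.
have Hu j : (sqnorm2 (fun x => (u x - U j x)%R) <= (2 * 8^-1 ^+ j)%:E)%E.
  have [mUr mUi] := mU j.
  rewrite sqnorm2E; under eq_integral do rewrite EFinD.
  rewrite ge0_integralD//; first last.
  - by have [? ?] := cmeasurableB mu' (mU j); apply/measurable_EFinP; exact: measurable_sqr.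
  - by move=> x _; rewrite lee_fin sqr_ge0.
  - by have [? ?] := cmeasurableB mu' (mU j); apply/measurable_EFinP; exact: measurable_sqr.
  - by move=> x _; rewrite lee_fin sqr_ge0.
  rewrite mulr_natl mulr2n EFinD; apply: leeD.
    by under eq_integral do rewrite cReD cReN; exact: Hwr.
  by under eq_integral do rewrite cImD cImN; exact: Hwi.
have Lu : L2 u.
  have [m1 m2] := cmeasurableB mu' (mU 0%N).
  have L0 : L2 (fun x => u x - U 0%N x).
    by split => //; apply: le_lt_trans (Hu 0%N) _; rewrite ltry.
  have := L2D 1 L0 (LU 0%N).
  by rewrite (_ : (fun x => _) = u)//; apply/funext => x; ring.
exists u; split => //.
(* A diagonal choice: [U j] need not be in L^1 but has an approximating sequence, of which one
   member close enough on both sides is kept. *)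
have /choice[F HF] : forall j, exists F : E -> R[i], [/\ L1 F, L2 F,
    (sqnorm2 (fun x => (F x - U j x)%R) <= (8^-1 ^+ j)%:E)%E &
    (sqnorm2 (fun xi => (fourier1 F xi - G j xi)%R) <= (8^-1 ^+ j)%:E)%E].
  move=> j; have [_ _ [F [LF Fu Fg]]] := HU j.
  have [k _ Hk] := filterI (cvg0_eventually (q0 j) Fu) (cvg0_eventually (q0 j) Fg).
  by exists (F k); have [? ?] := LF k; have [? ?] := Hk k (leqnn k).
have mF j : cmeasurable (F j) by have [/L1_cmeasurable] := HF j.
exists F; split.
- by move=> k; have [] := HF k.
(* 6 = 2 * 1 + 2 * 2, from [HF] and [Hu]; the 3 below bounds 2 * 1 + 2 / 4, from [HF] and [HN]. *)
- apply: (squeeze_cvge _ (cvg_cst 0%E) (cvg_eighth 6)).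
  apply: nearW => k; rewrite sqnorm2_ge0/=; have [_ _ h1 _] := HF k.
  have h2 := Hu k; rewrite sqnorm2_subC in h2.
  apply: le_trans (tri _ _ _ _ _ (mF k) (mU k) mu' h1 h2) _.
  by rewrite lee_fin; move: (8^-1 ^+ k) => a; lra.
- apply: (squeeze_cvge _ (cvg_cst 0%E) (cvg_eighth 3)).
  apply: nearW => k; rewrite sqnorm2_ge0/=; have [L _ _ h1] := HF k.
  apply: le_trans (tri _ _ _ _ _ (cmeasurable_fourier1 L) (mG k) mg h1 (HN k)) _.
  by rewrite lee_fin; have := q0 k; move: (8^-1 ^+ k) => a; lra.
Qed.

End surjectivity.

(** * Test functions *)

Section test_functions.
Context {R : realType} {n : nat}.
Local Notation E := 'rV[R]_n.
Local Notation mu := (lebesgue_rV R n).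
Implicit Types (a psi : E -> R) (K : set E) (v x xi : E).
Local Notation Int f := (mu.-integrable setT (EFin \o f)).

Lemma smooth_derive a v : smooth a -> smooth ('D_v a).
Proof.
(* [iter_derive] applies the head of the list last, so the innermost derivative is the last
   entry. *)
move=> sa vs x; have := sa (rcons vs v) x.
suff -> : iter_derive (rcons vs v) a = iter_derive vs ('D_v a) by [].
by elim: vs => //= w vs ->.
Qed.

Lemma smooth_continuous a : smooth a -> continuous a.
Proof. by move=> sa x; apply: differentiable_continuous; exact: (sa [::] x). Qed.

Lemma smooth_derivable a x v : smooth a -> derivable a x v.
Proof. by move=> sa; apply: diff_derivable; exact: (sa [::] x). Qed.

Lemma smooth_is_derive_line a x v (t : R) : smooth a ->
  is_derive t 1 (fun t : R => a (t *: v + x)) ('D_v a (t *: v + x)).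
Proof.
move=> sa; have da := @smooth_derivable a (t *: v + x) v sa.
have E1 : (fun h : R => h^-1 *: (((fun t : R => a (t *: v + x)) \o shift t) (h *: 1) - a (t *: v + x))) =
   (fun h : R => h^-1 *: ((a \o shift (t *: v + x)) (h *: v) - a (t *: v + x))).
  by apply/funext => h /=; rewrite [h%:A]mulr1 scalerDl addrA.
by apply: DeriveDef; rewrite /derivable /derive E1.
Qed.

Lemma smooth_MVT a x v (h : R) : smooth a -> 0 < h ->
  exists c : R, a (h *: v + x) - a x = h * 'D_v a (c *: v + x).
Proof.
move=> sa h0.
have D (t : R) : is_derive t 1 (fun t : R => a (t *: v + x)) ('D_v a (t *: v + x)).
  exact: smooth_is_derive_line.
have [c _] := MVT h0 (fun t _ => D t) (derivable_within_continuous (fun t _ => @ex_derive _ _ _ _ _ _ _ (D t))).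
by rewrite scale0r add0r subr0 => ->; exists c; rewrite mulrC.
Qed.

Lemma zero_derive a v K : closed K -> (forall x, ~ K x -> a x = 0) ->
  forall x, ~ K x -> 'D_v a x = 0.
Proof.
move=> cK a0 x Kx; rewrite -(derive_cst 0 x v); apply: near_eq_derive.
have : nbhs x (~` K) by apply: open_nbhs_nbhs; split => //; exact: closed_openC.
by apply: filterS => y Ky; exact: a0.
Qed.

Lemma compact_support_bounded a K : continuous a -> compact K ->
  (forall x, ~ K x -> a x = 0) -> exists2 C, 0 <= C & forall x, `|a x| <= C.
Proof.
move=> ca cK a0.
have : compact (a @` K) by apply: continuous_compact => //; exact: continuous_subspaceT.
move=> /compact_bounded [M [_ HM]].
exists (`|M| + 1) => [|x]; first by rewrite addr_ge0.
have [Kx|Kx] := pselect (K x); last by rewrite a0// normr0 addr_ge0.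
apply: (HM (`|M| + 1)); last by exists x.
by rewrite (le_lt_trans (ler_norm _))// ltrDl.
Qed.

Lemma compact_box K : compact K -> exists N, K `<=` box N.
Proof.
move=> /compact_bounded [M [_ HM]].
have xm := archi_boundP (normr_ge0 M); exists (Num.bound `|M|).+1 => x Kx.
rewrite /box mx_norm_ball /ball_/= sub0r normrN.
apply: (@le_lt_trans _ _ (Num.bound `|M|).+1%:R); last by rewrite ltr_nat.
apply: HM => //; rewrite (le_lt_trans (ler_norm _))// (lt_trans xm)// ltr_nat//.
Qed.

Lemma compact_support_Int a K : continuous a -> compact K ->
  (forall x, ~ K x -> a x = 0) -> Int a /\ Int (fun x => a x ^+ 2).
Proof.
move=> ca cK a0; have ma := continuous_measurable_rV ca.
have [C C0 aC] := compact_support_bounded ca cK a0.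
have [N KN] := compact_box cK.
have ib := Rint_indic (@measurable_box R n N) (@lebesgue_rV_ball_fin R n N).
have out x : ~ box N x -> a x = 0 by move=> Nx; apply: a0 => /KN.
split.
  apply: (le_Rint ma _ (RintZl C ib)) => x; rewrite indicE.
  have [bx|bx] := pselect (box N x); first by rewrite mem_set// mulr1.
  by rewrite memNset// mulr0 out// normr0.
apply: (le_Rint (measurable_sqr ma) _ (RintZl (C ^+ 2) ib)) => x; rewrite indicE.
have [bx|bx] := pselect (box N x).
  by rewrite mem_set// mulr1 normrX ler_sqr ?nnegrE.
by rewrite memNset// mulr0 out// expr0n normr0.
Qed.

(** Translation by [v] rotates the pair of [fcos] and [fsin] by the angle [phase v xi].
    Differentiating this rotation yields the transform of a derivative without integration by
    parts. *)
Lemma fcos_shift a v xi : Int a ->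
  fcos (fun x => a (v + x)) xi = cos (phase v xi) * fcos a xi + sin (phase v xi) * fsin a xi.
Proof.
move=> ai.
have ic := Rint_cos xi ai; have jc := Rint_sin xi ai.
rewrite -(RintegralZl _ measurableT ic) -(RintegralZl _ measurableT jc).
rewrite -(RintegralD measurableT (RintZl _ ic) (RintZl _ jc)).
have i1 := RintD (RintZl (cos (phase v xi)) ic) (RintZl (sin (phase v xi)) jc).
rewrite -(Rintegral_shift v i1); apply: eq_Rintegral => x _.
rewrite (addrC x v) phaseD cosD sinD.
have := cos2Dsin2 (phase v xi).
move: (cos (phase v xi)) (sin (phase v xi)) (cos (phase x xi)) (sin (phase x xi)) (a (v + x)) => c s p q z cs.
transitivity (z * p * (c ^+ 2 + s ^+ 2)); first by rewrite cs mulr1.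
by ring.
Qed.

Lemma fsin_shift a v xi : Int a ->
  fsin (fun x => a (v + x)) xi = cos (phase v xi) * fsin a xi - sin (phase v xi) * fcos a xi.
Proof.
move=> ai.
have ic := Rint_cos xi ai; have jc := Rint_sin xi ai.
rewrite -(RintegralZl _ measurableT ic) -(RintegralZl _ measurableT jc).
rewrite -(RintegralB measurableT (RintZl _ jc) (RintZl _ ic)).
have i1 := RintB (RintZl (cos (phase v xi)) jc) (RintZl (sin (phase v xi)) ic).
rewrite -(Rintegral_shift v i1); apply: eq_Rintegral => x _.
rewrite (addrC x v) phaseD cosD sinD.
have := cos2Dsin2 (phase v xi).
move: (cos (phase v xi)) (sin (phase v xi)) (cos (phase x xi)) (sin (phase x xi)) (a (v + x)) => c s p q z cs.
transitivity (z * q * (c ^+ 2 + s ^+ 2)); first by rewrite cs mulr1.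
by ring.
Qed.

Lemma cvg_quotient (f : R -> R) (d : R) : is_derive (0 : R) 1 f d ->
  k.+1%:R * (f k.+1%:R^-1 - f 0) @[k --> \oo] --> d.
Proof.
move=> H; have df : derivable f 0 1 by exact: (@ex_derive _ _ _ _ _ _ _ H).
have ed : 'D_1 f 0 = d by exact: (@derive_val _ _ _ _ _ _ _ H).
have c0 : (k.+1%:R^-1 : R) @[k --> \oo] --> 0^'.
  move=> A /= [e /= e0 He]; have /cvgrPdist_lt /(_ _ e0) := @cvg_harmonic R.
  by apply: filterS => k /= ke; apply: He => //=.
have := @cvg_comp _ _ _ (fun k : nat => (k.+1%:R^-1 : R)) _ _ _ _ c0 df.
rewrite -[lim _]/('D_1 f 0) ed.
rewrite (_ : _ \o _ = (fun k : nat => k.+1%:R * (f k.+1%:R^-1 - f 0)))//.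
by apply/funext => k /=; rewrite invrK addr0 [_%:A]mulr1.
Qed.

Lemma phaseZ (t : R) v xi : phase (t *: v) xi = phase v xi * t.
Proof.
rewrite /phase (_ : dotv (t *: v) xi = dotv v xi * t) ?mulrA//; rewrite /dotv mulr_suml.
by apply: eq_bigr => i _; rewrite mxE -mulrA mulrC.
Qed.

(** * The transform of a directional derivative *)

Section fourier_derivative.
Variables (a : E -> R) (K : set E) (v : E).
Hypotheses (sa : smooth a) (cK : compact K) (a0 : forall x, ~ K x -> a x = 0).

Let ca : continuous a. Proof. exact: smooth_continuous. Qed.
Let ma : measurable_fun setT a. Proof. exact: continuous_measurable_rV. Qed.
Let ai : Int a. Proof. by have [] := compact_support_Int ca cK a0. Qed.
Let q k x := k.+1%:R * (a (k.+1%:R^-1 *: v + x) - a x).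

Let cvg_q x : q k x @[k --> \oo] --> 'D_v a x.
Proof.
have := smooth_is_derive_line x v 0 sa; rewrite scale0r add0r => /cvg_quotient.
by rewrite /= scale0r add0r.
Qed.

Let mq k : measurable_fun setT (q k).
Proof.
apply: measurable_funM => //; apply: measurable_funB => //.
have := measurable_shift (- (k.+1%:R^-1 *: v)) ma.
by apply: eq_measurable_fun => x _; rewrite opprK addrC.
Qed.

(** By the mean value theorem a bound of the derivative also bounds the difference quotients. Their
    shifts are no longer than [v], so enlarging the cube around the support from [N] to [M] contains
    them all. *)
Let q_dom : exists2 g : E -> R, Int g & forall k x, `|q k x| <= g x.
Proof.
have cD := smooth_continuous (smooth_derive v sa).
have D0 := zero_derive v (compact_closed (@norm_hausdorff _ _) cK) a0.
have [C C0 aC] := compact_support_bounded cD cK D0.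
have [N KN] := compact_box cK.
pose M := (N + Num.bound `|v|)%N.
have ib := Rint_indic (@measurable_box R n M) (@lebesgue_rV_ball_fin R n M).
exists (fun x => C * \1_(box M) x) => [|k x]; first exact: RintZl.
rewrite indicE; have [bx|bx] := pselect (box M x).
  rewrite mem_set// mulr1 /q.
  have [c ->] := @smooth_MVT a x v k.+1%:R^-1 sa (k1_gt0 k).
  by rewrite mulrA divff// mul1r.
have out y : ~ box N y -> a y = 0 by move=> Ny; apply: a0 => /KN.
rewrite memNset// mulr0 /q !out ?subrr ?mulr0 ?normr0//.
  apply: contra_not bx; rewrite /box mx_norm_ball /ball_/= !sub0r !normrN => bx.
  by apply: lt_le_trans bx _; rewrite ler_nat ltnS leq_addr.
apply: contra_not bx; rewrite /box mx_norm_ball /ball_/= !sub0r !normrN => bx.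
have -> : x = (k.+1%:R^-1 *: v + x) - k.+1%:R^-1 *: v by rewrite addrAC subrr add0r.
apply: le_lt_trans (ler_normB _ _) _.
rewrite /M -addSn natrD; apply: ltr_leD => //.
apply: le_trans (ltW (archi_boundP (normr_ge0 v))).
by rewrite normrZ ler_piMl// ger0_norm// invf_le1// ler1n.
Qed.

(** The derivative at 0 of the rotation in [fcos_shift]; [t] is [fsin a xi] for the cosine transform
    and [- fcos a xi] for the sine transform. *)
Let cvg_trig (f t : R) xi : let p := phase v xi in
  k.+1%:R * (cos (phase (k.+1%:R^-1 *: v) xi) * f + sin (phase (k.+1%:R^-1 *: v) xi) * t - f)
  @[k --> \oo] --> p * t.
Proof.
move=> p.
have D : is_derive (0 : R) 1 (fun u : R => cos (p * u) * f + sin (p * u) * t) (p * t).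
  have Dm : is_derive (0 : R) 1 (fun u : R => p * u) p.
    by apply: is_derive_eq; rewrite [LHS]mulr1.
  have Dc := is_derive1_comp (is_derive_cos (p * 0)) Dm.
  have Ds := is_derive1_comp (is_derive_sin (p * 0)) Dm.
  have := is_deriveD (is_deriveM Dc (is_derive_cst f (0 : R) 1)) (is_deriveM Ds (is_derive_cst t (0 : R) 1)).
  by move/(is_derive_eq); apply; rewrite /= mulr0 sin0 cos0 !scaler0 !add0r oppr0 mul0r scaler0 add0r mul1r; exact: mulrC.
have := cvg_quotient D; rewrite mulr0 cos0 sin0 mul1r mul0r addr0.
rewrite (_ : (fun k => _) = (fun k => k.+1%:R * (cos (phase (k.+1%:R^-1 *: v) xi) * f +
  sin (phase (k.+1%:R^-1 *: v) xi) * t - f)))//.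
by apply/funext => k; rewrite phaseZ.
Qed.

Lemma fcos_derive xi : fcos ('D_v a) xi = phase v xi * fsin a xi.
Proof.
have [g gi qg] := q_dom.
have [||||_ cv] := @Rdominated_convergence _ _ _ mu (fun k x => q k x * cos (phase x xi))
    (fun x => 'D_v a x * cos (phase x xi)) g.
- by move=> k; apply: measurable_funM => //; exact: measurable_cosl.
- exact: gi.
- move=> k x; rewrite normrM; apply: le_trans (qg k x).
  by rewrite ler_piMr// cos_max.
- by move=> x; apply: cvgM; [exact: cvg_q|exact: cvg_cst].
have lim2 := @cvg_trig (fcos a xi) (fsin a xi) xi.
apply: (cvg_unique _ cv); first exact: norm_hausdorff.
rewrite (_ : (fun k => _) = (fun k : nat => k.+1%:R * (cos (phase (k.+1%:R^-1 *: v) xi) * fcos a xi +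
   sin (phase (k.+1%:R^-1 *: v) xi) * fsin a xi - fcos a xi))) //.
apply/funext => k.
have as' : Int (fun x => a (k.+1%:R^-1 *: v + x)).
  have := Rint_shift (- (k.+1%:R^-1 *: v)) ai.
  by apply: eq_integrable => // x _ /=; rewrite opprK addrC.
have i1 := Rint_cos xi as'; have i2 := Rint_cos xi ai.
rewrite -fcos_shift// /fcos -(RintegralB measurableT i1 i2).
rewrite -(RintegralZl _ measurableT (RintB i1 i2)).
by apply: eq_Rintegral => x _; rewrite /q -mulrBl mulrA.
Qed.

Lemma fsin_derive xi : fsin ('D_v a) xi = - (phase v xi * fcos a xi).
Proof.
have [g gi qg] := q_dom.
have [||||_ cv] := @Rdominated_convergence _ _ _ mu (fun k x => q k x * sin (phase x xi))
    (fun x => 'D_v a x * sin (phase x xi)) g.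
- by move=> k; apply: measurable_funM => //; exact: measurable_sinl.
- exact: gi.
- move=> k x; rewrite normrM; apply: le_trans (qg k x).
  by rewrite ler_piMr// sin_max.
- by move=> x; apply: cvgM; [exact: cvg_q|exact: cvg_cst].
have lim2 := @cvg_trig (fsin a xi) (- fcos a xi) xi.
rewrite -mulrN.
apply: (cvg_unique _ cv); first exact: norm_hausdorff.
rewrite (_ : (fun k => _) = (fun k : nat => k.+1%:R * (cos (phase (k.+1%:R^-1 *: v) xi) * fsin a xi +
   sin (phase (k.+1%:R^-1 *: v) xi) * (- fcos a xi) - fsin a xi))) //.
apply/funext => k.
have as' : Int (fun x => a (k.+1%:R^-1 *: v + x)).
  have := Rint_shift (- (k.+1%:R^-1 *: v)) ai.
  by apply: eq_integrable => // x _ /=; rewrite opprK addrC.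
have i1 := Rint_sin xi as'; have i2 := Rint_sin xi ai.
rewrite mulrN -fsin_shift// /fsin -(RintegralB measurableT i1 i2).
rewrite -(RintegralZl _ measurableT (RintB i1 i2)).
by apply: eq_Rintegral => x _; rewrite /q -mulrBl mulrA.
Qed.

End fourier_derivative.

Definition power_spectrum a xi := fcos a xi ^+ 2 + fsin a xi ^+ 2.

Lemma power_spectrum_ge0 a xi : 0 <= power_spectrum a xi.
Proof. by rewrite addr_ge0 ?sqr_ge0. Qed.

Lemma measurable_power_spectrum a : Int a -> measurable_fun setT (power_spectrum a).
Proof.
move=> ai; apply: measurable_funD; apply: measurable_sqr.
  exact: measurable_fcos.
exact: measurable_fsin.
Qed.

Lemma Rint_power_spectrum a : Int a -> Int (fun x => a x ^+ 2) -> Int (power_spectrum a).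
Proof.
move=> ai a2; apply/ge0_RintP.
- exact: measurable_power_spectrum.
- exact: power_spectrum_ge0.
- by rewrite plancherel_real// -EFin_Rintegral// ltry.
Qed.

(** Deriving along [v] exchanges [fcos] and [fsin] up to sign and multiplies both by the phase,
    hence the power spectrum by its square; Plancherel is then applied to the derivative of order
    [m]. *)
Lemma Rint_phase_power a K v m : smooth a -> compact K ->
  (forall x, ~ K x -> a x = 0) ->
  Int (fun xi => phase v xi ^+ (2 * m) * power_spectrum a xi).
Proof.
move=> + cK; elim: m a => [|m IH] a sa a0.
  have [ai a2] := compact_support_Int (smooth_continuous sa) cK a0.
  have := Rint_power_spectrum ai a2.
  by apply: eq_integrable => // xi _ /=; rewrite expr0 mul1r.
have D0 := zero_derive v (compact_closed (@norm_hausdorff _ _) cK) a0.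
have := IH _ (smooth_derive v sa) D0; apply: eq_integrable => // xi _ /=.
congr EFin; rewrite /power_spectrum (fcos_derive v sa cK a0) (fsin_derive v sa cK a0).
by rewrite mulnS exprD; ring.
Qed.

(** The sum is at most [n] times its largest term, and the power of this bound is one of the
    summands on the right. *)
Lemma sum_exp_le (t : 'I_n -> R) m : (0 < n)%N -> (forall i, 0 <= t i) ->
  (\sum_i t i) ^+ m <= \sum_i n%:R ^+ m * t i ^+ m.
Proof.
move=> n0 t0; pose i0 := Ordinal n0.
have [i _ Hi] := @Order.TotalTheory.arg_maxP _ _ _ i0 xpredT t isT.
have h : \sum_j t j <= n%:R * t i.
  rewrite mulr_natl -[X in _ *+ X]card_ord -sumr_const; apply: ler_sum => j _.
  exact: Hi.
apply: (@le_trans _ _ ((n%:R * t i) ^+ m)).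
  by rewrite lerXn2r ?nnegrE ?mulr_ge0// sumr_ge0.
rewrite exprMn (bigD1 i)//= lerDl sumr_ge0// => j _.
by rewrite mulr_ge0// exprn_ge0.
Qed.

Lemma dotv_delta i xi : dotv (delta_mx ord0 i) xi = xi ord0 i.
Proof.
rewrite /dotv (bigD1 i)//= big1 ?addr0 => [|j ji].
  by rewrite mxE !eqxx mul1r.
by rewrite mxE (negbTE ji) andbF mul0r.
Qed.

Lemma dotv_ge0 x : 0 <= dotv x x.
Proof. by apply: sumr_ge0 => i _; rewrite -expr2 sqr_ge0. Qed.

Lemma enorm_ge0 x : 0 <= enorm x. Proof. exact: sqrtr_ge0. Qed.

Definition freq xi : R := 2 * pi * enorm xi.

Lemma freq_ge0 xi : 0 <= freq xi.
Proof. by rewrite mulr_ge0 ?enorm_ge0// mulr_ge0// pi_ge0. Qed.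

Lemma freq2 xi : freq xi ^+ 2 = \sum_i phase (delta_mx ord0 i) xi ^+ 2.
Proof.
rewrite /freq exprMn sqr_sqrtr ?dotv_ge0// /dotv mulr_sumr.
by apply: eq_bigr => i _; rewrite /phase dotv_delta -expr2 -exprMn.
Qed.

Lemma measurable_freq : measurable_fun setT freq.
Proof.
apply: measurable_funM => //.
apply: (@measurableT_comp _ _ _ _ _ _ (@Num.sqrt R)).
  by apply: continuous_measurable_fun; exact: sqrt_continuous.
apply: measurable_sum => i; apply: measurable_funM; exact: measurable_coord.
Qed.

Lemma powR_le_exp (t s : R) m : 0 <= t -> s <= m%:R -> 0 <= s -> t `^ (2 * s) <= 1 + t ^+ (2 * m).
Proof.
move=> t0 sm s0; have [t1|t1] := leP t 1.
  apply: (@le_trans _ _ 1); last by rewrite lerDl exprn_ge0.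
  by have := ge0_ler_powR (mulr_ge0 (ler0n R 2) s0) t0 (@ler01 R) t1; rewrite powR1.
apply: (@le_trans _ _ (t ^+ (2 * m))); last by rewrite lerDr.
rewrite -powR_mulrn//; apply: ler_powR; first exact: ltW.
by rewrite natrM ler_pM2l.
Qed.

(** An even integer exponent dominates the real one, and [freq2] with [sum_exp_le] splits it into
    moments along the coordinate directions, each a case of [Rint_phase_power]. *)
Lemma Rint_freq_power a K (s : R) : (0 < n)%N -> 0 <= s -> smooth a -> compact K ->
  (forall x, ~ K x -> a x = 0) ->
  Int (fun xi => freq xi `^ (2 * s) * power_spectrum a xi).
Proof.
move=> n0 s0 sa cK a0.
have [ai a2] := compact_support_Int (smooth_continuous sa) cK a0.
pose m := Num.bound s; have sm : s <= m%:R by exact/ltW/archi_boundP.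
have iS : Int (fun xi => \sum_i n%:R ^+ m * (phase (delta_mx ord0 i) xi ^+ (2 * m) * power_spectrum a xi)).
  have H i := Rint_phase_power (delta_mx ord0 i) m sa cK a0.
  have : mu.-integrable setT (fun xi => (\sum_i (n%:R ^+ m * (phase (delta_mx ord0 i) xi ^+ (2 * m) * power_spectrum a xi))%:E)%E).
    by apply: integrable_sum => // i _; exact: (RintZl (n%:R ^+ m) (H i)).
  by apply: eq_integrable => // xi _ /=; rewrite sumEFin.
apply: (le_Rint _ _ (RintD (Rint_power_spectrum ai a2) iS)) => [|xi].
  apply: measurable_funM; last exact: measurable_power_spectrum.
  exact: (measurableT_comp (@measurable_powR R (2 * s)) measurable_freq).
have Q0 := power_spectrum_ge0 a xi.
rewrite ger0_norm ?mulr_ge0 ?powR_ge0//.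
have -> : \sum_i n%:R ^+ m * (phase (delta_mx ord0 i) xi ^+ (2 * m) * power_spectrum a xi) =
    (\sum_i n%:R ^+ m * (phase (delta_mx ord0 i) xi ^+ 2) ^+ m) * power_spectrum a xi.
  by rewrite mulr_suml; apply: eq_bigr => i _; rewrite mulrA exprM.
rewrite -[X in X + _]mul1r -mulrDl; apply: ler_wpM2r => //.
apply: le_trans (powR_le_exp (freq_ge0 xi) sm s0) _.
rewrite lerD2l exprM freq2; apply: sum_exp_le => // i; exact: sqr_ge0.
Qed.

(** The limit of [poisson_average] at [x = 0]: on one side the weights [ehat] tend to 1 under
    domination by [fcos a], on the other the averages of the bounded continuous [a] concentrate at
    0. *)
Lemma fourier_inversion0 a K : continuous a -> compact K ->
  (forall x, ~ K x -> a x = 0) -> Int (fcos a) -> \int[mu]_xi fcos a xi = a 0.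
Proof.
move=> ca cK a0 fi.
have [ai a2] := compact_support_Int ca cK a0.
have [C C0 aC] := compact_support_bounded ca cK a0.
have ma := Rint_measurable ai.
have id_ k : \int[mu]_xi (ehat k xi * fcos a xi) =
    \int[mu]_w (a (0 - k.+1%:R^-1 *: w) * poisson w).
  rewrite -[RHS](@poisson_average _ _ a 0 k ai).
  have := kernel_fubini ai (Rint_ehat k) (@measurable_cos2 R n) (fun=> cos_max _) => /= E1.
  rewrite -[LHS]E1; apply: eq_Rintegral => y _; congr (_ * _).
  by apply: eq_Rintegral => xi _; rewrite sub0r [in RHS]phaseC phaseNr cosN phaseC.
have [||||_ cv1] := @Rdominated_convergence _ _ _ mu (fun k xi => ehat k xi * fcos a xi)
    (fcos a) (fun xi => `|fcos a xi|).
- by move=> k; apply: measurable_funM; [exact: Rint_measurable (Rint_ehat k)|exact: measurable_fcos].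
- exact: Rint_norm.
- by move=> k xi; rewrite normrM ler_piMl// ger0_norm ?ehat_ge0// ehat_le1.
- move=> xi; rewrite -[X in _ --> X]mul1r; apply: cvgM; last exact: cvg_cst.
  exact: cvg_ehat.
have [||||_ cv2] := @Rdominated_convergence _ _ _ mu
    (fun k w => a (0 - k.+1%:R^-1 *: w) * poisson w)
    (fun w => a 0 * poisson w) (fun w => C * poisson w).
- move=> k; apply: measurable_funM; last exact: measurable_poisson.
  apply: (measurableT_comp ma).
  apply: (eq_measurable_fun (fun w : E => (- k.+1%:R^-1) *: w + 0)).
    by move=> w _; rewrite addr0 sub0r scaleNr.
  exact: measurable_affine_rV.
- apply: RintZl; exact: integrable_poisson.
- by move=> k w; rewrite normrM (ger0_norm (poisson_ge0 w)) ler_wpM2r// poisson_ge0.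
- move=> w; apply: cvgM; last exact: cvg_cst.
  have h : 0 - k.+1%:R^-1 *: w @[k --> \oo] --> (0 : E).
    rewrite -[X in _ --> X](subrr 0) -[X in _ - X](scale0r w).
    apply: cvgB; first exact: cvg_cst.
    by apply: cvgZr_tmp; exact: cvg_k1.
  exact: (@cvg_comp _ _ _ (fun k : nat => 0 - k.+1%:R^-1 *: w) a _ _ _ h (ca 0)).
have e2 : \int[mu]_w (a 0 * poisson w) = a 0.
  rewrite (RintegralZl _ measurableT (integrable_poisson n)).
  by rewrite /Rintegral integral_poisson mulr1.
rewrite e2 in cv2.
have E2 : (fun k => \int[mu]_xi (ehat k xi * fcos a xi)) =
    (fun k : nat => \int[mu]_w (a (0 - k.+1%:R^-1 *: w) * poisson w)) by exact/funext.
by rewrite -E2 in cv2; apply: (cvg_unique _ cv1 cv2); exact: norm_hausdorff.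
Qed.

End test_functions.

(** * The profile equation *)

Section real_transforms.
Context {R : realType} {n : nat}.
Local Notation E := 'rV[R]_n.
Local Notation mu := (lebesgue_rV R n).
Implicit Types (a psi phi h : E -> R) (f g u : E -> R[i]).
Local Notation Int f := (mu.-integrable setT (EFin \o f)).
Local Notation Re := complex.Re.
Local Notation Im := complex.Im.

Lemma Rint0 : Int (fun=> 0).
Proof. have := RintZl 0 (integrable_poisson (R := R) n); by apply: eq_integrable => // x _ /=; rewrite mul0r. Qed.

Lemma fcos0 (xi : E) : fcos (fun=> 0) xi = 0.
Proof. by rewrite /fcos; under eq_Rintegral do rewrite mul0r; rewrite /Rintegral integral0. Qed.

Lemma fsin0 (xi : E) : fsin (fun=> 0) xi = 0.
Proof. by rewrite /fsin; under eq_Rintegral do rewrite mul0r; rewrite /Rintegral integral0. Qed.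

Lemma L1_Cfun a : Int a -> L1 (Cfun a).
Proof. by move=> ai; split => //; exact: Rint0. Qed.

Lemma L2_Cfun a : measurable_fun setT a -> Int (fun x => a x ^+ 2) -> L2 (Cfun a).
Proof.
move=> ma a2; apply/L2P; split => //.
by have := Rint0; apply: eq_integrable => // x _ /=; rewrite expr0n.
Qed.

Lemma fourier1_Cfun a xi : Int a -> fourier1 (Cfun a) xi = fcos a xi +i* - fsin a xi.
Proof.
move=> ai; have La := L1_Cfun ai; apply/eqP; rewrite eq_complex.
rewrite Re_fourier1// Im_fourier1//= fcos0 fsin0 addr0 sub0r.
by rewrite !eqxx.
Qed.

Lemma odd_Rintegral a : Int a -> (forall x, a (- x) = - a x) -> \int[mu]_x a x = 0.
Proof.
move=> ai oa; have := Rintegral_opp ai.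
under eq_Rintegral do rewrite oa -mulN1r.
rewrite (RintegralZl _ measurableT ai) mulN1r => /esym/eqP.
by rewrite -addr_eq0 -mulr2n mulrn_eq0 => /eqP.
Qed.

Lemma fsin_even a xi : Int a -> (forall x, a (- x) = a x) -> fsin a xi = 0.
Proof.
move=> ai ea; apply: odd_Rintegral; first exact: Rint_sin.
by move=> x; rewrite ea phaseC phaseNr sinN mulrN phaseC.
Qed.

(** For even [a] the sine part vanishes and the direct and inverse transforms coincide, so
    [is_fourier_inverse] applies to [fcos a]. *)
Lemma has_transform_fcos a : Int a -> Int (fun x => a x ^+ 2) ->
  (forall x, a (- x) = a x) -> has_transform (fcos a) a.
Proof.
move=> ai a2 ea; split; first exact: continuous_fcos.
rewrite (_ : Cfun (fcos a) = fun x => fourier1 (Cfun a) (- x)).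
  by apply: is_fourier_inverse; [exact: L1_Cfun|exact: (L2_Cfun (Rint_measurable ai) a2)].
by apply/funext => x; rewrite fourier1_Cfun// fcosN fsin_even// oppr0.
Qed.

Lemma has_transform_uniq phi phi' h : has_transform phi h -> has_transform phi' h ->
  phi = phi'.
Proof.
move=> [c H] [c' H']; apply: ae_eq_continuous => //.
have := is_fourier_uniq_l H H'; apply: filterS => x.
by move=> /(congr1 (fun z => Re z)).
Qed.

Lemma has_transformZ phi h c : has_transform phi h ->
  has_transform (fun x => c * phi x) (fun x => c * h x).
Proof.
move=> [ch H]; split.
  move=> x; have FF := nbhs_filter x; apply: cvgM; [exact: cvg_cst|exact: ch].
have := is_fourierZ (c%:C) H.
rewrite (_ : (fun x => _) = Cfun (fun x => c * phi x)).
  by rewrite (_ : (fun x => _) = Cfun (fun x => c * h x))//; apply/funext => x; rewrite /Cfun rmorphM.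
by apply/funext => x; rewrite /Cfun rmorphM.
Qed.

(** [fraclap] refers to the representative [fourier f], equal to [g] only almost everywhere, and its
    choice succeeds because the transform is onto L^2. From here on the explicit [g] replaces the
    chosen representative. *)
Lemma fraclap_is_fourier (s : R) f g : is_fourier f g ->
  L2 (fun xi => (freq xi `^ (2 * s))%:C * g xi) ->
  is_fourier (fraclap s f) (fun xi => (freq xi `^ (2 * s))%:C * g xi).
Proof.
move=> H LW; have H' := is_fourierP H.
have ae := is_fourier_uniq_r H H'; have ae' := is_fourier_uniq_r H' H.
have mp : measurable_fun setT (fun xi : E => freq xi `^ (2 * s)).
  exact: (measurableT_comp (@measurable_powR R (2 * s)) (@measurable_freq R n)).
have [_ /L2_cmeasurable[mr mi] _] := H'.
have mW : cmeasurable (fun xi => (freq xi `^ (2 * s))%:C * fourier f xi).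
  split.
    apply: (eq_measurable_fun (fun xi => freq xi `^ (2 * s) * Re (fourier f xi))).
      by move=> xi _; rewrite cReM /= mul0r subr0.
    exact: measurable_funM.
  apply: (eq_measurable_fun (fun xi => freq xi `^ (2 * s) * Im (fourier f xi))).
    by move=> xi _; rewrite cImM /= mul0r addr0.
  exact: measurable_funM.
have [u Hu] := is_fourier_surj LW.
have Hfr : is_fourier (fraclap s f) (fun xi => (freq xi `^ (2 * s))%:C * fourier f xi).
  apply: (@xgetPex _ (fun=> 0) [set u | is_fourier u (fun xi => (freq xi `^ (2 * s))%:C * fourier f xi)]).
  by exists u => /=; apply: (ae_is_fourier Hu mW); apply: filterS ae => xi ->.
apply: (ae_is_fourier Hfr (L2_cmeasurable LW)).
by apply: filterS ae' => xi ->.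
Qed.

End real_transforms.

(** A weighted arithmetic-geometric mean inequality, read off from the square of [y - q]. It takes
    the place of Cauchy-Schwarz: with [q] the resolvent symbol and [D] its inverse, integrability of
    [q] and [D * Q] gives that of [y]. *)
Lemma le_weighted_sqr (R : realFieldType) (D q y Q : R) : 0 < D -> D * q = 1 ->
  y ^+ 2 <= Q -> y <= q + D * Q.
Proof.
move=> D0 Dq yQ.
have q0 : 0 < q by rewrite -(pmulr_rgt0 _ D0) Dq.
have h1 : D * y ^+ 2 <= D * Q by rewrite ler_pM2l.
have h2 : 0 <= D * (y - q) ^+ 2 by rewrite mulr_ge0 ?sqr_ge0// ltW.
have h3 : D * (y - q) ^+ 2 = D * y ^+ 2 - 2 * (D * q) * y + (D * q) * q by ring.
have h4 : 0 <= D * y ^+ 2 by rewrite mulr_ge0 ?sqr_ge0// ltW.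
by move: h2; rewrite h3 Dq; lra.
Qed.

(** * The resolvent symbol and the Green function *)

Section resolvent.
Context {R : realType} {n : nat} (omega s : R).
Hypotheses (n_gt0 : (0 < n)%N) (omega_gt0 : 0 < omega) (s_gt : n%:R / 2 < s).
Local Notation E := 'rV[R]_n.
Local Notation mu := (lebesgue_rV R n).
Local Notation Int f := (mu.-integrable setT (EFin \o f)).
Local Notation Re := complex.Re.
Local Notation Im := complex.Im.
Local Notation r := (@resolvent_symbol R n s omega).

Let s_gt0 : 0 < s. Proof. by apply: le_lt_trans s_gt; rewrite divr_ge0. Qed.
Let den_gt0 (xi : E) : 0 < freq xi `^ (2 * s) + omega.
Proof. by rewrite ltr_wpDl ?powR_ge0. Qed.

Lemma resolvent_gt0 xi : 0 < r xi.
Proof. by rewrite invr_gt0; exact: den_gt0. Qed.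

Lemma resolventK xi : (freq xi `^ (2 * s) + omega) * r xi = 1.
Proof. by rewrite divff// gt_eqF//; exact: den_gt0. Qed.

Lemma resolvent_le xi : r xi <= omega^-1.
Proof. by rewrite lef_pV2 ?posrE//; [rewrite lerDr powR_ge0|exact: den_gt0]. Qed.

Lemma freqN (xi : E) : freq (- xi) = freq xi.
Proof.
rewrite /freq /enorm; congr (_ * Num.sqrt _); apply: eq_bigr => i _.
by rewrite !mxE mulrNN.
Qed.

Lemma resolventN xi : r (- xi) = r xi.
Proof. by have := freqN xi; rewrite /resolvent_symbol /freq => ->. Qed.

Lemma measurable_freq_power (p : R) : measurable_fun setT (fun xi : E => freq xi `^ p).
Proof. exact: (measurableT_comp (@measurable_powR R p) (@measurable_freq R n)). Qed.

Lemma measurable_resolvent : measurable_fun setT r.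
Proof.
apply: (eq_measurable_fun (fun xi : E => (freq xi `^ (2 * s) + omega) `^ (-1))).
  by move=> xi _; rewrite powR_inv1// ltW.
apply: (measurableT_comp (@measurable_powR R (-1))).
by apply: measurable_funD => //; exact: measurable_freq_power.
Qed.

Lemma powR_add1_le (t p : R) : 0 <= t -> 0 <= p -> (1 + t) `^ p <= 2 `^ p * (1 + t `^ p).
Proof.
move=> t0 p0; have t1 : 0 <= 1 + t by rewrite addr_ge0.
have [tle|tgt] := leP t 1.
  apply: (@le_trans _ _ (2 `^ p)); last by rewrite ler_peMr ?powR_ge0// lerDl powR_ge0.
  by apply: (ge0_ler_powR p0 t1 (ler0n R 2)); lra.
apply: (@le_trans _ _ ((2 * t) `^ p)).
  by apply: (ge0_ler_powR p0 t1 (mulr_ge0 (ler0n R 2) t0)); lra.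
by rewrite powRM// ler_wpM2l ?powR_ge0// lerDr.
Qed.

Lemma coord_le_freq (xi : E) i : `|xi ord0 i| <= freq xi.
Proof.
have p1 : 1 <= 2 * pi :> R by have := @pi_ge2 R; move: pi => p ?; lra.
apply: le_trans (_ : enorm xi <= _); last first.
  by rewrite /freq ler_peMl// enorm_ge0.
rewrite -sqrtr_sqr ler_sqrt ?dotv_ge0// /dotv (bigD1 i)//= -expr2 lerDl.
by apply: sumr_ge0 => j _; rewrite -expr2 sqr_ge0.
Qed.

Let p := 2 * s / n%:R.

(* The product form reduces integrability on R^n to (1 + |t|)^-p on the line,
   where p = 2 s / n > 1. *)
Lemma resolvent_decay : exists2 C, 0 <= C & forall xi : E,
  (1 + freq xi `^ (2 * s)) * r xi <= C /\
  r xi <= C * \prod_(i < n) (1 + `|xi ord0 i|) `^ (- p).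
Proof.
have n0 : 0 < n%:R :> R by rewrite ltr0n.
have s2 : 0 <= 2 * s by rewrite mulr_ge0// ltW.
have p0 : 0 <= p by rewrite divr_ge0.
pose C0 := 1 + omega^-1; have C00 : 0 <= C0 by rewrite addr_ge0// invr_ge0 ltW.
have c2 : 1 <= 2 `^ (2 * s) :> R.
  have := @ler_powR R 2 (ler1n R 2) 0 (2 * s) s2; by rewrite powRr0.
have H1 xi : (1 + freq xi `^ (2 * s)) * r xi <= C0.
  rewrite ler_pdivrMr; last exact: den_gt0.
  have : 0 <= freq xi `^ (2 * s) / omega by rewrite divr_ge0 ?powR_ge0// ltW.
  have : omega^-1 * omega = 1 by rewrite mulVf// gt_eqF.
  rewrite /C0; move: (freq xi `^ (2 * s)) => F; move: (omega^-1) => w wo Fw.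
  have o0 := ltW omega_gt0; rewrite mulrDl mul1r mulrDr wo (mulrC w F); lra.
exists (2 `^ (2 * s) * C0) => [|xi]; first by rewrite mulr_ge0// powR_ge0.
split; first by apply: le_trans (H1 xi) _; rewrite ler_peMl.
pose P := \prod_(i < n) (1 + `|xi ord0 i|) `^ p.
have f0 := freq_ge0 xi; have f1 : 0 <= 1 + freq xi by rewrite addr_ge0.
have PV : \prod_(i < n) (1 + `|xi ord0 i|) `^ (- p) = P^-1.
  by rewrite -prodfV; apply: eq_bigr => i _; rewrite powRN.
have P0 : 0 < P by apply: prodr_gt0 => i _; rewrite powR_gt0// ltr_pwDl.
have PF : P <= 2 `^ (2 * s) * (1 + freq xi `^ (2 * s)).
  apply: le_trans (powR_add1_le f0 s2).
  rewrite (_ : 2 * s = p * n%:R); last by rewrite /p divfK// gt_eqF.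
  rewrite powRrM powR_mulrn ?powR_ge0// -[X in _ ^+ X]card_ord -prodr_const.
  apply: ler_prod => i _; rewrite powR_ge0/=.
  by apply: (ge0_ler_powR p0) => //; rewrite ?nnegrE ?addr_ge0// lerD2l coord_le_freq.
rewrite PV ler_pdivlMr//; apply: le_trans (ler_wpM2l (ltW (resolvent_gt0 xi)) PF) _.
by rewrite mulrCA ler_wpM2l ?powR_ge0// mulrC.
Qed.

Lemma Rint_resolvent : Int r.
Proof.
have n0 : 0 < n%:R :> R by rewrite ltr0n.
have p1 : 1 < p by rewrite /p ltr_pdivlMr// mul1r; move: s_gt; move: (n%:R : R) => x; lra.
have [C C0 HC] := resolvent_decay.
pose d (t : R) := (1 + `|t|) `^ (- p).
have md : measurable_fun setT d.
  by apply: (measurableT_comp (@measurable_powR R (- p))); apply: measurable_funD => //; exact: measurableT_comp.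
have iP : Int (fun xi : E => \prod_(i < n) d (xi ord0 i)).
  apply/ge0_RintP; first exact: measurable_prod_rV.
    by move=> xi; apply: prodr_ge0 => i _; exact: powR_ge0.
  by rewrite (@integral_prod_rV _ _ _ (2 / (p - 1))) ?ltry// => [t|]; [exact: powR_ge0|exact: integral_powR_decay].
apply: (le_Rint measurable_resolvent _ (RintZl C iP)) => xi.
by rewrite ger0_norm ?(ltW (resolvent_gt0 xi))//; have [] := HC xi.
Qed.

Lemma Rint_resolvent_sq : Int (fun xi => r xi ^+ 2).
Proof.
apply: (le_Rint _ _ (RintZl omega^-1 Rint_resolvent)) => [|xi].
  by apply: measurable_sqr; exact: measurable_resolvent.
have r0 := ltW (resolvent_gt0 xi).
by rewrite ger0_norm ?sqr_ge0// expr2 ler_wpM2r// resolvent_le.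
Qed.

Lemma green_transform : has_transform (fcos r) r.
Proof.
exact: (has_transform_fcos Rint_resolvent Rint_resolvent_sq resolventN).
Qed.

Lemma greenE : green s omega = fcos r.
Proof.
apply: (has_transform_uniq _ green_transform).
apply: (@xgetPex _ (fun=> 0) [set G | has_transform G r]).
by exists (fcos r); exact: green_transform.
Qed.

Lemma phase0 (x : E) : phase x 0 = 0.
Proof. by rewrite /phase /dotv big1 ?mulr0// => i _; rewrite mxE mulr0. Qed.

Lemma green0 : green s omega (0 : E) = \int[mu]_xi r xi.
Proof.
by rewrite greenE; apply: eq_Rintegral => x _; rewrite phase0 cos0 mulr1.
Qed.

(** With integral 0 the nonnegative [r] would vanish almost everywhere, and the whole space would be
    null since [r] is positive. Positivity is needed to add exponents of powers of this integral. *)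
Lemma Rintegral_resolvent_gt0 : 0 < \int[mu]_xi r xi.
Proof.
rewrite lt_neqAle Rintegral_ge0 ?andbT; last by move=> xi _; rewrite ltW// resolvent_gt0.
apply/eqP => /esym r0.
have mr : measurable_fun setT (EFin \o r) by apply/measurable_EFinP; exact: measurable_resolvent.
have /(ae_eq_integral_abs mu measurableT)[+ _] := mr.
rewrite (_ : (\int[mu]_(x in setT) _)%E = (\int[mu]_xi r xi)%:E); last first.
  rewrite EFin_Rintegral; last exact: Rint_resolvent.
  by apply: eq_integral => x _; rewrite /= ger0_norm// ltW// resolvent_gt0.
rewrite r0 => /(_ erefl) [N [mN N0 NT]].
have := @lebesgue_rV_open_gt0 R n setT openT (ex_intro _ 0 I).
suff -> : [set: E] = N by rewrite N0 ltxx.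
apply/esym/seteqP; split => // x _; apply: NT => /= /(_ I) [] rx.
by have := resolvent_gt0 x; rewrite rx ltxx.
Qed.

Lemma freq_power_half (xi : E) : (freq xi `^ (2 * (s / 2))) ^+ 2 = freq xi `^ (2 * s).
Proof. by rewrite -powR_mulrn ?powR_ge0// -powRrM; congr (_ `^ _); field. Qed.

Lemma freq_power_resolvent_le1 xi : freq xi `^ (2 * s) * r xi <= 1.
Proof. by rewrite ler_pdivrMr ?mul1r ?lerDl ?ltW//; exact: den_gt0. Qed.

(** * The profile and its pairing with a test function *)

Section profile.
Variable c : R.
Let phi (x : E) : R := c * fcos r x.

Lemma profile_has_transform : has_transform phi (fun xi => c * r xi).
Proof. exact: has_transformZ green_transform. Qed.

(** One of the two factors [r] in the square absorbs the Sobolev weight, which is at most a multiple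
    of 1 + freq^(2s); the other one is integrable. *)
Lemma profile_sobolev : sobolev s (Cfun phi).
Proof.
have [_ H] := profile_has_transform; exists (Cfun (fun xi => c * r xi)) => //.
have [C C0 HC] := resolvent_decay.
pose w xi := (1 + freq xi ^+ 2) `^ s * (c * r xi) ^+ 2.
have mr := measurable_resolvent.
have mw : measurable_fun setT w.
  apply: measurable_funM.
    apply: (measurableT_comp (@measurable_powR R s)); apply: measurable_funD => //.
    by apply: measurable_sqr; exact: measurable_freq.
  by apply: measurable_sqr; exact: measurable_funM.
have w0 xi : 0 <= w xi by rewrite mulr_ge0 ?sqr_ge0 ?powR_ge0.
rewrite (_ : (\int[mu]_xi _)%E = (\int[mu]_xi (w xi)%:E)%E); last first.
  by apply: eq_integral => xi _; rewrite /w normc2 /= expr0n addr0.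
apply/ge0_RintP => //.
apply: (le_Rint mw _ (RintZl (2 `^ s * c ^+ 2 * C) Rint_resolvent)) => xi.
rewrite (ger0_norm (w0 xi)) /w.
have F2 : (freq xi ^+ 2) `^ s = freq xi `^ (2 * s).
  by rewrite -powR_mulrn ?freq_ge0// -powRrM.
have := powR_add1_le (sqr_ge0 (freq xi)) (ltW s_gt0); rewrite F2 => h1.
have r0 := ltW (resolvent_gt0 xi); have [h2 _] := HC xi.
apply: (@le_trans _ _ (2 `^ s * (1 + freq xi `^ (2 * s)) * (c * r xi) ^+ 2)).
  by rewrite ler_wpM2r// sqr_ge0.
rewrite (_ : _ * (c * r xi) ^+ 2 = 2 `^ s * c ^+ 2 * ((1 + freq xi `^ (2 * s)) * r xi) * r xi).
  by rewrite ler_wpM2r// ler_wpM2l// mulr_ge0 ?powR_ge0 ?sqr_ge0.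
by rewrite exprMn expr2; move: (2 `^ s) (freq xi `^ (2 * s)) (r xi) => A B D; ring.
Qed.

Lemma L2_freq_profile :
  L2 (fun xi => (freq xi `^ (2 * (s / 2)))%:C * Cfun (fun xi => c * r xi) xi).
Proof.
rewrite (_ : (fun xi => _) = Cfun (fun xi => freq xi `^ (2 * (s / 2)) * (c * r xi))); last first.
  by apply/funext => xi; rewrite /Cfun [in RHS]rmorphM.
have mw : measurable_fun setT (fun xi => freq xi `^ (2 * (s / 2)) * (c * r xi)).
  apply: measurable_funM; first exact: measurable_freq_power.
  by apply: measurable_funM => //; exact: measurable_resolvent.
apply: L2_Cfun => //.
apply: (le_Rint (measurable_sqr mw) _ (RintZl (c ^+ 2) Rint_resolvent)) => xi.
rewrite ger0_norm ?sqr_ge0// !exprMn freq_power_half mulrCA ler_wpM2l ?sqr_ge0//.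
by rewrite expr2 mulrA ler_piMl ?freq_power_resolvent_le1// ltW// resolvent_gt0.
Qed.

Variable psi : E -> R.
Hypothesis tpsi : test_function psi.
Let K := closure [set x | psi x != 0].
Let spsi : smooth psi. Proof. by have [] := tpsi. Qed.
Let cpsi : continuous psi. Proof. exact: smooth_continuous. Qed.
Let cK : compact K. Proof. by have [] := tpsi. Qed.
Let psi0 x : ~ K x -> psi x = 0.
Proof.
by move=> Kx; apply/eqP/negPn/negP => px; apply: Kx; exact: subset_closure.
Qed.
Let pi1 : Int psi. Proof. by have [] := compact_support_Int cpsi cK psi0. Qed.
Let pi2 : Int (fun x => psi x ^+ 2).
Proof. by have [] := compact_support_Int cpsi cK psi0. Qed.
Let iw : Int (fun xi => freq xi `^ (2 * s) * power_spectrum psi xi).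
Proof. exact: Rint_freq_power n_gt0 (ltW s_gt0) spsi cK psi0. Qed.
Let iQ : Int (power_spectrum psi). Proof. exact: Rint_power_spectrum. Qed.

Lemma is_fourier_test : is_fourier (Cfun psi) (fun xi => fcos psi xi +i* - fsin psi xi).
Proof.
rewrite (_ : (fun xi => _) = fourier1 (Cfun psi)).
  by apply: is_fourier_fourier1; [exact: L1_Cfun|exact: (L2_Cfun (Rint_measurable pi1))].
by apply/funext => xi; rewrite fourier1_Cfun.
Qed.

(** Meant for [fcos psi] and [fsin psi]: their squares are controlled with the weight of
    [D = 1 / r], and [le_weighted_sqr] passes to first powers at the price of adding the integrable
    [r]. *)
Let Rint_spectrum (z : E -> R) : measurable_fun setT z ->
  (forall xi, z xi ^+ 2 <= power_spectrum psi xi) -> Int z.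
Proof.
move=> mz zQ.
apply: (le_Rint mz _ (RintD Rint_resolvent (RintD iw (RintZl omega iQ)))) => xi.
rewrite -mulrDl; apply: (le_weighted_sqr (den_gt0 xi) (resolventK xi)).
by rewrite real_normK ?num_real.
Qed.

Lemma Rint_fcos_test : Int (fcos psi).
Proof.
apply: Rint_spectrum => [|xi]; first exact: measurable_fcos.
by rewrite lerDl sqr_ge0.
Qed.

Lemma Rint_fsin_test : Int (fsin psi).
Proof.
apply: Rint_spectrum => [|xi]; first exact: measurable_fsin.
by rewrite lerDr sqr_ge0.
Qed.

Lemma L2_freq_test : L2 (fun xi => (freq xi `^ (2 * (s / 2)))%:C * (fcos psi xi +i* - fsin psi xi)).
Proof.
have mf := measurable_freq_power (2 * (s / 2)).
have mc := measurable_fcos pi1; have ms := measurable_fsin pi1.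
have bound (z : R) xi : z ^+ 2 <= power_spectrum psi xi ->
    `|(freq xi `^ (2 * (s / 2)) * z) ^+ 2| <= freq xi `^ (2 * s) * power_spectrum psi xi.
  by move=> zQ; rewrite ger0_norm ?sqr_ge0// exprMn freq_power_half ler_wpM2l// powR_ge0.
have ER xi : Re ((freq xi `^ (2 * (s / 2)))%:C * (fcos psi xi +i* - fsin psi xi)) =
    freq xi `^ (2 * (s / 2)) * fcos psi xi by rewrite cReM /= mul0r subr0.
have EI xi : Im ((freq xi `^ (2 * (s / 2)))%:C * (fcos psi xi +i* - fsin psi xi)) =
    freq xi `^ (2 * (s / 2)) * - fsin psi xi by rewrite cImM /= mul0r addr0.
have m1 : measurable_fun setT (fun xi => freq xi `^ (2 * (s / 2)) * fcos psi xi) by exact: measurable_funM.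
have m2 : measurable_fun setT (fun xi => freq xi `^ (2 * (s / 2)) * - fsin psi xi).
  by apply: measurable_funM => //; exact: measurable_funN.
apply/L2P; split.
- by split; [under eq_fun do rewrite ER|under eq_fun do rewrite EI].
- under eq_fun do rewrite ER; apply: (le_Rint (measurable_sqr m1) _ iw) => xi.
  by apply: bound; rewrite lerDl sqr_ge0.
- under eq_fun do rewrite EI; apply: (le_Rint (measurable_sqr m2) _ iw) => xi.
  by apply: bound; rewrite sqrrN lerDr sqr_ge0.
Qed.

Lemma profile_pairing :
  pairing (fraclap (s / 2) (Cfun phi)) (fraclap (s / 2) (Cfun psi)) +
  omega%:C * pairing (Cfun phi) (Cfun psi) = (c * psi 0)%:C.
Proof.
have [_ Hphi] := profile_has_transform; have Hpsi := is_fourier_test.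
have Fphi := fraclap_is_fourier Hphi L2_freq_profile.
have Fpsi := fraclap_is_fourier Hpsi L2_freq_test.
rewrite (parseval Fphi Fpsi) (parseval Hphi Hpsi).
have ic := Rint_fcos_test; have is_ := Rint_fsin_test.
have mr := measurable_resolvent.
have mT (p : R) : measurable_fun setT (fun xi : E => freq xi `^ p) := measurable_freq_power p.
pose F xi := c * (freq xi `^ (2 * s) * r xi); pose G xi := c * r xi.
have mF : measurable_fun setT F by apply: measurable_funM => //; exact: measurable_funM.
have mG : measurable_fun setT G by exact: measurable_funM.
have bF xi : `|F xi| <= `|c|.
  rewrite normrM ler_piMr// ger0_norm ?mulr_ge0 ?powR_ge0//; first exact: freq_power_resolvent_le1.
  by rewrite ltW// resolvent_gt0.
have bG xi : `|G xi| <= `|c| * omega^-1.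
  by rewrite normrM ler_wpM2l// ger0_norm ?resolvent_le// ltW// resolvent_gt0.
(* The equation on the frequency side: the two symbols add up to a constant, so no multiplier
   remains on the transform of [psi]. *)
have FG xi : F xi + omega * G xi = c.
  transitivity (c * ((freq xi `^ (2 * s) + omega) * r xi)); last by rewrite resolventK mulr1.
  by rewrite /F /G; move: (freq xi `^ (2 * s)) (r xi) => A B; ring.
have key (z : E -> R) : Int z ->
    \int[mu]_xi (z xi * F xi) + omega * \int[mu]_xi (z xi * G xi) = c * \int[mu]_xi z xi.
  move=> iz; have iF := RintM_bounded iz mF bF; have iG := RintM_bounded iz mG bG.
  rewrite -(RintegralZl _ measurableT iG) -(RintegralD measurableT iF (RintZl _ iG)).
  rewrite -(RintegralZl _ measurableT iz); apply: eq_Rintegral => xi _.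
  by rewrite -[in RHS](FG xi); move: (F xi) (G xi) (z xi) => A B D; ring.
(* Evenness of the frequency makes the reflection in Parseval's identity harmless, and the two half
   powers combine. *)
have W2 (xi : E) : freq (- xi) `^ (2 * (s / 2)) * freq xi `^ (2 * (s / 2)) = freq xi `^ (2 * s).
  by rewrite freqN -expr2 freq_power_half.
have E1 : pairing (fun xi => (freq (- xi) `^ (2 * (s / 2)))%:C * Cfun (fun xi => c * r xi) (- xi))
    (fun xi => (freq xi `^ (2 * (s / 2)))%:C * (fcos psi xi +i* - fsin psi xi)) =
    (\int[mu]_xi (fcos psi xi * F xi)) +i* (\int[mu]_xi (- fsin psi xi * F xi)).
  rewrite /pairing /Cintegral; congr (_ +i* _); apply: eq_Rintegral => xi _.
    rewrite !(cReM, cImM) /= resolventN /F -W2.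
    by move: (freq (- xi) `^ _) (freq xi `^ _) (r xi) (fcos psi xi) (fsin psi xi) => A B D e f; ring.
  rewrite !(cReM, cImM) /= resolventN /F -W2.
  by move: (freq (- xi) `^ _) (freq xi `^ _) (r xi) (fcos psi xi) (fsin psi xi) => A B D e f; ring.
have E2 : pairing (fun xi => Cfun (fun xi => c * r xi) (- xi))
    (fun xi => fcos psi xi +i* - fsin psi xi) =
    (\int[mu]_xi (fcos psi xi * G xi)) +i* (\int[mu]_xi (- fsin psi xi * G xi)).
  rewrite /pairing /Cintegral; congr (_ +i* _); apply: eq_Rintegral => xi _.
    rewrite !(cReM, cImM) /= resolventN /G.
    by move: (r xi) (fcos psi xi) (fsin psi xi) => D e f; ring.
  rewrite !(cReM, cImM) /= resolventN /G.
  by move: (r xi) (fcos psi xi) (fsin psi xi) => D e f; ring.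
rewrite E1 E2.
(* The imaginary part vanishes because the sine transform is odd. *)
have S0 : \int[mu]_xi (- fsin psi xi) = 0.
  apply: odd_Rintegral => [|xi]; first exact: RintN.
  by rewrite fsinN.
apply/eqP; rewrite eq_complex cReD cImD cReM cImM /= !mul0r subr0 addr0.
rewrite (key _ ic) (key _ (RintN is_)) S0 mulr0 eqxx andbT.
by rewrite (fourier_inversion0 cpsi cK psi0 ic).
Qed.

End profile.

End resolvent.

Local Close Scope complex_scope.

Theorem theorem1 (R : realType) (n : nat) (omega s sigma : R)
    (n_ge1 : (1 <= n)%N) (omega_gt0 : 0 < omega) (s_gt : n%:R / 2 < s)
    (sigma_gt0 : 0 < sigma) :
  let G : 'rV[R]_n -> R := green s omega in
  let phi_omega : 'rV[R]_n -> R :=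
    fun x => G x / G 0 `^ (1 + (2 * sigma)^-1) in
  (forall phi : 'rV[R]_n -> R,
     has_transform phi (profile_transform s omega sigma) <->
     (forall x, phi x = phi_omega x)) /\
  weak_solution s omega sigma phi_omega.
Proof.
move=> G phi_omega.
pose I := \int[lebesgue_rV R n]_xi resolvent_symbol s omega xi.
pose c := I `^ (- (1 + (2 * sigma)^-1)).
have I0 : 0 < I := Rintegral_resolvent_gt0 n_ge1 omega_gt0 s_gt.
have G0 : G 0 = I := green0 n_ge1 omega_gt0 s_gt.
have phiE : phi_omega = fun x => c * fcos (resolvent_symbol s omega) x.
  by apply/funext => x; rewrite /phi_omega G0 /c powRN mulrC /G greenE.
have H : has_transform phi_omega (profile_transform s omega sigma).
  by rewrite phiE; exact: profile_has_transform.
(* The equivalence of the two descriptions is uniqueness of the continuous function with a given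
   transform. *)
split=> [phi|].
  split=> [H'|/funext ->//].
  by rewrite (has_transform_uniq H' H).
split; first by have [] := H.
  by rewrite phiE; exact: profile_sobolev.
(* Only the occurrences inside the pairings are unfolded; the nonlinear term keeps the value at 0,
   computed next. *)
move=> psi tpsi; rewrite {1 2}phiE profile_pairing// -rmorphB.
have phi0 : phi_omega 0 = I `^ (- (2 * sigma)^-1).
  have -> : phi_omega 0 = c * I by rewrite /phi_omega G0 /c powRN mulrC.
  rewrite -[X in _ * X](powRr1 (ltW I0)) /c -powRD ?(gt_eqF I0) ?implybT//.
  by congr (_ `^ _); ring.
(* The exponent of [I] becomes - (2 sigma + 1) / (2 sigma) = - (1 + 1 / (2 sigma)), that of [c]. *)
have phi0c : `|phi_omega 0| `^ (2 * sigma) * phi_omega 0 = c.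
  rewrite ger0_norm phi0 ?powR_ge0// -powRrM -powRD ?(gt_eqF I0) ?implybT//.
  by congr (_ `^ _); field; rewrite gt_eqF.
by rewrite phi0c subrr.
Qed.
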